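(* Let $n$ and $k$ be positive integers. The cyclic group of order $2n$ acts on $\mathrm{T}(n,k)$ by the rotation $R$, and the triple \[\left(\mathrm{T}(n,k),\ \langle R\rangle,\ \frac{1+q^{n}}{[n-1]_q}\begin{bmatrix}n-1\\k-2\end{bmatrix}_q\begin{bmatrix}n\\k\end{bmatrix}_q\right)\] exhibits the cyclic sieving phenomenon.
   Context: Rooted plane trees: a plane tree is a finite tree with a counterclockwise cyclic order of the half-edges around each node, up to isomorphism (orientation-preserving homeomorphism). A corner is a sector between two consecutive half-edges around a node (a node of degree $d\ge1$ has $d$ corners). A rooted plane tree is a plane tree with one distinguished corner, the root corner. A leaf is a node of degree $1$ (graph degree; the root node counts as a leaf if it has degree $1$). A tree with $n$ edges has $2n$ corners. $\mathrm{T}(n,k)$ is the set of rooted plane trees with $n$ edges and $k$ leaves. Ordinary rotation $R$: it moves the root corner to the next corner in counterclockwise order around the tree. Precisely, identify a corner with the half-edge $h$ that follows it counterclockwise around its node; if $\alpha(h)$ is the other half of the same edge and $\sigma(h')$ is the half-edge following $h'$ counterclockwise around its node, then the corner after $h$ is $\sigma(\alpha(h))$. Then $R^{2n}=\mathrm{id}$ on trees with $n$ edges, and the cyclic group of order $2n$ acts with its generator acting as $R$ (the action need not be faithful; in particular the action of the group of order $2n$ is considered also when $n=1$). $q$-notation: $[M]_q=\frac{1-q^M}{1-q}$, $[M]_q!=[1]_q\cdots[M]_q$, $[0]_q!=1$, $\begin{bmatrix}M\\N\end{bmatrix}_q=\frac{[M]_q!}{[N]_q!\,[M-N]_q!}$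 for $0\le N\le M$, and it is $0$ if $N<0$ or $N>M$. Cyclic sieving phenomenon: given a set $S$ of combinatorial objects, an action on $S$ of a cyclic group $G$ of order $m$ with generator $g$, and a polynomial $P(q)$ with non-negative integer coefficients, the triple $(S,G,P)$ exhibits the cyclic sieving phenomenon if the number of elements of $S$ fixed by $g^e$ equals $P(\omega^e)$ for all primitive $m$-th roots of unity $\omega$ and all integers $e$. (Part of the assertion is that the given $P$ is a polynomial with non-negative integer coefficients.)
   Formalization: For n = 1 the displayed expression is undefined (0/0, since [0]_q = 0 and the product of q-binomials vanishes); there the polynomial is taken to be 1 if k = 2 and 0 otherwise. For n ≥ 2 the formula is exactly as stated. *)

(* Defs.v *)
From mathcomp Require Import all_boot all_order all_fingroup all_algebra.
From mathcomp Require Import all_solvable all_field.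

Set Implicit Arguments.
Unset Strict Implicit.
Unset Printing Implicit Defensive.

Import Order.TTheory GRing.Theory Num.Theory.

Local Open Scope ring_scope.

(** Rooted plane trees as combinatorial maps.

    A plane tree with n >= 1 edges is given by its 2n half-edges, labelled by
    'I_(2 * n), together with
    - sigma, sending a half-edge to the one following it counterclockwise
      around its node, so that nodes are the orbits of sigma;
    - alpha, exchanging the two halves of each edge.
    A corner is identified with the half-edge following it counterclockwise
    around its node; root_corner is the half-edge of the root corner. *)

Definition rooted_map (n : nat) : Type :=
  {perm 'I_(2 * n)} * {perm 'I_(2 * n)} * 'I_(2 * n).

Section RootedMaps.
Variable n : nat.
Implicit Types t u : rooted_map n.

Definition sigma t : {perm 'I_(2 * n)} := t.1.1.
Definition alpha t : {perm 'I_(2 * n)} := t.1.2.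
Definition root_corner t : 'I_(2 * n) := t.2.

Definition edge_pairing t : bool :=
  [forall h, (alpha t h != h) && (alpha t (alpha t h) == h)].

(** As every node carries a half-edge, connectedness of the graph can be
    tested on half-edges. *)
Definition connected t : bool :=
  [forall h, forall h',
     connect [rel x y | (y == sigma t x) || (y == alpha t x)] h h'].

(** A cycle of the graph, written as the sequence of half-edges through which
    it leaves its (pairwise distinct) nodes. The condition h' != alpha h
    forbids walking back along the edge just used. Loops are cycles of length
    1 and double edges are cycles of length 2. *)
Definition graph_cycle t (c : seq 'I_(2 * n)) : bool :=
  [&& c != [::],
      path.cycle [rel h h' | (h' \in porbit (sigma t) (alpha t h))
                             && (h' != alpha t h)] c
    & uniq [seq porbit (sigma t) h | h <- c]].

(** The length bound on c excludes no cycle, as the entries of a cycle are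
    pairwise distinct. *)
Definition acyclic t : bool :=
  [forall c : (2 * n).-bseq 'I_(2 * n), ~~ graph_cycle t c].

Definition is_tree t : bool := [&& edge_pairing t, connected t & acyclic t].

Definition nb_leaves t : nat :=
  #|[set v in porbits (sigma t) | #|v| == 1%N]|.

Definition isomorphic t u : bool :=
  [exists p : {perm 'I_(2 * n)},
    [&& [forall h, sigma u (p h) == p (sigma t h)],
        [forall h, alpha u (p h) == p (alpha t h)]
      & root_corner u == p (root_corner t)]].

Definition iso_class t : {set rooted_map n} := [set u | isomorphic t u].

Definition next_corner t : rooted_map n :=
  (sigma t, alpha t, sigma t (alpha t (root_corner t))).

(** next_corner commutes with isomorphisms, hence maps the isomorphism class
    of t onto that of next_corner t. *)
Definition rotation (X : {set rooted_map n}) : {set rooted_map n} :=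
  [set next_corner t | t in X].

Definition plane_trees (k : nat) : {set {set rooted_map n}} :=
  [set iso_class t | t in [pred t | is_tree t && (nb_leaves t == k)]].

End RootedMaps.

(** T(n, k), for n >= 1. *)
Definition rooted_plane_tree (n k : nat) : Type :=
  {X : {set rooted_map n} | X \in plane_trees n k}.

Section QAnalogues.
Variables (F : fieldType) (q : F).

Definition qint (m : nat) : F := (1 - q ^+ m) / (1 - q).

Definition qfact (m : nat) : F := \prod_(1 <= i < m.+1) qint i.

Definition qbinom (m : nat) (j : int) : F :=
  if (0 <= j <= m%:Z) then qfact m / (qfact `|j|%N * qfact (m - `|j|)%N)
  else 0.

End QAnalogues.

Definition qfrac : fieldType := {fraction {poly int}}.
Definition qvar : qfrac := tofrac ('X : {poly int}).

Definition qfrac_of_poly (P : {poly nat}) : qfrac :=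
  tofrac (map_poly (fun a : nat => a%:R : int) P).

(** For n = 1 and k >= 1 the general formula reads 0 / 0: both [0]_q and the
    product of the two q-binomials vanish. Writing the formula as
    (1 + q^n) [n]! [n-2]! / ([k]! [n-k]! [k-2]! [n-k+1]!) and cancelling the
    two factors [-1]! that appear when n = 1 and k = 2 gives 1; for n = 1 and
    k <> 2 there is no tree to count and the value is 0. *)
Definition sieving_fraction (n k : nat) : qfrac :=
  if n == 1%N then (k == 2%N)%:R
  else (1 + qvar ^+ n) / qint qvar n.-1
       * qbinom qvar n.-1 (k%:Z - 2) * qbinom qvar n k%:Z.

Definition expgz (gT : finGroupType) (g : gT) (e : int) : gT :=
  match e with
  | Posz a => (g ^+ a)%g
  | Negz a => (g ^- a.+1)%g
  end.

(** All complex roots of unity lie in algC. *)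
Definition cyclic_sieving (gT : finGroupType) (G : {group gT}) (g : gT)
    (S : finType) (to : action G S) (P : {poly nat}) : Prop :=
  generator G g /\
  forall (w : algC) (e : int), #|G|.-primitive_root w ->
    #|('Fix_to[expgz g e])%g|%:R
      = (map_poly (fun a : nat => a%:R : algC) P).[w ^ e].

(* Main.v *)
(** Walking around a rooted plane tree with n edges visits its 2n corners in
    cyclic order, and the pairs of half-edges of the edges then form a
    noncrossing perfect matching of Z/2n; the rotation of trees becomes the
    rotation of matchings, and leaves become chords of length 1. A matching
    fixed by the rotation by r < 2n, without a diameter, is encoded by the
    r-periodic word telling which half-edges open their chord the short way
    around, so that such matchings are counted by balanced cyclic words with a
    given number of peaks. A diameter, or for r = 2n a chord at a leaf, can be
    rotated to the root, which leaves Dyck words to count.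

    On the algebraic side let a = k - 2, b = n - k and [x = [a+b choose a]_q].
    The 2 x 2 minors
      A = x^2 - q [a+b choose a-1]_q [a+b choose a+1]_q   and
      B = x [a+b choose a+1]_q - q^2 [a+b choose a-1]_q [a+b choose a+2]_q
    satisfy (1 + q) P = (1 + q^n) (q^b (1 + q) A + B) for the required fraction
    P. The right-hand side vanishes at q = -1, hence P is a polynomial; its
    values at roots of unity follow from the q-Lucas theorem. Moreover
    (1 - q^(n+1)) P = (1 + q^n) (1 - q) f with
    f = [n+1 choose k]_q [n-2 choose k-2]_q, a symmetric polynomial that is
    unimodal by an sl_2 argument, and this forces the coefficients of P to be
    nonnegative. *)
Require Import Defs.
From mathcomp Require Import all_boot all_order all_fingroup all_algebra.
From mathcomp Require Import all_solvable all_field.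
From mathcomp Require Import zify ring.

Set Implicit Arguments.
Unset Strict Implicit.
Unset Printing Implicit Defensive.

Import Order.TTheory GRing.Theory Num.Theory.

(** * q-binomial coefficients *)

(** What shapes the counting is the choice of the half-edge that opens a chord: it has to commute
    with the rotation and to be recoverable from the matching. Cutting the circle at the root
    violates the former, and the shorter way around is undefined on a diameter. Under a rotation by
    [r < n] a diameter would cross its own image, and a diameter forces [n] to be odd, so the
    exceptional periods are [r = n] with [n] odd and [r = 2n]. There double counting takes over: a
    matching has exactly one diameter in the former case and [k] short chords in the latter. The
    algebra has matching exceptions. [[n+1]_q] vanishes at a [2n]-th root of unity only for [q = -1]
    and [n] odd; there [(1 + q^n) / (1 + q)] takes the value [n] and the minor [B] is left. At
    [q = 1] the minor [A] is the Narayana number counting matchings with a short chord at the root.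
    Half-edges are lifted from Z/2n to natural numbers, so that heights and crossings refer to a
    linear order; hypotheses such as [N <= x] leave room for one more period on the left. *)

Section QBinomials.
Local Open Scope ring_scope.

Section Generic.
Variables (R : comNzRingType) (q : R).

Definition qnum m : R := \sum_(i < m) q ^+ i.
Definition qfac m : R := \prod_(i < m) qnum i.+1.

(** Defined by the q-Pascal rule and not as a quotient of q-factorials, since the latter can vanish
    at roots of unity. *)
Fixpoint qbin (m j : nat) : R :=
  match m, j with
  | _, 0 => 1
  | 0, _.+1 => 0
  | m'.+1, j'.+1 => qbin m' j' + q ^+ j'.+1 * qbin m' j'.+1
  end.

Lemma qbinn0 m : qbin m 0 = 1. Proof. by case: m. Qed.

Lemma qbinSS m j : qbin m.+1 j.+1 = qbin m j + q ^+ j.+1 * qbin m j.+1.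
Proof. by []. Qed.

Lemma qbin_small m j : (m < j)%N -> qbin m j = 0.
Proof.
elim: m j => [|m IH] [|j] //=; rewrite ltnS => mj.
by rewrite !IH ?mulr0 ?addr0 // ltnW.
Qed.

Lemma qbinnn m : qbin m m = 1.
Proof. by elim: m => //= m ->; rewrite qbin_small // mulr0 addr0. Qed.

Lemma qnum0 : qnum 0 = 0. Proof. by rewrite /qnum big_ord0. Qed.

Lemma qnum1 : qnum 1 = 1. Proof. by rewrite /qnum big_ord1 expr0. Qed.

Lemma qnumS m : qnum m.+1 = qnum m + q ^+ m.
Proof. by rewrite /qnum big_ord_recr. Qed.

Lemma qnumD a b : qnum (a + b) = qnum a + q ^+ a * qnum b.
Proof.
elim: b => [|b IH]; first by rewrite addn0 qnum0 mulr0 addr0.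
by rewrite addnS !qnumS IH exprD; ring.
Qed.

Lemma qnumSl m : qnum m.+1 = 1 + q * qnum m.
Proof. by rewrite -add1n qnumD qnum1 expr1. Qed.

Lemma qfacS m : qfac m.+1 = qfac m * qnum m.+1.
Proof. by rewrite /qfac big_ord_recr. Qed.

Lemma qfac0 : qfac 0 = 1. Proof. by rewrite /qfac big_ord0. Qed.

Lemma qbin_fac a b : qbin (a + b) a * (qfac a * qfac b) = qfac (a + b).
Proof.
elim: {a b}(a + b)%N {-2}a {-2}b (erefl (a + b)%N) => [|n IH] a b.
  by case: a; case: b => // _; rewrite qfac0 !mulr1 qbinn0.
case: a b => [|a] [|b] //.
- by move=> _; rewrite add0n qbinn0 qfac0 !mul1r.
- by move=> _; rewrite addn0 qbinnn qfac0 mulr1 mul1r.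
move=> e; have [e1 e2] : n = (a + b.+1)%N /\ n = (a.+1 + b)%N by lia.
rewrite addSn qbinSS mulrDl -[in X in _ = X]addSn.
have -> : qbin (a + b.+1) a * (qfac a.+1 * qfac b.+1) = qfac (a + b.+1) * qnum a.+1.
  by rewrite -IH // qfacS; ring.
have -> : q ^+ a.+1 * qbin (a + b.+1) a.+1 * (qfac a.+1 * qfac b.+1) =
   qfac (a.+1 + b) * (q ^+ a.+1 * qnum b.+1).
  by rewrite -IH // addnS -addSn [qfac b.+1]qfacS; ring.
by rewrite !addSn !addnS -mulrDr -qnumD [in RHS]qfacS addSn addnS.
Qed.

Lemma qbinSSr n j i : (j + i)%N = n ->
  qbin n.+1 j.+1 = qbin n j.+1 + q ^+ i * qbin n j.
Proof.
elim: n j i => [|n IH] j i.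
  by case: j => //; case: i => //= _; ring.
case: j => [|j] e.
  have {e}-> : i = n.+1 by lia.
  rewrite [RHS](congr2 +%R (qbinSS _ _) (erefl _)) qbinSS (IH 0%N n) //.
  by rewrite !qbinn0 !exprS expr0; ring.
case: i e => [|i] e.
  have {e}-> : j = n by lia.
  by rewrite !qbinnn qbin_small // expr0; ring.
rewrite [RHS](congr2 +%R (qbinSS _ _) (congr1 _ (qbinSS _ _))).
rewrite qbinSS (IH j i.+1) ?(IH j.+1 i) ?exprS; [ring|lia|lia].
Qed.

End Generic.

Lemma rmorph_qnum (R R' : comNzRingType) (f : {rmorphism R -> R'}) q m :
  f (qnum q m) = qnum (f q) m.
Proof. by rewrite rmorph_sum; apply: eq_bigr => i _; rewrite rmorphXn. Qed.

Lemma rmorph_qbin (R R' : comNzRingType) (f : {rmorphism R -> R'}) q m j :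
  f (qbin q m j) = qbin (f q) m j.
Proof.
elim: m j => [|m IH] [|j] /=; rewrite ?rmorph1 ?rmorph0 //.
by rewrite rmorphD rmorphM rmorphXn !IH.
Qed.

Lemma qnum_one (R : comNzRingType) m : qnum (1 : R) m = m%:R.
Proof.
by rewrite /qnum (eq_bigr (fun=> 1)) => [|i _]; rewrite ?expr1n // sumr_const card_ord.
Qed.

Lemma qbin_one (R : comNzRingType) m j : qbin (1 : R) m j = 'C(m, j)%:R.
Proof.
elim: m j => [|m IH] [|j] //=.
by rewrite expr1n mul1r !IH binS natrD addrC.
Qed.

Lemma qnum_geom (R : comNzRingType) (q : R) m : (1 - q) * qnum q m = 1 - q ^+ m.
Proof.
elim: m => [|m IH]; first by rewrite qnum0 mulr0 expr0 subrr.
by rewrite qnumS mulrDr IH exprS; ring.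
Qed.

(** * q-binomials at primitive roots of unity *)

Section RootsOfUnity.
Variables (F : fieldType) (q : F) (d : nat).
Hypothesis prim_q : d.-primitive_root q.

Lemma qnum_prim_neq0 i : (0 < i < d)%N -> qnum q i != 0.
Proof.
case/andP=> i0 id; apply/eqP => qi0.
have := qnum_geom q i; rewrite qi0 mulr0 => /esym/eqP.
rewrite subr_eq0 eq_sym -(prim_order_dvd prim_q) => /dvdn_leq.
by move=> /(_ i0); rewrite leqNgt id.
Qed.

Lemma qnum_prim0 : (1 < d)%N -> qnum q d = 0.
Proof.
move=> d1; have := qnum_geom q d; rewrite (prim_expr_order prim_q) subrr.
move/eqP; rewrite mulf_eq0 => /orP[|/eqP //].
rewrite subr_eq0 eq_sym -[q]expr1 -(prim_order_dvd prim_q) dvdn1 => /eqP d1'.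
by rewrite d1' in d1.
Qed.

Lemma qfac_prim_neq0 i : (i < d)%N -> qfac q i != 0.
Proof.
move=> id; rewrite /qfac prodf_seq_neq0; apply/allP => j _ /=.
by apply: qnum_prim_neq0; rewrite /= (leq_trans _ id) // ltnS ltn_ord.
Qed.

Lemma qbin_prim_order j : qbin q d j = (j == 0)%:R + (j == d)%:R.
Proof.
have d0 := prim_order_gt0 prim_q.
case: (ltngtP j d) => [jd|dj|->].
- case: j jd => [|j] jd; first by rewrite qbinn0 addr0.
  rewrite addr0; have := qbin_fac q j.+1 (d - j.+1).
  rewrite subnKC ?(ltnW jd) // => e.
  have qd0 : qfac q d = 0.
    rewrite -(prednK d0) qfacS prednK // qnum_prim0 ?mulr0 //.
    by apply: leq_ltn_trans jd.
  move/eqP: e; rewrite qd0 !mulf_eq0 (negbTE (qfac_prim_neq0 jd)).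
  rewrite (negbTE (qfac_prim_neq0 _)) ?orbF; last by rewrite ltn_subrL d0.
  by move/eqP.
- by rewrite qbin_small // addr0; case: j dj.
- by rewrite qbinnn; case: (d) d0 => // d' _; rewrite add0r.
Qed.

(** Row [d] of the q-Pascal triangle is 1, 0, ..., 0, 1 at a primitive [d]-th root of unity, so
    going down by [d] rows acts on columns [d] apart like one step in Pascal's triangle. The q-Lucas
    theorem is the iteration of this. *)
Lemma qbin_prim_shift m j :
  qbin q (m + d) j = qbin q m j + (if (d <= j)%N then qbin q m (j - d) else 0).
Proof.
have d0 := prim_order_gt0 prim_q.
elim: m j => [|m IH] j.
  rewrite add0n qbin_prim_order; case: j => [|j].
    by rewrite leqNgt d0 (ltn_eqF d0) qbinn0.
  rewrite [qbin q 0 j.+1]/(0 : F) !add0r; have [jd|dj|<-] := ltngtP j.+1 d; first by [].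
    by rewrite qbin_small // subn_gt0.
  by rewrite subnn.
case: j => [|j]; first by rewrite !qbinn0 leqNgt d0 addr0.
rewrite addSn !qbinSS !IH.
have [dj|jd] := leqP d j.
  rewrite (leqW dj) subSn // qbinSS.
  have -> : q ^+ j.+1 = q ^+ (j - d).+1.
    by rewrite -subSn // -{1}(subnK (leqW dj)) exprD (prim_expr_order prim_q) mulr1.
  ring.
case: (ltngtP d j.+1) => [|dj|e]; first by rewrite ltnS leqNgt jd.
  by rewrite !addr0.
rewrite -e subnn !qbinn0 (prim_expr_order prim_q); ring.
Qed.

Lemma qbin_lucas m j a b : (a < d)%N -> (b < d)%N ->
  qbin q (m * d + a) (j * d + b) = 'C(m, j)%:R * qbin q a b.
Proof.
move=> ad bd; elim: m j => [|m IH] j.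
  case: j => [|j]; first by rewrite !mul0n !add0n mul1r.
  rewrite qbin_small ?mul0r // mul0n add0n mulSn -addnA.
  by apply: leq_trans ad (leq_addr _ _).
rewrite mulSn -addnA addnC qbin_prim_shift IH.
case: j => [|j]; first by rewrite leqNgt bd addr0 !bin0.
by rewrite mulSn -addnA leq_addr addKn IH binS natrD mulrDl.
Qed.

End RootsOfUnity.
End QBinomials.

(** * Unimodality of a product of two q-binomial coefficients *)

Section Unimodality.
Local Open Scope ring_scope.

(** By hypothesis the matrix [K] restricted to rows [X] and columns [Y] has independent rows, so its
    rank [#|X|] is at most its number of columns. *)
Lemma leq_card_inj_kernel (T : finType) (X Y : {set T}) (K : T -> T -> rat) :
    (forall v : T -> rat, (forall x, x \notin X -> v x = 0) ->
       (forall y, y \in Y -> \sum_x v x * K x y = 0) -> forall x, v x = 0) ->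
  (#|X| <= #|Y|)%N.
Proof.
move=> Kinj.
pose M := \matrix_(i < #|X|, j < #|Y|) K (enum_val i) (enum_val j).
suff /eqP <- : row_free M by apply: rank_leq_col.
apply: inj_row_free => v vM0.
pose w x : rat := \sum_(i < #|X|) v 0 i * (enum_val i == x)%:R.
have wE (f : T -> rat) : \sum_x w x * f x = \sum_i v 0 i * f (enum_val i).
  under eq_bigr => x _ do rewrite mulr_suml.
  rewrite exchange_big /=; apply/eq_bigr => i _.
  rewrite (bigD1 (enum_val i)) //= eqxx mulr1 big1 ?addr0 // => x xi.
  by rewrite eq_sym (negbTE xi) mulr0 mul0r.
have w0 : forall x, w x = 0.
  apply: Kinj => [x xX|y yY].
    rewrite /w big1 // => i _; case: eqP => [ix|_]; last by rewrite mulr0.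
    by rewrite -ix enum_valP in xX.
  rewrite wE; have := congr1 (fun A : 'rV_#|Y| => A 0 (enum_rank_in yY y)) vM0.
  rewrite !mxE => vM0y; apply: etrans vM0y; apply: eq_bigr => i _.
  by rewrite mxE enum_rankK_in.
apply/rowP => i; rewrite mxE -(w0 (enum_val i)) /w.
rewrite (bigD1 i) //= eqxx mulr1 big1 ?addr0 // => j ji.
by rewrite (inj_eq enum_val_inj) (negbTE ji) mulr0.
Qed.

(** * Raising and lowering operators on graded functions *)

Section Sl2.
Variables (T : finType) (L : nat -> {set T}) (U D : (T -> rat) -> T -> rat).
Variables (K : T -> T -> rat) (s : nat).

Definition supported (v : T -> rat) (X : {set T}) := forall x, x \notin X -> v x = 0.

Hypothesis U_kernel : forall v y, U v y = \sum_x v x * K x y.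
Hypothesis D_scale : forall v (c : rat) y, D (fun x => c * v x) y = c * D v y.
Hypothesis ext_D : forall u v, u =1 v -> D u =1 D v.
Hypothesis L_U : forall v i, supported v (L i) -> supported (U v) (L i.+1).
Hypothesis L_D : forall v i, supported v (L i.+1) -> supported (D v) (L i).
Hypothesis L_D0 : forall v, supported v (L 0) -> forall x, D v x = 0.
Hypothesis commDU : forall v i, supported v (L i) ->
  forall x, U (D v) x = D (U v) x - (s%:R - (2 * i)%:R) * v x.

(* If [U v = 0] then [U (D^(j+1) v)] is a nonzero multiple of [D^j v], so [v] is
   recovered, up to a nonzero factor, from [D^(i+1) v = 0]. *)
Lemma sl2_injective v i : (2 * i < s)%N -> supported v (L i) ->
  (forall x, U v x = 0) -> forall x, v x = 0.
Proof.
move=> lt_i vL Uv0.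
(* [h t] is the weight of level [i - t]. The scalars met on the way down are, up to sign, the
   partial sums [c] of these positive numbers, hence nonzero. *)
pose h t : rat := s%:R - (2 * (i - t))%:R.
pose c j := \sum_(t < j) h t.
have h_gt0 t : 0 < h t.
  by rewrite /h subr_gt0 ltr_nat; apply: leq_ltn_trans lt_i; rewrite leq_mul2l leq_subr.
have suppD j : (j <= i)%N -> supported (iter j D v) (L (i - j)).
  elim: j => [|j IH] ji; first by rewrite subn0.
  by rewrite iterS; apply: L_D; rewrite subnSK //; apply: IH; apply: ltnW.
have UD j : (j <= i)%N -> forall x, U (iter j.+1 D v) x = - c j.+1 * iter j D v x.
  elim: j => [|j IH] ji x.
    rewrite /= (commDU vL) /c big_ord1 /h subn0.
    have -> : D (U v) x = 0.
      have e : U v =1 (fun x => 0 * v x) by move=> z; rewrite Uv0 mul0r.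
      by rewrite (ext_D e) D_scale mul0r.
    by rewrite add0r mulNr.
  rewrite iterS (commDU (suppD _ ji)).
  rewrite (ext_D (IH (ltnW ji))) D_scale -[D (iter j D v) x]/(iter j.+1 D v x).
  by rewrite -mulrBl -opprD [c j.+2]/c big_ord_recr.
have Dzero : forall x, iter i.+1 D v x = 0.
  move=> x; rewrite iterS; apply: L_D0; have := suppD i (leqnn i).
  by rewrite subnn.
have U0 w : (forall x, w x = 0) -> forall x, U w x = 0.
  by move=> w0 x; rewrite U_kernel big1 // => y _; rewrite w0 mul0r.
suff dn j : (j <= i.+1)%N -> forall x, iter (i.+1 - j) D v x = 0.
  by have := dn i.+1 (leqnn _); rewrite subnn.
elim: j => [|j IH] ji; first by rewrite subn0.
move=> x; rewrite subSS.
have := UD (i - j)%N (leq_subr _ _) x.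
rewrite (_ : (i - j).+1 = (i.+1 - j)%N); last by rewrite subSn.
rewrite (U0 _ (IH (ltnW ji))) => /esym/eqP.
rewrite mulf_eq0 oppr_eq0 => /orP[|/eqP //].
rewrite gt_eqF // /c subSn // big_ord_recr /=.
apply: ltr_wpDl (h_gt0 _).
by apply: sumr_ge0 => t _; apply: ltW.
Qed.

Lemma sl2_unimodal i : (2 * i < s)%N -> (#|L i| <= #|L i.+1|)%N.
Proof.
move=> lt_i; apply: (@leq_card_inj_kernel _ _ _ K) => v vL vK.
apply: (sl2_injective lt_i vL) => x.
have [xL|xL] := boolP (x \in L i.+1); first by rewrite U_kernel vK.
exact: (L_U vL).
Qed.
End Sl2.

(** * Particles hopping along bonds *)

Section Hopping.
Variables (S E : finType) (src dst : E -> S) (beta : E -> rat).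
Hypotheses (src_inj : injective src) (dst_inj : injective dst).

(** Exchanging the two sites is an involution on all sets; [up_ok] and [down_ok] select the case
    where a particle really moves. They describe the set after the move, because [hop_up v B]
    collects the values of [v] at the sets from which [B] is reached. *)
Definition hop e (B : {set S}) : {set S} := [set x | tperm (src e) (dst e) x \in B].
Definition up_ok e (B : {set S}) := (dst e \in B) && (src e \notin B).
Definition down_ok e (B : {set S}) := (src e \in B) && (dst e \notin B).

Definition hop_up (v : {set S} -> rat) B := \sum_e (up_ok e B)%:R * v (hop e B).
Definition hop_down (v : {set S} -> rat) B :=
  \sum_e (down_ok e B)%:R * (beta e * v (hop e B)).

Lemma hopK e : involutive (hop e).
Proof. by move=> B; apply/setP => x; rewrite !inE tpermK. Qed.

(** By injectivity distinct bonds share neither sources nor targets. If the target of one is the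
    source of the other, that site is in the wrong state for the second move and both sides vanish;
    otherwise the two transpositions have disjoint supports. *)
Lemma hop_commute e e' B v : e != e' ->
  (up_ok e B)%:R * ((down_ok e' (hop e B))%:R * v (hop e' (hop e B))) =
  (down_ok e' B)%:R * ((up_ok e (hop e' B))%:R * v (hop e (hop e' B))) :> rat.
Proof.
move=> ee'; have ne1 : src e != src e' by rewrite (inj_eq src_inj).
have ne2 : dst e != dst e' by rewrite (inj_eq dst_inj).
rewrite !mulrA -!natrM !mulnb.
have [s1|s1] := eqVneq (src e') (dst e).
  rewrite /up_ok /down_ok !inE s1 tpermR -s1 tpermL.
  by case: (src e \in B); case: (dst e' \in B); rewrite /= ?andbF /= ?mul0r.
have [s2|s2] := eqVneq (dst e') (src e).
  rewrite /up_ok /down_ok !inE s2 tpermL -s2 tpermR.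
  by case: (src e' \in B); case: (dst e \in B); rewrite /= ?andbF /= ?mul0r.
have d1 : tperm (src e) (dst e) (src e') = src e' by rewrite tpermD // eq_sym.
have d2 : tperm (src e) (dst e) (dst e') = dst e' by rewrite tpermD // eq_sym.
have d3 : tperm (src e') (dst e') (src e) = src e by rewrite tpermD // eq_sym.
have d4 : tperm (src e') (dst e') (dst e) = dst e by rewrite tpermD // eq_sym.
rewrite /up_ok /down_ok !inE d1 d2 d3 d4.
congr (((_ : bool) : nat)%:R * v _); first by rewrite andbC.
apply/setP => x; rewrite !inE; congr (_ \in B).
rewrite -!permM; congr (fun p : {perm S} => p x).
by apply/commgP/conjg_fixP; rewrite tpermJ ?d1 ?d2 ?d3 ?d4.
Qed.
End Hopping.
End Unimodality.

Section ParticleHopping.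
Local Open Scope ring_scope.
Variables (S E : finType) (src dst : E -> S) (beta : E -> rat) (pos : S -> nat).
Hypotheses (src_inj : injective src) (dst_inj : injective dst).
Hypothesis pos_dst : forall e, pos (dst e) = (pos (src e)).+1.

Lemma src_neq_dst e : src e != dst e.
Proof. by apply/eqP => sd; have := pos_dst e; rewrite -sd; lia. Qed.

Definition weight (B : {set S}) : nat := \sum_(x in B) pos x.

Lemma hop_upE e B : up_ok src dst e B -> hop src dst e B = src e |: (B :\ dst e).
Proof.
case/andP=> dB sB; apply/setP => x; rewrite !inE.
case: tpermP => [->|->|/eqP xs /eqP xd].
- by rewrite dB eqxx.
- by rewrite (negbTE sB) eqxx eq_sym (negbTE (src_neq_dst e)).
- by rewrite (negbTE xs) xd.
Qed.

Lemma hop_downE e B : down_ok src dst e B -> hop src dst e B = dst e |: (B :\ src e).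
Proof.
case/andP=> sB dB; apply/setP => x; rewrite !inE.
case: tpermP => [->|->|/eqP xs /eqP xd].
- by rewrite (negbTE dB) eqxx (negbTE (src_neq_dst e)).
- by rewrite sB eqxx.
- by rewrite (negbTE xd) xs.
Qed.

Lemma weight_up e B : up_ok src dst e B -> weight B = (weight (hop src dst e B)).+1.
Proof.
move=> ok; rewrite (hop_upE ok); case/andP: ok => dB sB.
rewrite /weight big_setU1 ?inE ?(negbTE sB) ?andbF //=.
by rewrite (big_setD1 _ dB) /= pos_dst.
Qed.

Lemma weight_down e B : down_ok src dst e B -> weight (hop src dst e B) = (weight B).+1.
Proof.
move=> ok; rewrite (hop_downE ok); case/andP: ok => sB dB.
rewrite /weight big_setU1 ?inE ?(negbTE dB) ?andbF //=.
by rewrite (big_setD1 _ sB) /= pos_dst.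
Qed.

Variables (P : pred {set S}) (s : nat).
Hypothesis P_hop : forall e B,
  up_ok src dst e B || down_ok src dst e B -> P (hop src dst e B) = P B.
Hypothesis charge : forall B, P B ->
  \sum_e beta e * ((src e \in B)%:R - (dst e \in B)%:R) = s%:R - (2 * weight B)%:R.

Definition level i := [set B | P B & weight B == i].

(** In the commutator of [hop_up] and [hop_down] the terms with two distinct bonds cancel by
    [hop_commute]. Those with a repeated bond add up, apart from the sign, to the left-hand side of
    [charge], which is the weight that [sl2_unimodal] asks for. *)
Lemma level_unimodal i : (2 * i < s)%N -> (#|level i| <= #|level i.+1|)%N.
Proof.
pose K x y : rat := \sum_e ((up_ok src dst e y) && (x == hop src dst e y))%:R.
apply: (@sl2_unimodal _ level (hop_up src dst) (hop_down src dst beta) K).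
- move=> v y; rewrite /hop_up /K; under [RHS]eq_bigr => x _ do rewrite mulr_sumr.
  rewrite exchange_big /=; apply: eq_bigr => e _.
  rewrite (bigD1 (hop src dst e y)) //= eqxx andbT mulrC big1 ?addr0 // => x ne.
  by rewrite (negbTE ne) andbF mulr0.
- move=> v c y; rewrite /hop_down mulr_sumr; apply: eq_bigr => e _; ring.
- by move=> u v uv y; apply: eq_bigr => e _; rewrite uv.
- move=> v j vL y; rewrite inE => yL; rewrite /hop_up big1 // => e _.
  case ok: (up_ok src dst e y); last by rewrite mul0r.
  rewrite vL ?mulr0 // inE; apply: contra yL.
  by rewrite P_hop ?ok // (weight_up ok) eqSS.
- move=> v j vL y; rewrite inE => yL; rewrite /hop_down big1 // => e _.
  case ok: (down_ok src dst e y); last by rewrite mul0r.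
  rewrite vL ?mulr0 // inE; apply: contra yL.
  by rewrite P_hop ?ok ?orbT // (weight_down ok) eqSS.
- move=> v vL y; rewrite /hop_down big1 // => e _.
  case ok: (down_ok src dst e y); last by rewrite mul0r.
  by rewrite vL ?mulr0 // inE (weight_down ok) andbF.
move=> v j vL B.
(* Off the level [charge] does not give the right weight, but there the repeated bonds only
   contribute multiples of [v B = 0]. *)
have [BL|BL] := boolP (B \in level j); last first.
  rewrite (vL _ BL) mulr0 subr0.
  rewrite /hop_up /hop_down.
  under eq_bigr => e _ do rewrite mulr_sumr.
  under [RHS]eq_bigr => e _ do rewrite !mulr_sumr.
  rewrite [RHS]exchange_big /=; apply: eq_bigr => e _; apply: eq_bigr => e' _.
  have [<-{e'}|ee'] := eqVneq e e'.
    rewrite hopK (vL _ BL) !mulr0 ?mulr0 //.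
  have := @hop_commute _ _ _ _ src_inj dst_inj e e' B v ee'.
  rewrite [beta e' * (_ * _)]mulrCA ![_ * (beta e' * _)]mulrCA => ->; ring.
move: (BL); rewrite inE => /andP[PB /eqP wB].
rewrite -{1}wB -(charge PB) mulr_suml.
rewrite /hop_up /hop_down.
under eq_bigr => e _ do rewrite mulr_sumr.
under [X in _ = X - _]eq_bigr => e _ do rewrite !mulr_sumr.
rewrite [X in _ = X - _]exchange_big /= -sumrB; apply: eq_bigr => e _.
rewrite [in LHS](bigD1 e) //= [in RHS](bigD1 e) //= hopK -!addrA.
set X := \sum_(_ | _) _; set Y := \sum_(_ | _) _.
have -> : X = Y.
  apply: eq_bigr => e' e'e; rewrite eq_sym in e'e.
  have := @hop_commute _ _ _ _ src_inj dst_inj e e' B v e'e.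
  rewrite [beta e' * (_ * _)]mulrCA ![_ * (beta e' * _)]mulrCA => ->; ring.
rewrite /up_ok /down_ok !inE tpermL tpermR.
case: (src e \in B); case: (dst e \in B); rewrite /=; ring.
Qed.
End ParticleHopping.

(** * Subsets of two intervals and products of two q-binomials *)

Section TwoIntervals.
Local Open Scope ring_scope.

(** The q-binomial theorem: both sides are the coefficient of [T^j] in the product of the factors
    [1 + q^i T], expanded over subsets on the left and by the q-Pascal rule on the right. *)
Lemma gauss_sets N j :
  \sum_(A : {set 'I_N} | #|A| == j) 'X^(\sum_(x in A) x)
    = 'X^('C(j, 2)) * qbin 'X N j :> {poly int}.
Proof.
pose c M i : {poly int} := 'X^('C(i, 2)) * qbin 'X M i.
have cS M i : c M.+1 i.+1 = c M i.+1 + 'X^M * c M i.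
  rewrite /c; have [iM|Mi] := leqP i M; last first.
    by rewrite !qbin_small ?mulr0 ?addr0 // ltnS ltnW.
  rewrite (@qbinSSr _ _ M i (M - i)) ?subnKC // binS bin1 addnC.
  have -> : 'X^M = 'X^(M - i) * 'X^i :> {poly int} by rewrite -exprD subnK.
  rewrite exprD; ring.
have coef_prod M : \prod_(i < M) (1 + ('X^i)%:P * 'X) = \sum_(i < M.+1) (c M i)%:P * 'X^i.
  elim: M => [|M IH].
    by rewrite big_ord0 big_ord1 /c qbinn0 bin_small // !expr0 !mulr1.
  rewrite big_ord_recr /= {}IH mulrDr mulr1 [RHS]big_ord_recl /=.
  rewrite [X in X + _ = _]big_ord_recl [X in _ + X = _]mulr_suml -addrA; congr (_ + _).
    by rewrite /c !qbinn0.
  under [RHS]eq_bigr => i _ do rewrite /bump add1n cS polyCD mulrDl.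
  rewrite big_split /=; congr (_ + _).
    rewrite [RHS]big_ord_recr /= [X in _ = _ + X](_ : _ = 0) ?addr0 //.
    by rewrite /c qbin_small ?mulr0 ?mul0r.
  by apply: eq_bigr => i _; rewrite [('X^M * _)%:P]polyCM exprS; ring.
have := coef_prod N.
under eq_bigr => i _ do rewrite addrC.
rewrite bigA_distr => /(congr1 (fun p : {poly {poly int}} => p`_j)).
rewrite !coef_sum => e.
have termE (A : {set 'I_N}) :
    (\prod_(i < N) (if i \in A then ('X^i)%:P * 'X else 1))
    = ('X^(\sum_(x in A) x))%:P * 'X^#|A| :> {poly {poly int}}.
  rewrite -big_mkcond big_split /= prodr_const; congr (_ * _).
  by rewrite -rmorph_prod /= -expr_sum.
rewrite -/(c N j); transitivity (\sum_(i < N.+1) ((c N i)%:P * 'X^i)`_j); last first.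
  have [jN|Nj] := ltnP j N.+1.
    rewrite (bigD1 (Ordinal jN)) //= coefCM coefXn eqxx mulr1 big1 ?addr0 // => i.
    by rewrite -val_eqE /= coefCM coefXn eq_sym => /negbTE ->; rewrite mulr0.
  rewrite big1 => [|i _]; first by rewrite /c qbin_small ?mulr0.
  rewrite coefCM coefXn gtn_eqF ?mulr0 //; exact: leq_trans (ltn_ord i) Nj.
rewrite -e [LHS]big_mkcond; apply: eq_bigr => A _.
by rewrite termE coefCM coefXn eq_sym; case: eqP; rewrite ?mulr1 ?mulr0.
Qed.

Variables (a b k l : nat).
Local Notation site := ('I_a.+1 + 'I_b.+1)%type.
Local Notation bond := ('I_a + 'I_b)%type.

Definition bond_src (e : bond) : site :=
  match e with
  | inl i => inl (widen_ord (leqnSn a) i) | inr i => inr (widen_ord (leqnSn b) i)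
  end.
Definition bond_dst (e : bond) : site :=
  match e with inl i => inl (lift ord0 i) | inr i => inr (lift ord0 i) end.
(** The coefficients of the lowering operator in the irreducible sl_2-representations of dimensions
    [a + 1] and [b + 1]: the numbers [c x = (x + 1)(m - x)] satisfy [c x - c (x - 1) = m - 2 x], as
    [charge] demands. Configurations index a basis of the product of a [k]-th and an [l]-th exterior
    power; no signs arise, as particles on a line keep their order. *)
Definition bond_weight (e : bond) : rat :=
  match e with inl i => (i.+1 * (a - i))%:R | inr i => (i.+1 * (b - i))%:R end.
Definition site_pos (x : site) : nat := match x with inl i => i | inr i => i end.
Definition site_left (x : site) : nat := match x with inl _ => 1 | inr _ => 0 end.
Definition site_right (x : site) : nat := match x with inl _ => 0 | inr _ => 1 end.
Definition site_rev (x : site) : site :=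
  match x with inl i => inl (rev_ord i) | inr i => inr (rev_ord i) end.
(* Up to a power of [q], the product of the q-binomials [[a+1 choose k]_q] and
   [[b+1 choose l]_q] counts the configurations by weight. *)
Definition configuration (B : {set site}) :=
  (\sum_(x in B) site_left x == k)%N && (\sum_(x in B) site_right x == l)%N.

Local Notation lvl := (level site_pos configuration).

Lemma interval_charge m (g : 'I_m.+1 -> rat) :
  \sum_(i < m) (i.+1 * (m - i))%:R * (g (widen_ord (leqnSn m) i) - g (lift ord0 i))
  = \sum_(x < m.+1) (m%:R - (2 * x)%:R) * g x.
Proof.
pose c x : rat := (x.+1 * (m - x))%:R; pose c' x : rat := (x * (m.+1 - x))%:R.
transitivity (\sum_(x < m.+1) c x * g x - \sum_(x < m.+1) c' x * g x).
  rewrite [X in _ = X - _]big_ord_recr [X in _ = _ - X]big_ord_recl /= /c /c'.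
  rewrite subnn muln0 mul0r addr0 mul0n mul0r add0r -sumrB.
  by apply: eq_bigr => i _; rewrite mulrBr.
rewrite -sumrB; apply: eq_bigr => x _; rewrite -mulrBl; congr (_ * _).
have xm : (x <= m)%N by rewrite -ltnS.
rewrite /c /c' subSn //; move: {x}(nat_of_ord x) xm => x xm.
rewrite -[in RHS](subnKC xm); move: (m - x)%N => y; rewrite !natrM !natrD; ring.
Qed.

Lemma sum_site (R : nmodType) (F : site -> R) (B : {set site}) :
  \sum_(x in B) F x = \sum_i (F (inl i) *+ (inl i \in B)) + \sum_j (F (inr j) *+ (inr j \in B)).
Proof.
rewrite big_mkcond big_sumType /=; congr (_ + _); apply: eq_bigr => i _;
  by case: (_ \in B); rewrite ?mulr1n ?mulr0n.
Qed.

Lemma configuration_hop e B :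
  up_ok bond_src bond_dst e B || down_ok bond_src bond_dst e B ->
  configuration (hop bond_src bond_dst e B) = configuration B.
Proof.
have posd e' : site_pos (bond_dst e') = (site_pos (bond_src e')).+1 by case: e'.
have inv (f : site -> nat) : f (bond_src e) = f (bond_dst e) ->
    up_ok bond_src bond_dst e B || down_ok bond_src bond_dst e B ->
    (\sum_(x in hop bond_src bond_dst e B) f x = \sum_(x in B) f x)%N.
  move=> fe /orP[] ok; [rewrite (hop_upE posd ok) | rewrite (hop_downE posd ok)];
    case/andP: ok => i1 /negbTE i2;
    by rewrite big_setU1 ?inE ?i2 ?andbF //= ?fe -?fe (big_setD1 _ i1) ?fe.
by move=> ok; rewrite /configuration !inv //; case: (e).
Qed.

Lemma charge_site B : configuration B ->
  \sum_e bond_weight e * ((bond_src e \in B)%:R - (bond_dst e \in B)%:R)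
    = (k * a + l * b)%:R - (2 * weight site_pos B)%:R.
Proof.
case/andP=> /eqP <- /eqP <-.
rewrite big_sumType /= (interval_charge (fun i => (inl i \in B)%:R)).
rewrite (interval_charge (fun i => (inr i \in B)%:R)).
rewrite natrM natrD !natrM /weight !natr_sum !sum_site /=.
rewrite !(big1 _ _ (fun=> 0 *+ _)) => [|i _|i _]; rewrite ?mul0rn //.
have split_sum m (g : 'I_m.+1 -> bool) : \sum_(x < m.+1) (m%:R - (2 * x)%:R) * (g x)%:R
    = (\sum_(x < m.+1) 1 *+ g x) * m%:R - 2 * (\sum_(x < m.+1) x%:R *+ g x) :> rat.
  rewrite mulr_suml mulr_sumr -sumrB; apply: eq_bigr => x _.
  by rewrite natrM; case: (g x); rewrite ?mulr1n ?mulr0n; ring.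
by rewrite addr0 add0r !split_sum; ring.
Qed.

Lemma level_mono i : (2 * i < k * a + l * b)%N -> (#|lvl i| <= #|lvl i.+1|)%N.
Proof.
apply: (@level_unimodal _ _ bond_src bond_dst bond_weight).
- by move=> [i1|i1] [i2|i2] //= [] e; congr (_ _); apply: val_inj.
- by move=> [i1|i1] [i2|i2] //= [] e; congr (_ _); apply: val_inj.
- by case.
- exact: configuration_hop.
- exact: charge_site.
Qed.

Definition config_rev (B : {set site}) : {set site} := [set x | site_rev x \in B].

Lemma config_revK : involutive config_rev.
Proof. by move=> B; apply/setP => -[x|x]; rewrite !inE /= rev_ordK. Qed.

Lemma site_revK : involutive site_rev.
Proof. by case=> x; rewrite /= rev_ordK. Qed.

Lemma sum_config_rev (f : site -> nat) B :
  \sum_(x in config_rev B) f x = \sum_(x in B) f (site_rev x).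
Proof.
rewrite (reindex_inj (inv_inj site_revK)); apply: eq_bigl => x.
by rewrite inE site_revK.
Qed.

Lemma config_rev_configuration B : configuration (config_rev B) = configuration B.
Proof.
rewrite /configuration !sum_config_rev.
by congr (_ && _); congr (_ == _); apply: eq_bigr => -[].
Qed.

Lemma weight_rev B : configuration B ->
  (weight site_pos B + weight site_pos (config_rev B) = k * a + l * b)%N.
Proof.
case/andP=> /eqP <- /eqP <-; rewrite /weight sum_config_rev -big_split !big_distrl /=.
rewrite -big_split /=; apply: eq_bigr => -[i|i] _ /=; rewrite ?mul1n ?mul0n ?addn0 ?add0n;
  by rewrite subSS subnKC // -ltnS.
Qed.

Lemma level_sym i : (i <= k * a + l * b)%N -> #|lvl i| = #|lvl (k * a + l * b - i)%N|.
Proof.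
move=> i_le.
have sub j j' : (j + j' = k * a + l * b)%N -> (#|lvl j| <= #|lvl j'|)%N.
  move=> jj'; rewrite -(card_imset _ (inv_inj config_revK)); apply: subset_leq_card.
  apply/subsetP => _ /imsetP[B BL ->]; move: BL; rewrite !inE config_rev_configuration.
  case/andP=> cB /eqP wB; rewrite cB /=; have := weight_rev cB; rewrite wB; lia.
by apply/eqP; rewrite eqn_leq !sub // ?subnKC ?subnK.
Qed.

Lemma level_gt i : (k * a + l * b < i)%N -> #|lvl i| = 0%N.
Proof.
move=> lt_i; apply/eqP; rewrite cards_eq0; apply/eqP/setP => B; rewrite !inE.
apply/negbTE/andP => -[cB /eqP wB]; have := weight_rev cB; rewrite wB; lia.
Qed.

Lemma card_level i :
  (#|lvl i|%:R : int) =
  ('X^('C(k, 2) + 'C(l, 2)) * (qbin 'X a.+1 k * qbin 'X b.+1 l))`_i.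
Proof.
have -> : 'X^('C(k, 2) + 'C(l, 2)) * (qbin 'X a.+1 k * qbin 'X b.+1 l) =
    \sum_(B : {set site} | configuration B) 'X^(weight site_pos B) :> {poly int}.
  have -> : 'X^('C(k, 2) + 'C(l, 2)) * (qbin 'X a.+1 k * qbin 'X b.+1 l) =
    ('X^('C(k, 2)) * qbin 'X a.+1 k) * ('X^('C(l, 2)) * qbin 'X b.+1 l) :> {poly int}.
    by rewrite exprD; ring.
  rewrite -!gauss_sets big_distrlr /= pair_big /=.
  pose h (p : {set 'I_a.+1} * {set 'I_b.+1}) : {set site} :=
    [set x | match x with inl i => i \in p.1 | inr j => j \in p.2 end].
  pose h' (B : {set site}) : {set 'I_a.+1} * {set 'I_b.+1} :=
    ([set i | inl i \in B], [set j | inr j \in B]).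
  have hK : cancel h h'.
    by case=> A1 A2; rewrite /h /h' /=; congr (_, _); apply/setP => x; rewrite !inE.
  have h'K : cancel h' h by move=> B; apply/setP => -[x|x]; rewrite !inE.
  rewrite [RHS](reindex h); last by exists h' => x _; [apply: hK | apply: h'K].
  have sumh (f : site -> nat) p : (\sum_(x in h p) f x =
      \sum_(i in p.1) f (inl i) + \sum_(j in p.2) f (inr j))%N.
    rewrite big_mkcond big_sumType /= [X in (_ = X + _)%N]big_mkcond.
    rewrite [X in (_ = _ + X)%N]big_mkcond /=.
    by congr (_ + _)%N; apply: eq_bigr => x _; rewrite inE.
  apply: eq_big => [p|p _]; last by rewrite -exprD /weight sumh.
  by rewrite /configuration !sumh /= !sum1_card !big1 // addn0 add0n.
rewrite coef_sum -sum1_card natr_sum big_mkcond [RHS]big_mkcond /=.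
apply: eq_bigr => B _; rewrite inE coefXn eq_sym.
by case: (configuration B); rewrite ?andbF //=; case: eqP.
Qed.
End TwoIntervals.

Section GaussUnimodal.
Local Open Scope ring_scope.
Variables (a b k l : nat).
Hypotheses (ka : (k <= a.+1)%N) (lb : (l <= b.+1)%N).
Let f : {poly int} := qbin 'X a.+1 k * qbin 'X b.+1 l.
Let deg := (k * (a.+1 - k) + l * (b.+1 - l))%N.

(** ['C(k, 2) + 'C(l, 2)] is the least weight of a configuration, by which the levels are shifted
    against the coefficients of [f]. The identity matches the two centres of symmetry. *)
Lemma gauss_top : (k * a + l * b = deg + 2 * ('C(k, 2) + 'C(l, 2)))%N.
Proof.
have half j m : (j <= m.+1)%N -> (j * m = j * (m.+1 - j) + 2 * 'C(j, 2))%N.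
  rewrite mulnC -mulnC => jm; rewrite [(2 * _)%N]mulnC -[2%N]/(2`!) bin_ffact ffactnS ffactn1 -mulnDr.
  case: j jm => // j jm; congr muln; lia.
by rewrite mulnDr (half k) // (half l) // /deg; lia.
Qed.

Lemma coef_gauss i : f`_i = #|level (@site_pos a b) (@configuration a b k l) (i + ('C(k, 2) + 'C(l, 2)))%N|%:R.
Proof. by rewrite card_level coefXnM ltnNge leq_addl /= addnK. Qed.

Lemma gauss_mono i : (2 * i < deg)%N -> f`_i <= f`_i.+1.
Proof.
by move=> i_lt; rewrite !coef_gauss ler_nat level_mono // gauss_top; lia.
Qed.

Lemma gauss_sym i : (i <= deg)%N -> f`_i = f`_(deg - i).
Proof.
move=> i_le; rewrite !coef_gauss level_sym; last by rewrite gauss_top; lia.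
by congr (#|level _ _ _|%:R); rewrite gauss_top; lia.
Qed.

Lemma gauss_gt i : (deg < i)%N -> f`_i = 0.
Proof.
move=> i_gt; rewrite coef_gauss.
set w := (i + _)%N; have [w_le|w_gt] := leqP w (k * a + l * b); last by rewrite level_gt.
rewrite level_sym // card_level coefXnM ifT //.
by move: w_le; rewrite /w gauss_top; lia.
Qed.
End GaussUnimodal.

(** * The sieving polynomial *)

Section SievingPolynomial.
Local Open Scope ring_scope.
Local Notation q := ('X : {poly int}).

Lemma qnumX_neq0 i : qnum q i.+1 != 0.
Proof.
apply/eqP => /(congr1 (fun p : {poly int} => p.[1])).
rewrite -horner_evalE rmorph_qnum /= horner_evalE hornerX qnum_one horner0.
by move/eqP; rewrite pnatr_eq0.
Qed.

Lemma qfacX_neq0 i : qfac q i != 0.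
Proof. by rewrite prodf_seq_neq0; apply/allP => j _; apply: qnumX_neq0. Qed.

Lemma qbinX_next m j : qbin q m j.+1 * qnum q j.+1 = qbin q m j * qnum q (m - j).
Proof.
have [jm|mj] := ltnP j m; last first.
  rewrite qbin_small ?ltnS // mul0r.
  by move: mj; rewrite -subn_eq0 => /eqP ->; rewrite qnum0 mulr0.
have [i e] : exists i, m = (j + i.+1)%N by exists (m - j.+1)%N; lia.
apply: (mulIf (mulf_neq0 (qfacX_neq0 j) (qfacX_neq0 i))).
have := qbin_fac q j i.+1; have := qbin_fac q j.+1 i.
rewrite addSn -addnS -e (_ : (m - j)%N = i.+1) ?e ?addKn // !qfacS => e1 e2.
transitivity (qfac q m); rewrite e; [rewrite -e1|rewrite -e2]; rewrite -?e; ring.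
Qed.

Lemma qbinX_top m j : (j <= m)%N ->
  qbin q m.+1 j * qnum q (m.+1 - j) = qbin q m j * qnum q m.+1.
Proof.
move=> jm; have [i e] : exists i, m = (j + i)%N by exists (m - j)%N; rewrite subnKC.
apply: (mulIf (mulf_neq0 (qfacX_neq0 j) (qfacX_neq0 i))).
have := qbin_fac q j i.+1; have := qbin_fac q j i.
rewrite addnS -e subSn // (_ : (m - j)%N = i) ?e ?addKn // -e !qfacS => e1 e2.
transitivity (qfac q m * qnum q m.+1); [rewrite -e2|rewrite -e1]; ring.
Qed.

Variables (a b : nat).
Let n := (a + b).+2.
Let x := qbin q (a + b) a.
Let xp := qbin q (a + b) a.+1.
Let xpp := qbin q (a + b) a.+2.
Let xm := if a is a'.+1 then qbin q (a + b) a' else 0.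

(** By [narayanaqE] this is the q-Narayana number with parameters [n - 1] and [a + 1]; the form as a
    minor makes it visibly a polynomial. *)
Definition narayanaq : {poly int} := x ^+ 2 - q * (xm * xp).
Definition binq_minor : {poly int} := x * xp - q ^+ 2 * (xm * xpp).

Let xpE : xp * qnum q a.+1 = x * qnum q b.
Proof. by rewrite /xp qbinX_next addKn. Qed.

Let xppE : xpp * qnum q a.+2 = xp * qnum q b.-1.
Proof. by rewrite /xpp qbinX_next; congr (_ * qnum q _); lia. Qed.

Let xmE : xm * qnum q b.+1 = x * qnum q a.
Proof.
rewrite /xm /x; case: (a) => [|a']; first by rewrite qnum0 mul0r mulr0.
by rewrite qbinX_next; congr (_ * qnum q _); lia.
Qed.

Lemma narayanaqE : narayanaq * (qnum q a.+1 * qnum q b.+1) = qnum q (a + b).+1 * x ^+ 2.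
Proof.
transitivity (x ^+ 2 * (qnum q a.+1 * qnum q b.+1) -
   q * ((xm * qnum q b.+1) * (xp * qnum q a.+1))); first by rewrite /narayanaq; ring.
rewrite xpE xmE addnC -addnS qnumD (qnumSl _ a) (qnumS _ b); ring.
Qed.

Lemma binq_minorE : binq_minor * (qnum q a.+2 * qnum q a.+1 * qnum q b.+1) =
  (1 + q) * qnum q (a + b).+1 * qnum q b * x ^+ 2.
Proof.
transitivity (x * (xp * qnum q a.+1) * (qnum q a.+2 * qnum q b.+1) -
   q ^+ 2 * ((xm * qnum q b.+1) * ((xpp * qnum q a.+2) * qnum q a.+1))).
  by rewrite /binq_minor; ring.
have -> : xpp * qnum q a.+2 * qnum q a.+1 = x * qnum q b * qnum q b.-1.
  by rewrite xppE mulrAC xpE.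
rewrite xpE xmE.
have [-> | [b' ->]] : b = 0%N \/ exists b', b = b'.+1 by case: (b); [left|right; eexists].
  by rewrite qnum0; ring.
rewrite /= addnC addSn -!addnS qnumD (qnumSl _ a.+1) (qnumSl _ a).
rewrite (qnumS _ b'.+1) (qnumS _ b') exprS; ring.
Qed.

(** The coefficients make the two minors combine through [[b] + q^b [a+2] = [n]], and leave only
    [binq_minor] at [q = -1]. *)
Definition sieving_num : {poly int} := q ^+ b * (1 + q) * narayanaq + binq_minor.

Lemma sieving_numE : sieving_num * (qnum q a.+2 * qnum q a.+1 * qnum q b.+1) =
  (1 + q) * (qnum q (a + b).+1 * qnum q n * x ^+ 2).
Proof.
rewrite /sieving_num mulrDl binq_minorE.
transitivity (q ^+ b * (1 + q) * qnum q a.+2 * (narayanaq * (qnum q a.+1 * qnum q b.+1))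
  + (1 + q) * qnum q (a + b).+1 * qnum q b * x ^+ 2); first by ring.
have -> : n = (b + a.+2)%N by rewrite /n; lia.
by rewrite narayanaqE qnumD; ring.
Qed.

Let one_q_neq0 : 1 + q != 0.
Proof.
apply/eqP => /(congr1 (fun p : {poly int} => p.[1])).
by rewrite !hornerE.
Qed.

Lemma root_binq_minor : ~~ odd n -> binq_minor.[-1] = 0.
Proof.
move=> n_even.
have e : binq_minor * qnum q a.+2 = (1 + q) * qnum q b * narayanaq.
  apply: (mulIf (mulf_neq0 (qnumX_neq0 a) (qnumX_neq0 b))).
  have -> : binq_minor * qnum q a.+2 * (qnum q a.+1 * qnum q b.+1) =
    binq_minor * (qnum q a.+2 * qnum q a.+1 * qnum q b.+1) by ring.
  by rewrite binq_minorE -[RHS]mulrA narayanaqE; ring.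
have qm j : (qnum q j).[-1] = (odd j)%:R.
  elim: j => [|j IH]; first by rewrite qnum0 horner0.
  by rewrite qnumS hornerD IH hornerXn -signr_odd /=; case: odd.
have double j : qnum q (j * 2) = (1 + q) * qnum (q ^+ 2) j.
  elim: j => [|j IH]; first by rewrite !qnum0 mulr0.
  by rewrite mulSn addnC qnumD IH (qnumS (q ^+ 2)) -exprM mulnC
    [qnum q 2]qnumSl qnum1; ring.
(* For odd [a] the factor [[a+2]] is 1 at -1, and [1 + q] kills the other side. For even [a] both
   sides of [e] contain [1 + q]; once it is cancelled, [[b]] vanishes at -1 because [b] is even
   too. *)
have [a_odd|a_even] := boolP (odd a).
  have := congr1 (fun p : {poly int} => p.[-1]) e.
  rewrite !hornerM qm /= a_odd /= mulr1 => ->.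
  by rewrite hornerD hornerX hornerC subrr !mul0r.
have a2 : a.+2 = (a.+2./2 * 2)%N.
  by rewrite muln2 -[LHS]odd_double_half /= (negbTE a_even).
have b_even : ~~ odd b by move: n_even; rewrite /n /= negbK oddD (negbTE a_even).
have e' : binq_minor * qnum (q ^+ 2) a.+2./2 = qnum q b * narayanaq.
  by apply: (mulfI one_q_neq0); rewrite mulrCA -double -a2 e mulrA.
have := congr1 (fun p : {poly int} => p.[-1]) e'.
rewrite !hornerM qm (negbTE b_even) mul0r -!horner_evalE rmorph_qnum /= => /eqP.
rewrite mulf_eq0 => /orP[/eqP //|].
by rewrite horner_evalE hornerXn sqrrN expr1n qnum_one pnatr_eq0.
Qed.

Lemma sieving_poly_exists :
  exists P : {poly int}, (1 + q) * P = (1 + q ^+ n) * sieving_num.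
Proof.
suff /factor_theorem [P PE] : root ((1 + q ^+ n) * sieving_num) (-1).
  by exists P; rewrite PE mulrC polyCN opprK addrC.
rewrite rootM; have [n_odd|n_even] := boolP (odd n).
  by rewrite /root hornerD hornerC hornerXn -signr_odd n_odd expr1 subrr eqxx.
rewrite orbC /root hornerD !hornerM hornerD hornerX hornerC subrr.
by rewrite root_binq_minor // mulr0 mul0r addr0 eqxx.
Qed.
End SievingPolynomial.

Section SievingPolynomialProperties.
Local Open Scope ring_scope.
Local Notation q := ('X : {poly int}).

(* The recurrence for the coefficients of [P] is solved upwards on the increasing
   half of [f], and downwards on the decreasing half. *)
Lemma quotient_coef_ge0 (f P : {poly int}) (n deg : nat) :
    (forall i, 0 <= f`_i) ->
    (forall i, (2 * i < deg)%N -> f`_i <= f`_i.+1) ->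
    (forall i, (i <= deg)%N -> f`_i = f`_(deg - i)) ->
    (forall i, (deg < i)%N -> f`_i = 0) ->
    (1 - q ^+ n.+1) * P = (1 + q ^+ n) * ((1 - q) * f) ->
  forall i, 0 <= P`_i.
Proof.
move=> f_ge0 f_mono f_sym f_gt PE.
pose h i := ((1 - q) * f)`_i.
have hE i : h i = f`_i - (if i is i'.+1 then f`_i' else 0).
  by rewrite /h mulrBl mul1r coefB coefXM; case: i.
have h_ge0 i : (2 * i <= deg.+1)%N -> 0 <= h i.
  rewrite hE; case: i => [|i] le_i; first by rewrite subr0.
  by rewrite subr_ge0; apply: f_mono; lia.
have h_le0 i : (deg.+1 <= 2 * i)%N -> h i <= 0.
  case: i => [|i] le_i; first by lia.
  rewrite hE subr_le0; have [gt_i|i_le] := ltnP deg i.+1; first by rewrite f_gt.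
  rewrite f_sym // (f_sym i); last by lia.
  rewrite (_ : (deg - i = (deg - i.+1).+1)%N); last by lia.
  have [e|e] : (2 * (deg - i.+1) < deg)%N \/ (2 * (deg - i.+1) = deg)%N by lia.
    exact: f_mono.
  by lia.
have P_rec i : P`_(i) = (if (i < n.+1)%N then 0 else P`_(i - n.+1)) + h i
    + (if (i < n)%N then 0 else h (i - n)%N).
  have := congr1 (fun p : {poly int} => p`_i) PE.
  rewrite mulrBl mulrDl !mul1r coefB coefD !coefXnM -![((1 - q) * f)`_ _]/(h _) => e.
  by rewrite -addrA -e addrC subrK.
move=> i; have [le_i|lt_i] := leqP (2 * i) deg.
  elim/ltn_ind: i le_i => i IH le_i; rewrite P_rec.
  apply: addr_ge0; first apply: addr_ge0; last 1 first.
  - by case: ltnP => // _; apply: h_ge0; lia.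
  - by case: ltnP => // ?; apply: IH; lia.
  - by apply: h_ge0; lia.
(* [c] bounds the distance from [i] to the size of [P], where the downward recurrence starts from
   zero coefficients; each step by [n + 1] shortens it. *)
have [c ge_c] : exists c, (size P <= i + c)%N by exists (size P); lia.
elim/ltn_ind: c i lt_i ge_c => c IH i lt_i ge_c.
have [size_i|i_size] := leqP (size P) i; first by rewrite nth_default.
have := P_rec (i + n.+1)%N.
rewrite ifF ?ifF ?addnK; [|lia|lia].
rewrite (_ : (i + n.+1 - n)%N = i.+1); last by lia.
move=> e.
have -> : P`_i = P`_(i + n.+1) - h (i + n.+1)%N - h i.+1 by rewrite e; ring.
rewrite -addrA -opprD subr_ge0; apply: le_trans (_ : 0 <= _).
  by rewrite -[0]addr0; apply: lerD; apply: h_le0; lia.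
have [c0|c0] := posnP c; first by lia.
by apply: (IH (c - n.+1)%N); lia.
Qed.

Variables (a b : nat) (P : {poly int}).
Let n := (a + b).+2.
Hypothesis PE : (1 + q) * P = (1 + q ^+ n) * sieving_num a b.

Let one_q_neq0 : 1 + q != 0.
Proof. by apply/eqP => /(congr1 (fun p : {poly int} => p.[1])); rewrite !hornerE. Qed.

Let qcX := qnumX_neq0.

Lemma sieving_polyE : P * (qnum q a.+2 * qnum q a.+1 * qnum q b.+1) =
  (1 + q ^+ n) * (qnum q (a + b).+1 * qnum q n * qbin q (a + b) a ^+ 2).
Proof.
by apply: (mulfI one_q_neq0); rewrite mulrA PE -[LHS]mulrA sieving_numE; ring.
Qed.

Lemma sieving_poly_fraction : P * qnum q n.-1 =
  (1 + q ^+ n) * (qbin q n.-1 a * qbin q n a.+2).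
Proof.
apply: (mulIf (mulf_neq0 (mulf_neq0 (qcX a.+1) (qcX a)) (qcX b))).
rewrite mulrAC sieving_polyE.
have e1 := @qbinX_top (a + b) a (leq_addr _ _).
have e2 := @qbinX_next n a.+1; have e3 := @qbinX_next n a.
have e4 := @qbinX_top (a + b).+1 a (leqW (leq_addr _ _)).
rewrite (_ : ((a + b).+1 - a = b.+1)%N) in e1; last by lia.
rewrite (_ : (n - a.+1 = b.+1)%N) in e2; last by rewrite /n; lia.
rewrite (_ : (n - a = b.+2)%N) in e3; last by rewrite /n; lia.
rewrite (_ : ((a + b).+2 - a = b.+2)%N) in e4; last by lia.
transitivity ((1 + q ^+ n) * ((qbin q n.-1 a * qnum q b.+1) *
   (qbin q n a.+2 * qnum q a.+2 * qnum q a.+1))); last by ring.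
have -> : qbin q n a.+2 * qnum q a.+2 * qnum q a.+1 =
    qbin q (a + b) a * qnum q (a + b).+1 * qnum q n.
  by rewrite e2 mulrAC e3 e4 mulrAC e1.
rewrite e1; ring.
Qed.

Lemma sieving_poly_product : P * qnum q n.+1 =
  (1 + q ^+ n) * (qbin q n.+1 a.+2 * qbin q (a + b) a).
Proof.
apply: (mulIf (qcX (a + b))).
apply: etrans (_ : P * qnum q n.-1 * qnum q n.+1 = _); first by rewrite /=; ring.
rewrite sieving_poly_fraction.
have e1 := @qbinX_top (a + b) a (leq_addr _ _).
rewrite (_ : ((a + b).+1 - a = b.+1)%N) in e1; last by lia.
have e2 := @qbinX_top n a.+2 (leq_addr _ _).
rewrite (_ : (n.+1 - a.+2 = b.+1)%N) in e2; last by rewrite /n; lia.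
transitivity ((1 + q ^+ n) * (qbin q n.-1 a * (qbin q n a.+2 * qnum q n.+1))); first by ring.
rewrite -e2.
transitivity ((1 + q ^+ n) * (qbin q n.-1 a * qnum q b.+1 * qbin q n.+1 a.+2)); first by ring.
by rewrite e1; ring.
Qed.

Lemma sieving_poly_ge0 i : 0 <= P`_i.
Proof.
(* The unimodality results are stated for rows of the form [b' + 1]. For [a + b = 0] the q-binomial
   is 1, and it is replaced by the entry 1 at column 0 of row 1. *)
have [b' [l' [lb' fE degE]]] : exists b' l', [/\ (l' <= b'.+1)%N,
    qbin q (a + b) a = qbin q b'.+1 l' & (l' * (b'.+1 - l') = a * b)%N].
  case ab: (a + b)%N => [|m].
    by exists 0%N, 0%N; split; rewrite ?qbinn0 //; case: (a) ab.
  by exists m, a; split; [lia| | rewrite -ab addKn].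
have ka : (a.+2 <= n.+1)%N by rewrite /n; lia.
apply: (@quotient_coef_ge0 (qbin q n.+1 a.+2 * qbin q b'.+1 l') P n).
- by move=> j; rewrite coef_gauss // ler0n.
- by move=> j; apply: gauss_mono.
- by move=> j; apply: gauss_sym.
- by move=> j; apply: gauss_gt.
rewrite -qnum_geom -mulrA [_ * P]mulrC sieving_poly_product fE; ring.
Qed.

Lemma sieving_poly_narayana : P * qnum q a.+2 = (1 + q ^+ n) * (qnum q n * narayanaq a b).
Proof.
apply: (mulIf (mulf_neq0 (qcX a) (qcX b))).
transitivity (P * (qnum q a.+2 * qnum q a.+1 * qnum q b.+1)); first by ring.
transitivity ((1 + q ^+ n) * qnum q n * (narayanaq a b * (qnum q a.+1 * qnum q b.+1)));
  last by ring.
by rewrite sieving_polyE narayanaqE; ring.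
Qed.

Lemma sieving_poly_one :
  P.[1] * a.+2%:R = 2 * n%:R * (narayanaq a b).[1].
Proof.
have := congr1 (fun p : {poly int} => p.[1]) sieving_poly_narayana.
rewrite !hornerM hornerD hornerC hornerXn expr1n -!horner_evalE !rmorph_qnum /=.
by rewrite !horner_evalE hornerX !qnum_one => ->; ring.
Qed.

(** For odd [n] the factor [1 + q] in [PE] divides [1 + q^n]; the quotient is the q-number of [n] at
    [- q], which becomes [n]. *)
Lemma sieving_poly_minus1 : odd n -> P.[-1] = n%:R * (binq_minor a b).[-1].
Proof.
move=> n_odd.
have geom : 1 + q ^+ n = (1 + q) * qnum (- q) n.
  by have := qnum_geom (- q) n; rewrite opprK exprNn -signr_odd n_odd expr1 mulN1r opprK.
have -> : P = qnum (- q) n * sieving_num a b.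
  by apply: (mulfI one_q_neq0); rewrite PE geom mulrA.
rewrite hornerM -horner_evalE rmorph_qnum /= horner_evalE hornerN hornerX opprK qnum_one.
congr (_ * _); rewrite /sieving_num hornerD !hornerM [in X in X + _]hornerD hornerX hornerC.
by rewrite subrr mulr0 mul0r add0r.
Qed.
End SievingPolynomialProperties.

(** * Plane trees as noncrossing matchings *)

Section Trees.
Variable n : nat.
Implicit Types t u : rooted_map n.
Local Notation dart := 'I_(2 * n).

Section Tree.
Variable t : rooted_map n.
Local Notation s := (sigma t).
Local Notation al := (alpha t).
Hypothesis pairing : edge_pairing t.

Lemma alpha_neq h : al h != h.
Proof. by have /forallP/(_ h)/andP[] := pairing. Qed.

Lemma alphaK : involutive al.
Proof. by move=> h; have /forallP/(_ h)/andP[_ /eqP] := pairing. Qed.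

(* Its connected components are those of the graph without the edge of [h]. *)
Definition step_off (h : dart) : rel dart :=
  [rel x y | (y \in porbit s x) || [&& y == al x, x != h & x != al h]].

Lemma step_off_sym h : connect_sym (step_off h).
Proof.
apply: sym_connect_sym => x y; rewrite /step_off /= porbit_sym; congr (_ || _).
have -> : (x == al y) = (y == al x) by apply/eqP/eqP => ->; rewrite alphaK.
case: (eqVneq y (al x)) => //= ->; rewrite (inj_eq (inv_inj alphaK)) andbC.
by rewrite -(inj_eq (inv_inj alphaK) (al x) h) alphaK.
Qed.

Lemma step_off_alpha h : step_off (al h) =2 step_off h.
Proof. by move=> x y; rewrite /step_off /= alphaK [(x != _) && (x != h)]andbC. Qed.

Definition node_step_off (h : dart) : rel {set dart} :=
  [rel A B | [exists x, [&& x != h, x != al h, porbit s x == A & porbit s (al x) == B]]].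

(** Lifts a simple path of nodes to the half-edges through which it leaves them, ready to be closed
    up into a [graph_cycle]. The last hypothesis rules out turning back along the edge of [y]:
    either the node of [y] is not visited again, or [y] is [h], whose edge the path avoids. *)
Lemma node_path h A (p : seq {set dart}) (y : dart) :
    path (node_step_off h) A p -> uniq (A :: p) -> last A p = porbit s h ->
    porbit s (al y) = A -> y != al h -> (porbit s y \notin p) || (y == h) ->
  exists xs : seq dart,
    [/\ path [rel a b | (b \in porbit s (al a)) && (b != al a)] y (rcons xs h)
      & map (porbit s) xs = belast A p].
Proof.
elim: p A y => [|B p IH] A y /=.
  move=> _ _ Ah yA yh _; exists [::]; split=> //=.
  by rewrite yA Ah porbit_id -(inj_eq (inv_inj alphaK)) alphaK eq_sym yh.
case/andP=> /existsP[x /and4P[xh xah /eqP xA /eqP xB]] pB /andP[A_notin uB] lastB yA yh y_new.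
have [|xs [pxs nodes_xs]] := IH B x pB uB lastB xB xah.
  by rewrite xA; move: A_notin; rewrite inE negb_or => /andP[_ ->].
exists (x :: xs); rewrite /= nodes_xs xA; split=> //; rewrite pxs andbT.
rewrite yA -xA porbit_id /=; apply/eqP => xy.
case/orP: y_new => [|/eqP yh']; last by rewrite xy yh' eqxx in xah.
by rewrite inE -xB xy alphaK eqxx.
Qed.

Hypothesis no_cycle : acyclic t.

Lemma acyclic_seq c : ~~ graph_cycle t c.
Proof.
apply/negP => cyc; have uc : uniq c by case/and3P: cyc => _ _ /map_uniq.
have size_c : size c <= 2 * n by have := max_card (mem c); rewrite (card_uniqP uc) card_ord.
by have /forallP/(_ (Bseq size_c)) := no_cycle; rewrite cyc.
Qed.

(** A connection avoiding the edge of [h] shortens to a simple path of nodes, which that edge would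
    close to a cycle. *)
Lemma bridge h : ~~ connect (step_off h) (al h) h.
Proof.
apply/negP => conn_h.
have nodes x y : connect (step_off h) x y ->
    connect (node_step_off h) (porbit s x) (porbit s y).
  case/connectP=> p; elim: p x => [|z p IH] x /= => [_ ->|]; first exact: connect0.
  case/andP=> xz pz yE; apply: connect_trans (_ : connect _ _ (porbit s z)) (IH z pz yE).
  case/orP: xz => [|/and3P[/eqP -> xh xah]].
    by rewrite -eq_porbit_mem => /eqP ->; apply: connect0.
  by apply: connect1; apply/existsP; exists x; rewrite xh xah !eqxx.
case/connectP: (nodes _ _ conn_h) => p0 path_p0 last_p0.
case/shortenP: path_p0 last_p0 => p path_p uniq_p _ last_p.
have [||xs [path_xs nodes_xs]] := node_path path_p uniq_p (esym last_p) (erefl _).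
- by rewrite eq_sym alpha_neq.
- by rewrite eqxx orbT.
have /negP := acyclic_seq (h :: xs); apply; rewrite /graph_cycle /=.
rewrite path_xs /= nodes_xs; move: uniq_p.
by rewrite [porbit s (al h) :: p]lastI rcons_uniq last_p.
Qed.

(** The step from a corner to the next one, with [al] applied first; its orbits are the faces of the
    map. *)
Definition face : {perm dart} := (al * s)%g.

Lemma faceE h : face h = s (al h).
Proof. by rewrite permM. Qed.

Lemma side_face h x : connect (step_off h) (al h) x -> x != al h ->
  connect (step_off h) (al h) (face x).
Proof.
move=> cx xah; have xh : x != h by apply: contraTneq cx => ->; apply: bridge.
apply: connect_trans cx _; apply: connect_trans (_ : connect _ x (al x)) _.
  by apply: connect1; rewrite /step_off /= eqxx xh xah orbT.
by apply: connect1; rewrite /step_off /= faceE; have := mem_porbit s 1 (al x); rewrite expg1 => ->.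
Qed.

Lemma side_walk h i : (forall j, 0 < j <= i -> (face ^+ j)%g h != al h) ->
  connect (step_off h) (al h) ((face ^+ i.+1)%g h).
Proof.
elim: i => [|i IH] walk.
  rewrite expg1 faceE; apply: connect1; rewrite /step_off /=.
  by have := mem_porbit s 1 (al h); rewrite expg1 => ->.
rewrite expgSr permM; apply: side_face; last by apply: walk; rewrite ltnS leqnn.
by apply: IH => j /andP[j0 ji]; apply: walk; rewrite j0 leqW.
Qed.

(** The walk from [h] stays beyond the bridge as long as it does not meet [al h]. Being periodic, it
    returns to [h], which lies on the near side. *)
Lemma alpha_face h : al h \in porbit face h.
Proof.
apply/negPn/negP => notin; have /negP[] := bridge h.
have := @side_walk h #[face]%g.-1; rewrite (prednK (order_gt0 _)) expg_order perm1.
by apply=> j _; apply: contraNneq notin => <-; apply: mem_porbit.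
Qed.

Hypothesis t_connected : connected t.

(** A step by [alpha] stays within a face by [alpha_face], and so does a step by [sigma], which is
    [alpha] followed by [face]. Connectedness thus leaves a single face. *)
Lemma face_transitive h x : x \in porbit face h.
Proof.
have /forallP/(_ h)/forallP/(_ x)/connectP[p] := t_connected.
elim: p h => [|z p IH] h /=; first by move=> _ ->; apply: porbit_id.
case/andP=> hz pz xE; suff <- : porbit face z = porbit face h by apply: IH.
have orbit_al : porbit face (al h) = porbit face h.
  by apply/eqP; rewrite eq_porbit_mem alpha_face.
case/orP: hz => /eqP -> //; rewrite -orbit_al; apply/eqP; rewrite eq_porbit_mem.
by have := mem_porbit face 1 (al h); rewrite expg1 faceE alphaK.
Qed.

Lemma card_face h : #|porbit face h| = (2 * n)%N.
Proof.
rewrite -[RHS]card_ord; apply: eq_card => x; rewrite [RHS]inE; exact: face_transitive.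
Qed.

Lemma face_inj h i j : i < 2 * n -> j < 2 * n ->
  (face ^+ i)%g h = (face ^+ j)%g h -> i = j.
Proof.
move=> iN jN; rewrite !permX => e; have := uniq_traject_porbit face h.
rewrite card_face => uniq_t; apply/eqP; rewrite -(nth_uniq h _ _ uniq_t) ?size_traject //.
by rewrite !nth_traject // e.
Qed.

Lemma face_index h x : exists2 i, i < 2 * n & x = (face ^+ i)%g h.
Proof.
have := face_transitive h x; rewrite porbit_traject => /trajectP[i].
by rewrite card_face -permX => iN ->; exists i.
Qed.

Lemma face_period h : (face ^+ (2 * n))%g h = h.
Proof. by have := iter_porbit face h; rewrite card_face -permX. Qed.

(* The two sides of the edge of [h] are the two arcs that the chord from [h] to
   [alpha h] cuts out of the cyclic order of the half-edges under [face]. *)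
Lemma alpha_arc h l z : (0 < l < 2 * n)%N -> (face ^+ l)%g h = al h -> (0 < z < l)%N ->
  exists2 z', (0 < z' < l)%N & al ((face ^+ z)%g h) = (face ^+ z')%g h.
Proof.
case/andP=> l0 lN hl /andP[z0 zl].
have side1 i : 0 < i <= l -> connect (step_off h) (al h) ((face ^+ i)%g h).
  case: i => // i /andP[_ il]; apply: side_walk => j /andP[j0 ji].
  apply/eqP; rewrite -hl => /face_inj e; have : j = l by apply: e; lia.
  lia.
have side2 i : l < i < 2 * n -> connect (step_off h) h ((face ^+ i)%g h).
  move=> /andP[li iN]; have := @side_walk (al h) (i - l).-1.
  rewrite prednK ?subn_gt0 // (eq_connect (step_off_alpha h)) alphaK.
  move=> walk; rewrite -(subnKC (ltnW li)) expgD permM hl; apply: walk => j jil.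
  rewrite -hl -permM -expgD; apply/eqP => e.
  suff : (l + j = 0)%N by lia.
  by apply: (@face_inj h); rewrite ?expg0 ?perm1 //; lia.
have not_h i : 0 < i < 2 * n -> (face ^+ i)%g h != h.
  move=> /andP[i0 iN]; apply/eqP => e; suff : i = 0%N by lia.
  by apply: (@face_inj h); rewrite ?expg0 ?perm1 //; lia.
pose x := (face ^+ z)%g h.
have x_side : connect (step_off h) (al h) x by apply: side1; rewrite z0 ltnW.
have xh : x != h by apply: not_h; lia.
have xah : x != al h.
  rewrite /x -hl; apply/eqP => /face_inj e; suff : z = l by lia.
  by apply: e; lia.
have alx_side : connect (step_off h) (al h) (al x).
  by apply: connect_trans x_side (connect1 _); rewrite /step_off /= eqxx xh xah orbT.
have [z' z'N alxE] := face_index h (al x).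
exists z' => //; rewrite -/x alxE in alx_side *.
have [z'0|z'0] := posnP z'.
  by move: alx_side; rewrite z'0 expg0 perm1 (negbTE (bridge h)).
rewrite /= ltnNge; apply/negP => lz'; move: lz'; rewrite leq_eqVlt => /orP[/eqP e|lz'].
  by move: alxE; rewrite -e hl => /(inv_inj alphaK) /eqP; rewrite (negbTE xh).
have := side2 z'; rewrite lz' z'N => /(_ erefl).
rewrite (step_off_sym h) => c; have /negP[] := bridge h.
by apply: connect_trans alx_side c.
Qed.
End Tree.
End Trees.

(** * Noncrossing matchings and the two sides of a chord *)

Section NoncrossingMatchings.
Variable N : nat.
Implicit Types m : {perm 'I_N}.

Definition cyclic_shift : {perm 'I_N} := perm (@ordS_inj N).

Definition noncrossing m : bool :=
  [forall i, (m i != i) && (m (m i) == i)] &&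
  [forall i : 'I_N, forall j : 'I_N, ~~ [&& i < j, j < m i & m i < m j]].

(** A chord of length 1 is counted at its first end in cyclic order. For [N = 2] both ends count, in
    agreement with the two leaves of a single edge. *)
Definition nb_short m : nat := #|[set i | m i == cyclic_shift i]|.

Lemma cyclic_shiftE i : cyclic_shift i = i.+1 %% N :> nat.
Proof. by rewrite permE. Qed.

Lemma cyclic_shiftX k i : (cyclic_shift ^+ k)%g i = (i + k) %% N :> nat.
Proof.
elim: k => [|k IH]; first by rewrite expg0 perm1 addn0 modn_small.
by rewrite expgSr permM cyclic_shiftE IH addnS -[in LHS]addn1 -[in RHS]addn1 modnDml.
Qed.

Section Noncrossing.
Variable m : {perm 'I_N}.
Hypothesis nc : noncrossing m.

Lemma nc_neq i : m i != i.
Proof. by case/andP: nc => /forallP/(_ i)/andP[]. Qed.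

Lemma ncK : involutive m.
Proof. by move=> i; case/andP: nc => /forallP/(_ i)/andP[_ /eqP]. Qed.

Lemma ncP (i j : 'I_N) : i < j -> j < m i -> m i < m j -> False.
Proof.
by move=> ij jmi mij; case/andP: nc => _ /forallP/(_ i)/forallP/(_ j); rewrite ij jmi mij.
Qed.

Lemma nc_inside (i j : 'I_N) : i < j -> j < m i -> i < m j < m i.
Proof.
move=> ij jmi; apply/andP; split; rewrite ltnNge; apply/negP => le.
  have ne : m j != i by apply: contraTneq jmi => <-; rewrite ncK ltnn.
  move: le; rewrite leq_eqVlt (negbTE (ne : (m j : nat) != i)) /= => lt.
  by apply: (@ncP (m j) i) => //; rewrite ncK.
have ne : m i != m j by rewrite (inj_eq perm_inj) neq_ltn ij.
by move: le; rewrite leq_eqVlt (negbTE (ne : (m i : nat) != m j)) /=; apply: ncP.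
Qed.

Local Notation s := (m * cyclic_shift)%g.

Lemma nc_sigma x : s x = cyclic_shift (m x).
Proof. by rewrite permM. Qed.

Section Arc.
Variable a : 'I_N.
Hypothesis lt_a : a < m a.
Let arc := [pred x : 'I_N | a < x <= m a].

Lemma arc_alpha x : x \in arc -> x != m a -> m x \in arc.
Proof.
rewrite !inE => /andP[ax xb] xne; have {xb}xb : x < m a by rewrite ltn_neqAle xb andbT.
by have /andP[-> /ltnW ->] := nc_inside ax xb.
Qed.

Lemma arcC_alpha x : x \notin arc -> x != a -> m x \notin arc.
Proof.
move=> x_out xa; apply: contra x_out => mx_in; rewrite -[x]ncK; apply: arc_alpha => //.
by rewrite (inj_eq perm_inj).
Qed.

Lemma arc_sigma x : x \in arc -> s x \in arc.
Proof.
move=> x_in; rewrite nc_sigma inE cyclic_shiftE.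
have [->|xne] := eqVneq x (m a); first by rewrite ncK modn_small ?leqnn ?(leq_trans _ (ltn_ord (m a))) // ltnS.
have := arc_alpha x_in xne; have [e|] := eqVneq (m x) (m a).
  by move: x_in; rewrite -[x]ncK e ncK inE ltnn.
rewrite !inE => mne /andP[amx mxb]; have mxb' : m x < m a by rewrite ltn_neqAle mxb andbT.
rewrite modn_small ?mxb' ?(leq_trans amx) //; exact: leq_ltn_trans mxb' (ltn_ord _).
Qed.

Lemma arcC_sigma x : x \notin arc -> s x \notin arc.
Proof.
move=> x_out; apply/negP => sx_in.
have img : [set s y | y in arc] \subset arc.
  by apply/subsetP => _ /imsetP[y y_in ->]; apply: arc_sigma.
have e : [set s y | y in arc] =i arc.
  by apply: subset_cardP => //; rewrite card_imset //; apply: perm_inj.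
move: sx_in; rewrite -e => /imsetP[y y_in /perm_inj xy].
by rewrite xy y_in in x_out.
Qed.
End Arc.

(** The cyclic arc from [h] (excluded) to [m h] (included), that is, the part of the tree beyond the
    edge of [h]. It is a union of nodes, and an edge can leave it only at [m h]. *)
Definition side (h x : 'I_N) : bool :=
  if h < m h then h < x <= m h else ~~ (m h < x <= h).

Lemma side_sigma h x : side h x -> side h (s x).
Proof.
rewrite /side; case: ltnP => [lt_h|le_h]; first exact: arc_sigma.
have lt_mh : m h < m (m h).
  by rewrite ncK ltn_neqAle le_h andbT; apply: nc_neq.
by have := @arcC_sigma (m h) lt_mh x; rewrite !inE ncK.
Qed.

Lemma side_alpha h x : side h x -> x != m h -> side h (m x).
Proof.
rewrite /side; case: ltnP => [lt_h|le_h]; first exact: arc_alpha.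
have lt_mh : m h < m (m h).
  by rewrite ncK ltn_neqAle le_h andbT; apply: nc_neq.
by have := @arcC_alpha (m h) x; rewrite !inE ncK.
Qed.

Lemma side_node h x y : y \in porbit s x -> side h x -> side h y.
Proof.
case/porbitP=> i ->; elim: i => [|i IH] sx; first by rewrite expg0 perm1.
by rewrite expgSr permM; apply/side_sigma/IH.
Qed.

Lemma side_self h : side h h = false.
Proof. by rewrite /side; case: ltnP => [|le_h]; rewrite ?ltnn // ltn_neqAle le_h leqnn nc_neq. Qed.

Lemma side_other h : side h (m h).
Proof. by rewrite /side; case: ltnP => _; rewrite ?leqnn ?ltnn. Qed.
End Noncrossing.
End NoncrossingMatchings.

(** * Canonical representatives of rooted plane trees *)

Section CanonicalMaps.
Variables (n : nat) (n_gt0 : 0 < n).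
Local Notation N := (2 * n)%N.
Implicit Types (t u : rooted_map n) (m p : {perm 'I_(2 * n)}).

Lemma double_gt0 : 0 < 2 * n. Proof. by rewrite muln_gt0. Qed.

Definition root0 : 'I_(2 * n) := Ordinal double_gt0.

(** [sigma] is forced: walking around the tree has to be the cyclic shift, so [m * sigma] is the
    shift, and [m] is an involution. *)
Definition canonical_map m : rooted_map n := ((m * cyclic_shift (2 * n))%g, m, root0).

Definition relabel p t : rooted_map n :=
  ((sigma t ^ p)%g, (alpha t ^ p)%g, p (root_corner t)).

Lemma isomorphicP t u : reflect (exists p, u = relabel p t) (isomorphic t u).
Proof.
apply: (iffP existsP) => -[p].
  case/and3P=> /forallP sp /forallP ap /eqP rp; exists p.
  case: u sp ap rp => [[su au] ru]; rewrite /sigma /alpha /root_corner /= => sp ap ->.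
  congr (_, _, _); apply/permP => x; rewrite -[x](permKV p) permJ;
    by [rewrite (eqP (sp _)) | rewrite (eqP (ap _))].
move=> ->; exists p; rewrite /relabel /sigma /alpha /root_corner /=.
by apply/and3P; split=> //; apply/forallP => x; rewrite permJ.
Qed.

Lemma relabelM p p' t : relabel p' (relabel p t) = relabel (p * p')%g t.
Proof. by rewrite /relabel /sigma /alpha /root_corner /= !conjgM permM. Qed.

Lemma relabel1 t : relabel 1 t = t.
Proof. by case: t => [[s al] r]; rewrite /relabel /sigma /alpha /root_corner /= !conjg1 perm1. Qed.

Lemma iso_class_relabel p t : iso_class (relabel p t) = iso_class t.
Proof.
apply/setP => u; rewrite !inE; apply/isomorphicP/isomorphicP => -[p' ->].
  by exists (p * p')%g; rewrite relabelM.
by exists (p^-1 * p')%g; rewrite relabelM mulKVg.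
Qed.

Lemma mem_iso_class t : t \in iso_class t.
Proof. by rewrite inE; apply/isomorphicP; exists 1%g; rewrite relabel1. Qed.

Lemma iso_class_eq t u : iso_class t = iso_class u -> exists p, u = relabel p t.
Proof. by move=> e; apply/isomorphicP; have := mem_iso_class u; rewrite -e inE. Qed.

Lemma next_corner_relabel p t : next_corner (relabel p t) = relabel p (next_corner t).
Proof. by rewrite /next_corner /relabel /sigma /alpha /root_corner /= !permJ. Qed.

Lemma rotation_iso_class t : rotation (iso_class t) = iso_class (next_corner t).
Proof.
apply/setP => u; apply/imsetP/idP => [[v]|].
  rewrite !inE => /isomorphicP[p ->] ->; apply/isomorphicP.
  by exists p; rewrite next_corner_relabel.
rewrite inE => /isomorphicP[p ->]; exists (relabel p t).
  by rewrite inE; apply/isomorphicP; exists p.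
by rewrite next_corner_relabel.
Qed.

Lemma nb_leaves_fix t : nb_leaves t = #|[set h | sigma t h == h]|.
Proof.
have porbit1 h : (#|porbit (sigma t) h| == 1%N) = (sigma t h == h).
  apply/eqP/eqP => [c1|fix_h]; first by have := iter_porbit (sigma t) h; rewrite c1.
  rewrite -[RHS](cards1 h); congr #|pred_of_set _|; apply/setP => x; rewrite inE.
  apply/porbitP/eqP => [[i ->]|->]; first exact: permX_fix.
  by exists 0%N; rewrite expg0 perm1.
rewrite /nb_leaves -[RHS](@card_in_imset _ _ (porbit (sigma t))); last first.
  move=> x y; rewrite !inE => /eqP fix_x _ e; have := porbit_id (sigma t) y.
  by rewrite -e => /porbitP[i ->]; rewrite permX_fix.
apply: eq_card => A; rewrite inE; apply/andP/imsetP => [[/imsetP[h _ ->] A1]|[h]].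
  by exists h; rewrite // inE -porbit1.
by rewrite inE -porbit1 => h1 ->; rewrite h1 imset_f.
Qed.

Lemma nb_leaves_relabel p t : nb_leaves (relabel p t) = nb_leaves t.
Proof.
rewrite !nb_leaves_fix -[RHS](card_imset _ (@perm_inj _ p)); apply: eq_card => x.
apply/idP/imsetP => [|[h]]; last by rewrite !inE /relabel /sigma /= => /eqP hh ->; rewrite permJ hh.
rewrite inE -[x](permKV p) permJ (inj_eq perm_inj) => h_fix.
by exists ((p^-1)%g x) => //; rewrite inE.
Qed.

Lemma nb_leaves_canonical m : noncrossing m -> nb_leaves (canonical_map m) = nb_short m.
Proof.
move=> nc; rewrite nb_leaves_fix /nb_short -[RHS](card_imset _ (@perm_inj _ m)).
apply: eq_card => h; rewrite !inE /sigma /= permM.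
apply/eqP/imsetP => [e|[i]]; first by exists (m h); rewrite ?inE ?ncK // e.
by rewrite inE => /eqP mi ->; rewrite ncK.
Qed.

(** An isomorphism of canonical maps commutes with the walk around the tree, which is the cyclic
    shift, and fixes the root; hence it is the identity. *)
Lemma canonical_map_inj m m' : iso_class (canonical_map m) = iso_class (canonical_map m') ->
  involutive m -> involutive m' -> m = m'.
Proof.
case/iso_class_eq=> p [es em er] mK m'K.
have pc x : p (cyclic_shift _ x) = cyclic_shift _ (p x).
  have mp : m' (p x) = p (m x) by rewrite em permJ.
  have := congr1 (fun f : {perm 'I_N} => f (m' (p x))) es.
  by rewrite /sigma /alpha /= permM m'K mp permJ permM mK => ->.
have p1 x : p x = x.
  have -> : x = (cyclic_shift _ ^+ x)%g root0.
    by apply: val_inj; rewrite /= cyclic_shiftX add0n modn_small.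
  elim: (nat_of_ord x) => [|k IH]; first by rewrite expg0 perm1.
  by rewrite expgSr permM pc IH.
by apply/permP => x; rewrite em -[in RHS](p1 x) permJ p1.
Qed.

Lemma rotation_canonical m : involutive m ->
  rotation (iso_class (canonical_map m)) =
  iso_class (canonical_map (m ^ (cyclic_shift N)^-1)%g).
Proof.
move=> mK; rewrite rotation_iso_class.
rewrite -(iso_class_relabel (cyclic_shift N) (canonical_map _)); congr iso_class.
rewrite /next_corner /relabel /sigma /alpha /root_corner /= conjMg -!conjgM.
by rewrite mulVg conjg1 conjgE mulKg permM mK.
Qed.

Lemma tree_canonical t : is_tree t ->
  exists2 m, noncrossing m & iso_class t = iso_class (canonical_map m).
Proof.
case/and3P=> pair conn acyc; pose r := root_corner t.
(* Half-edges are numbered in the order in which the walk around the tree meets them, starting from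
   the root. *)
pose f (i : 'I_N) := (face t ^+ i)%g r.
have f_inj : injective f.
  by move=> i j e; apply: val_inj; apply: (face_inj pair acyc conn) e.
pose p := perm f_inj; pose m := ((alpha t) ^ p^-1)%g.
have pE i : p i = (face t ^+ i)%g r by rewrite permE.
have mE i : p (m i) = alpha t (p i).
  by rewrite /m conjgE invgK !permM permKV.
have face_p i : face t (p i) = p (cyclic_shift N i).
  rewrite !pE cyclic_shiftE -permM -expgSr.
  have [lt_i|] := ltnP i.+1 N; first by rewrite modn_small.
  rewrite leq_eqVlt ltnS leqNgt ltn_ord orbF => /eqP e.
  by rewrite -[in RHS]e modnn expg0 perm1 -e (face_period pair acyc conn).
have pr : p root0 = r by rewrite pE expg0 perm1.
exists m; last first.
  rewrite -(iso_class_relabel p (canonical_map m)); congr iso_class.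
  rewrite /relabel /canonical_map /sigma /alpha /root_corner /= pr.
  have -> : (m ^ p)%g = alpha t by rewrite /m -conjgM mulVg conjg1.
  suff -> : ((m * cyclic_shift N) ^ p)%g = sigma t.
    by rewrite /r /sigma /alpha /root_corner; case: (t) => [[]].
  apply/permP => x; rewrite -[x](permKV p) permJ permM -face_p mE faceE.
  by rewrite (alphaK pair).
apply/andP; split.
  apply/forallP => i; apply/andP; split.
    by rewrite -(inj_eq (@perm_inj _ p)) mE (alpha_neq pair).
  by rewrite -(inj_eq (@perm_inj _ p)) !mE (alphaK pair).
apply/forallP => i; apply/forallP => j; apply/negP => /and3P[ij jmi mij].
have pD (k : 'I_N) l : (face t ^+ l)%g (p k) = (face t ^+ (k + l))%g r.
  by rewrite pE -permM -expgD.
have [] := @alpha_arc _ t pair acyc conn (p i) (m i - i) (j - i).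
- by have := ltn_ord (m i); lia.
- by rewrite pD subnKC -?pE ?mE // ltnW // (ltn_trans ij).
- by lia.
move=> z' /andP[z'0 z'l]; rewrite !pD subnKC ?(ltnW ij) // -pE -mE pE.
move/(face_inj pair acyc conn); have := ltn_ord (m j); have := ltn_ord (m i).
by move=> ? ? e; have := e _ _; lia.
Qed.

Lemma canonical_tree m : noncrossing m -> is_tree (canonical_map m).
Proof.
move=> nc; have mK := ncK nc; apply/and3P; split.
- by apply/forallP => h; rewrite /alpha /= mK eqxx (nc_neq nc).
- apply/forallP => h; apply/forallP => h'.
  have step x : connect [rel x y | (y == sigma (canonical_map m) x)
      || (y == alpha (canonical_map m) x)] x (cyclic_shift N x).
    apply: connect_trans (_ : connect _ x (m x)) _; apply: connect1 => /=.
      by rewrite /alpha /= eqxx orbT.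
    by rewrite /sigma /= permM mK eqxx.
  have -> : h' = (cyclic_shift N ^+ (h' + (N - h)))%g h.
    apply: val_inj; rewrite /= cyclic_shiftX.
    rewrite (_ : (h + (h' + (N - h)) = h' + N)%N); last by have := ltn_ord h; lia.
    by rewrite modnDr modn_small.
  elim: (h' + _)%N => [|k IH]; first by rewrite expg0 perm1.
  by rewrite expgSr permM; apply: connect_trans IH (step _).
apply/forallP => -[c c_size]; apply/negP; rewrite /graph_cycle /=; case: c {c_size} => // h xs.
rewrite /alpha /sigma /= => /andP[path_xs /andP[h_notin uniq_xs]].
(* A walk that has crossed the edge of [h] and never leaves a node through [m h] remains on the far
   side, so it cannot come back to the node of [h]. In a cycle [m h] does not occur right after [h],
   as this would be backtracking, nor later, as its node is already that of the entry after [h]. *)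
have walk ys y : {in ys, forall z, z != m h} -> side m h (m y) ->
    path [rel h0 h' | (h' \in porbit (m * cyclic_shift N) (m h0)) && (h' != m h0)] y
      (rcons ys h) -> False.
  elim: ys y => [|z ys IH] y ys_ne y_side /=.
    rewrite andbT => /andP[h_in _]; have := side_node nc h_in y_side.
    by rewrite (side_self nc).
  case/andP=> /andP[z_in _]; apply: IH; first by move=> w w_in; apply: ys_ne; rewrite inE w_in orbT.
  apply: (side_alpha nc); last by apply: ys_ne; rewrite mem_head.
  exact: (@side_node _ _ nc h (m y) z z_in y_side).
apply: (walk xs h _ _ path_xs) => [z z_in|]; last exact: side_other.
case: xs z_in path_xs uniq_xs {h_notin} => // x xs z_in /= /andP[/andP[x_in x_ne] _] /andP[x_notin _].
move: z_in; rewrite inE => /orP[/eqP -> //|z_in]; apply: contraNneq x_notin => zE.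
by apply/mapP; exists z => //; apply/eqP; rewrite zE eq_porbit_mem.
Qed.
End CanonicalMaps.

(** * Matchings and words *)

Section Words.
Variable W : nat -> bool.

Definition height (x : nat) : int := \sum_(y < x) (if W y then 1 else -1)%R.

Lemma height0 : height 0 = 0%R. Proof. by rewrite /height big_ord0. Qed.

Lemma heightS x : height x.+1 = (height x + (if W x then 1 else -1))%R.
Proof. by rewrite /height big_ord_recr. Qed.

(* Parenthesis matching for the letter [true] opening and [false] closing. *)
Definition matched x y : Prop :=
  [/\ x < y, height y.+1 = height x & forall z, x < z <= y -> (height x < height z)%R].

Lemma matched_opens x y : matched x y -> W x.
Proof.
case=> xy _ /(_ x.+1); rewrite ltnSn xy heightS => /(_ erefl).
by case: (W x) => //; lia.
Qed.

Lemma matched_closes x y : matched x y -> ~~ W y.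
Proof.
case=> xy e /(_ y); rewrite xy leqnn => /(_ erefl); rewrite -e heightS.
by case: (W y) => //; lia.
Qed.

Lemma matched_fun x y y' : matched x y -> matched x y' -> y = y'.
Proof.
move=> [xy e h] [xy' e' h']; case: (ltngtP y y') => // lt.
  by have := h' y.+1; rewrite e ltxx ltnS (ltnW xy) lt => /(_ erefl).
by have := h y'.+1; rewrite e' ltxx ltnS (ltnW xy') lt => /(_ erefl).
Qed.

Lemma matched_inj x x' y : matched x y -> matched x' y -> x = x'.
Proof.
move=> [xy e h] [xy' e' h']; case: (ltngtP x x') => // lt.
  by have := h x'; rewrite -e e' ltxx lt (ltnW xy') => /(_ erefl).
by have := h' x; rewrite -e' e ltxx lt (ltnW xy) => /(_ erefl).
Qed.

Lemma matched_nocross x y x' y' : matched x y -> matched x' y' ->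
  x < x' -> x' < y -> y < y' -> False.
Proof.
move=> [xy e h] [xy' e' h'] xx' x'y yy'.
have := h' y.+1; rewrite e ltnS yy' (ltnW x'y) => /(_ erefl).
have := h x'; rewrite xx' (ltnW x'y) => /(_ erefl); lia.
Qed.

Lemma height_step x : (height x - 1 <= height x.+1 <= height x + 1)%R.
Proof. by rewrite heightS; case: (W x); lia. Qed.

Lemma matched_exists x l : W x -> (height (x + l.+1) = height x)%R ->
  exists2 y, matched x y & y <= x + l.
Proof.
move=> Wx hl; have hx1 := heightS x; rewrite Wx in hx1.
have ex : exists y, (x < y) && (height y.+1 <= height x)%R.
  exists (x + l)%N; rewrite -addnS hl lexx andbT.
  by case: l hl => [|l] hl; [move: hl; rewrite addn1; lia | lia].
have [y /andP[xy le_y] y_min] := ex_minnP ex; exists y.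
  have above z : x < z <= y -> (height x < height z)%R.
    case: z => // z /andP[xz zy]; have [<-|zx] := eqVneq x z; first by lia.
    rewrite ltNge; apply/negP => le_z; have := y_min z; rewrite le_z andbT; lia.
  split=> //; apply/eqP; rewrite eq_le le_y /=.
  by have := above y; rewrite xy leqnn => /(_ erefl); have := height_step y; lia.
apply: y_min; rewrite -addnS hl lexx andbT.
by case: l hl => [|l] hl; [move: hl; rewrite addn1; lia | lia].
Qed.

Lemma matched_exists_back x0 y : x0 <= y -> ~~ W y -> height x0 = height y.+1 ->
  exists2 x, matched x y & x0 <= x.
Proof.
move=> x0y Wy hx0; have hy1 := heightS y; rewrite (negbTE Wy) in hy1.
have ex : exists x, (x <= y) && (height x <= height y.+1)%R by exists x0; rewrite x0y hx0 lexx.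
have ub x : (x <= y) && (height x <= height y.+1)%R -> x <= y by case/andP.
have [x /andP[xy le_x] x_max] := ex_maxnP ex ub.
exists x; last by apply: x_max; rewrite x0y hx0 lexx.
have above z : x < z <= y -> (height y.+1 < height z)%R.
  case/andP=> xz zy; rewrite ltNge; apply/negP => le_z.
  by have := x_max z; rewrite zy le_z => /(_ erefl); lia.
have {xy}xy : x < y.
  rewrite ltn_neqAle xy andbT; apply: contraTneq le_x => ->; lia.
have hx : height y.+1 = height x.
  have := above x.+1; rewrite ltnSn xy => /(_ erefl); have := height_step x; lia.
by split=> // z /above; rewrite hx.
Qed.

Lemma matched_shift k x y : (forall z, x <= z <= y -> W (z + k) = W z) ->
  matched x y -> matched (x + k) (y + k).
Proof.
move=> Wk [xy e above].
have hk z : x <= z <= y.+1 -> (height (z + k) - height (x + k) = height z - height x)%R.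
  elim: z => [|z IH] /andP[xz zy]; first by move: xz; rewrite leqn0 => /eqP ->; lia.
  move: xz; rewrite leq_eqVlt => /orP[/eqP <-|xz]; first by lia.
  have := IH; rewrite -ltnS xz (leq_trans _ zy) // => /(_ erefl).
  rewrite addSn !heightS Wk; lia.
split; first by rewrite ltn_add2r.
  by have := hk y.+1; rewrite leqnn (leqW (ltnW xy)) => /(_ erefl); rewrite addSn; lia.
move=> z z_in; have := hk (z - k); have := above (z - k); rewrite subnK; last by lia.
have zk : x < z - k <= y by lia.
rewrite zk => /(_ erefl); have -> : x <= z - k <= y.+1 by lia.
by move=> ? /(_ erefl); lia.
Qed.
Lemma matched_odd x y : matched x y -> odd (y - x).
Proof.
have parity z : exists k : int, height z = (z%:Z - 2 * k)%R.
  elim: z => [|z [k IH]]; first by exists 0%R; rewrite height0.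
  by rewrite heightS IH; case: (W z); [exists k | exists (k + 1)%R]; lia.
case=> xy e _; have [k ek] := parity y.+1; have [l el] := parity x; lia.
Qed.

End Words.

Lemma height_ext W W' x : (forall y, y < x -> W y = W' y) -> height W x = height W' x.
Proof. by move=> e; apply: eq_bigr => y _; rewrite e. Qed.

(** * Periodic words as noncrossing matchings of a circle *)

Section PeriodicWords.
Variables (N : nat) (N_gt0 : 0 < N) (W : nat -> bool).
Definition residue (x : nat) : 'I_N := Ordinal (ltn_pmod x N_gt0).

Lemma residue_ord (i : 'I_N) : residue i = i.
Proof. by apply: val_inj; rewrite /= modn_small. Qed.

Lemma residueD x k : residue (x + k * N) = residue x.
Proof. by apply: val_inj; rewrite /= addnC modnMDl. Qed.

Lemma residue_addN x : residue (x + N) = residue x.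
Proof. by rewrite -[N in x + N]mul1n residueD. Qed.

Lemma residue_mod x : x = residue x + (x %/ N) * N.
Proof. by rewrite {1}(divn_eq x N) addnC. Qed.

Lemma residue_inj x y : residue x = residue y -> x < y + N -> y < x + N -> x = y.
Proof.
move=> /(congr1 val) /= e xy yx; wlog le_xy : x y e xy yx / x <= y.
  by move=> gen; case/orP: (leq_total x y) => [/gen|/gen/esym]; apply.
by move/eqP: e; rewrite eq_sym eqn_mod_dvd // => /dvdnP[[|q]]; nia.
Qed.

Hypothesis W_period : forall x, W (x + N) = W x.
Hypothesis W_balanced : height W N = 0%R.

Lemma periodD x k : W (x + k * N) = W x.
Proof. by elim: k => [|k IH]; rewrite ?addn0 // mulSn [N + _]addnC addnA W_period. Qed.

Lemma period_residue x : W (residue x) = W x.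
Proof. by rewrite [in RHS](residue_mod x) periodD. Qed.

Lemma height_period x : height W (x + N) = height W x.
Proof.
elim: x => [|x IH]; first by rewrite add0n W_balanced height0.
by rewrite addSn !heightS IH W_period.
Qed.

Lemma matchedD k x y : matched W x y -> matched W (x + k * N) (y + k * N).
Proof. by apply: matched_shift => z _; rewrite periodD. Qed.

Lemma matched_lt x y : matched W x y -> y < x + N.
Proof.
move=> mxy; have Wx := matched_opens mxy.
have [|y' mxy' ly'] := @matched_exists W x N.-1 Wx; first by rewrite prednK // height_period.
by rewrite (matched_fun mxy mxy'); lia.
Qed.

Lemma matched_open x : W x -> exists y, matched W x y.
Proof.
move=> Wx; have [|y mxy _] := @matched_exists W x N.-1 Wx; last by exists y.
by rewrite prednK // height_period.
Qed.

(** The partner lies less than [N] positions to the left of [y]; the bound on [y] keeps it among the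
    natural numbers. *)
Lemma matched_close y : N <= y -> ~~ W y -> exists x, matched W x y.
Proof.
move=> Ny Wy; have le_y : y.+1 - N <= y by lia.
have [|x mxy _] := matched_exists_back le_y Wy; last by exists x.
by rewrite -height_period subnK // leqW.
Qed.

Lemma matching_of_word : exists2 m : {perm 'I_N}, noncrossing m &
  forall x y, matched W x y -> m (residue x) = residue y.
Proof.
(* A closing letter is looked up at [i + N], where its partner is sure to exist. *)
pose P (i j : 'I_N) := (W i -> exists2 y, matched W i y & j = residue y) /\
    (~~ W i -> exists2 x, matched W x (i + N) & j = residue x).
have [f fP] : exists f : 'I_N -> 'I_N, forall i, P i (f i).
  apply: (@fin_all_exists _ (fun=> 'I_N) P) => i; rewrite /P; have [Wi|Wi] := boolP (W i).
    by have [y] := matched_open Wi; exists (residue y); split=> // _; exists y.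
  have [x xi] : exists x, matched W x (i + N).
    by apply: matched_close; rewrite ?leq_addl // W_period.
  by exists (residue x); split=> // _; exists x.
have f_open x y : matched W x y -> f (residue x) = residue y.
  move=> mxy; have [fW _] := fP (residue x); have [|y' mxy' ->] := fW.
    by rewrite period_residue; apply: matched_opens mxy.
  have := matchedD (x %/ N) mxy'; rewrite -residue_mod => mxy''.
  by rewrite (matched_fun mxy mxy'') residueD.
have f_close x y : matched W x y -> f (residue y) = residue x.
  move=> mxy; have [_ fW] := fP (residue y); have [|x' mx'y ->] := fW.
    by rewrite period_residue; apply: matched_closes mxy.
  have := matchedD (y %/ N) mx'y; rewrite -addnAC -residue_mod => mx'y'.
  have := matchedD 1 mxy; rewrite mul1n => mxyN.
  by rewrite -(residueD x' (y %/ N)) -(matched_inj mxyN mx'y') residue_addN.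
have lift (i : 'I_N) : exists x y, matched W x y /\ (i = residue x \/ i = residue y).
  have [Wi|Wi] := boolP (W i).
    have [y] := matched_open Wi; exists i, y; split=> //; left; by rewrite residue_ord.
  have [x xi] : exists x, matched W x (i + N).
    by apply: matched_close; rewrite ?leq_addl // W_period.
  by exists x, (i + N); split=> //; right; rewrite residue_addN residue_ord.
have fK : involutive f.
  move=> i; have [x [y [mxy []->]]] := lift i; first by rewrite (f_open _ _ mxy) (f_close _ _ mxy).
  by rewrite (f_close _ _ mxy) (f_open _ _ mxy).
have f_neq i : f i != i.
  have W_neq x y : matched W x y -> residue x != residue y.
    move=> mxy; apply/eqP => /(congr1 (fun k : 'I_N => W k)); rewrite !period_residue.
    by rewrite (matched_opens mxy) (negbTE (matched_closes mxy)).
  have [x [y [mxy []->]]] := lift i; last first.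
    by rewrite (f_close _ _ mxy) (W_neq _ _ mxy).
  by rewrite (f_open _ _ mxy) eq_sym (W_neq _ _ mxy).
pose m := perm (inv_inj fK); exists m; last by move=> x y; rewrite permE; apply: f_open.
(* On the line a chord with ends [i < f i] runs from [i] to [f i] or from [f i] to [i + N]. In each
   of the four combinations, crossing chords lift to crossing pairs of parentheses, possibly after a
   shift by one period. *)
have arc (i : 'I_N) : i < f i -> matched W i (f i) \/ matched W (f i) (i + N).
  move=> lt_i; have Nf := ltn_ord (f i); have Ni := ltn_ord i.
  have [Wi|Wi] := boolP (W i).
    left; have [y miy] := matched_open Wi; suff -> : nat_of_ord (f i) = y by [].
    have := f_open _ _ miy; rewrite residue_ord => /(congr1 val) /= fy.
    have y_lti := matched_lt miy; have [iy _ _] := miy; rewrite fy in lt_i *.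
    have [y_lt|y_ge] := ltnP y N; first by rewrite modn_small.
    by move: lt_i; rewrite -{1}(subnK y_ge) modnDr modn_small; lia.
  right; have Wf : W (f i).
    have [x mx fx] := (fP i).2 Wi; rewrite fx period_residue; exact: matched_opens mx.
  have [y mfy] := matched_open Wf; suff -> : i + N = y by [].
  have := f_open _ _ mfy; rewrite residue_ord fK => /(congr1 val) /= iy.
  have y_ltf := matched_lt mfy; have [fy _ _] := mfy.
  have [y_lt|y_ge] := ltnP y N; first by move: lt_i; rewrite {1}iy modn_small; lia.
  have e : y %% N = y - N by rewrite -{1}(subnK y_ge) modnDr modn_small //; lia.
  by rewrite iy e subnK.
apply/andP; split; first by apply/forallP => i; rewrite permE !permE f_neq fK eqxx.
apply/forallP => i; apply/forallP => j; rewrite !permE; apply/negP => /and3P[ij jfi fij].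
have [] := arc i (ltn_trans ij jfi); have [] := arc j (ltn_trans jfi fij) => mj mi.
- exact: matched_nocross mi mj ij jfi fij.
- have := matchedD 1 mi; rewrite mul1n => miN.
  apply: (matched_nocross mj miN); have := ltn_ord (f j); lia.
- by apply: (matched_nocross mj mi); have := ltn_ord (f j); lia.
- by apply: (matched_nocross mi mj); have := ltn_ord (f j); lia.
Qed.

(** * Recovering a matching from an orientation of its chords *)

Section Orientation.
Variable m : {perm 'I_N}.
Hypotheses (mK : involutive m) (W_m : forall i : 'I_N, W (m i) = ~~ W i).

Definition oriented_arc x y : Prop := [/\ W x, x < y < x + N & m (residue x) = residue y].

Hypothesis arc_nocross : forall x y x' y', oriented_arc x y -> oriented_arc x' y' ->
  x < x' -> x' < y -> y < y' -> False.

Lemma oriented_arc_open x : W x -> exists y, oriented_arc x y.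
Proof.
clear W_balanced; move=> Wx; pose d := (m (residue x) + N - residue x) %% N.
have dN : d < N by rewrite ltn_pmod.
have rd : residue (x + d) = m (residue x).
  apply: val_inj; rewrite /= -modnDml /d /= modnDmr addnBA; last by have := ltn_pmod x N_gt0; lia.
  by rewrite addnC addnK modnDr modn_small.
exists (x + d); split=> //; rewrite ltn_add2l dN andbT -[x in x < _]addn0 ltn_add2l lt0n.
apply/eqP => d0; move: rd; rewrite d0 addn0 => e.
by have := W_m (residue x); rewrite -e; case: (W _).
Qed.

Lemma oriented_arc_closes x y : oriented_arc x y -> ~~ W y.
Proof. by case=> Wx _ e; rewrite -period_residue -e W_m period_residue Wx. Qed.

Lemma oriented_arc_close y : N <= y -> ~~ W y -> exists x, oriented_arc x y.
Proof.
move=> Ny Wy; have Wm : W (m (residue y)) by rewrite W_m period_residue.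
have [z [Wz /andP[mz zm] mmz]] := oriented_arc_open Wm.
rewrite residue_ord mK in mmz.
exists (y - (z - m (residue y))); have le_z : z - m (residue y) <= y by lia.
have r_eq : residue (y - (z - m (residue y))) = m (residue y).
  apply: val_inj; rewrite /= -[RHS](modn_small (ltn_ord _)); apply/eqP.
  rewrite -(eqn_modDr z) (_ : _ + z = m (residue y) + y); last by lia.
  by move/(congr1 val): mmz => /= yz; rewrite -modnDmr yz modnDmr.
split; first by rewrite -period_residue r_eq.
- by apply/andP; split; lia.
by rewrite r_eq mK.
Qed.

(** If the chord and the parenthesis opened at [x] close at different places, the nearer closing
    letter has, for the other relation, an opening [u] strictly after [x]. By induction on the
    distance to the nearer end the two relations agree at [u], so the closing letter would have two
    openings. *)
Lemma oriented_arc_matched x y : N <= x -> oriented_arc x y -> matched W x y.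
Proof.
move=> Nx axy; have Wx : W x by case: axy.
have [y' mxy'] := matched_open Wx.
have [<-|] := eqVneq y' y; first by [].
move: (leqnn (minn y y' - x)); move: {2}(minn y y' - x) => k.
elim/ltn_ind: k x y y' Nx axy Wx mxy' => k IH x y y' Nx axy Wx mxy' le_k ne.
have [_ /andP[xy yx] exy] := axy; have [xy' _ _] := mxy'.
case: (ltngtP y y') ne le_k => // [lt|lt] _ le_k.
  have Wy := oriented_arc_closes axy.
  have Ny : N <= y by lia.
  have [u muy] := matched_close Ny Wy; have [uy _ _] := muy.
  have xu : x < u.
    case: (ltngtP x u) => // [ux|xu]; first by case: (matched_nocross muy mxy').
    by move: muy; rewrite -xu => /(matched_fun mxy') yy'; rewrite yy' ltnn in lt.
  have Wu := matched_opens muy; have [v auv] := oriented_arc_open Wu.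
  have [vy|vy] := eqVneq v y.
    case: auv => _ _; rewrite vy -exy => /perm_inj/residue_inj e; lia.
  have muv : matched W u v by apply: (IH (minn v y - u) _ u v y _ auv Wu muy (leqnn _)); lia.
  by rewrite (matched_fun muv muy) eqxx in vy.
have Wy' := matched_closes mxy'.
have Ny' : N <= y' by lia.
have [u auy'] := oriented_arc_close Ny' Wy'; have [Wu /andP[uy' y'u] _] := auy'.
have xu : x < u.
  case: (ltngtP x u) => // [ux|xu]; first by case: (arc_nocross auy' axy).
  case: axy auy' => _ _ e [_ _ e']; move: e'; rewrite -xu e => /residue_inj; lia.
have [v muv] := matched_open Wu.
have [vy|vy] := eqVneq v y'; first by move: muv; rewrite vy => /(matched_inj mxy'); lia.
have muy' : matched W u y' by apply: (IH (minn y' v - u) _ u y' v _ auy' Wu muv (leqnn _)); lia.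
by rewrite (matched_inj mxy' muy') ltnn in xu.
Qed.
End Orientation.
End PeriodicWords.

Lemma orientation_balanced N (W : nat -> bool) (m : {perm 'I_N}) :
  (forall i : 'I_N, W (m i) = ~~ W i) -> height W N = 0%R.
Proof.
move=> W_m; have e : height W N = (- height W N)%R.
  rewrite {1}/height (reindex_inj (@perm_inj _ m)) -sumrN.
  by apply: eq_bigr => i _; rewrite W_m; case: (W i); rewrite ?opprK.
lia.
Qed.

Section Encoding.
Variables (N : nat) (N_gt1 : 1 < N).
Let N_gt0 : 0 < N := ltnW N_gt1.
Local Notation res := (residue N_gt0).

Definition encodes (m : {perm 'I_N}) (W : nat -> bool) : Prop :=
  forall x y, matched W x y -> m (res x) = res y.

(** [noncrossing] refers to the order of ['I_N], cut at 0. With [x] moved into the first period, the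
    cases are how many of the other three ends lie in the second one; each is a cyclic relabelling
    of the forbidden pattern. *)
Lemma nc_nat (m : {perm 'I_N}) x y x' y' : noncrossing m ->
  m (res x) = res y -> m (res x') = res y' ->
  x < x' -> x' < y -> y < y' -> y' < x + N -> False.
Proof.
move=> nc mx mx' xx' x'y yy' y'x.
pose i := x %% N; have iN : i < N by rewrite ltn_pmod.
have xE := residue_mod N_gt0 x; rewrite /= -/i in xE.
pose q := x %/ N * N; rewrite -/q in xE.
have sub z : x <= z -> res z = res (z - q).
  by move=> xz; rewrite -{1}(@subnK q z) ?residueD //; lia.
have low z : z < N -> nat_of_ord (res z) = z by move=> zN; rewrite /= modn_small.
have high z : N <= z < N + N -> nat_of_ord (res z) = z - N.
  by case/andP=> Nz zN; rewrite /= -{1}(subnK Nz) modnDr modn_small //; lia.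
move: mx mx'; rewrite (sub x) ?(sub x') ?(sub y) ?(sub y') //; try lia.
set a := x - q; set b := x' - q; set c := y - q; set d := y' - q => mac mbd.
have [ab bc cd da aN] : [/\ a < b, b < c, c < d, d < a + N & a < N] by split; lia.
have mca : m (res c) = res a by rewrite -mac (ncK nc).
have mdb : m (res d) = res b by rewrite -mbd (ncK nc).
have [dN|Nd] := ltnP d N.
  by apply: (ncP nc (i := res a) (j := res b)); rewrite ?mac ?mbd !low; lia.
have [cN|Nc] := ltnP c N.
  by apply: (ncP nc (i := res d) (j := res a)); rewrite ?mac ?mdb !(low a, low b, low c, high d); lia.
have [bN|Nb] := ltnP b N.
  by apply: (ncP nc (i := res c) (j := res d)); rewrite ?mca ?mdb !(low a, low b, high c, high d); lia.
by apply: (ncP nc (i := res b) (j := res c)); rewrite ?mca ?mbd !(low a, high b, high c, high d); lia.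
Qed.

Section Word.
Variable W : nat -> bool.
Hypothesis W_period : forall x, W (x + N) = W x.

Lemma matched_unshift x y : height W N = 0%R ->
  matched W (x + N) (y + N) -> matched W x y.
Proof.
move=> W0 mxy; have Wx : W x by rewrite -W_period; apply: matched_opens mxy.
have [z mxz] := matched_open N_gt0 W_period W0 Wx.
have := matchedD W_period 1 mxz; rewrite mul1n => /(matched_fun mxy)/eqP.
by rewrite eqn_add2r => /eqP ->.
Qed.

Lemma orientation_arc (m : {perm 'I_N}) x y : involutive m ->
    (forall i : 'I_N, W (m i) = ~~ W i) ->
    (forall x y x' y', oriented_arc N_gt0 W m x y -> oriented_arc N_gt0 W m x' y' ->
       x < x' -> x' < y -> y < y' -> False) ->
  oriented_arc N_gt0 W m x y -> matched W x y.
Proof.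
move=> mK W_m nocross [Wx /andP[xy yx] mxy]; have W0 := orientation_balanced W_m.
apply: matched_unshift => //.
apply: (oriented_arc_matched W_period W0 mK W_m nocross); first by rewrite leq_addl.
by split; rewrite ?W_period ?ltn_add2r ?xy // !residue_addN.
Qed.

Lemma orientation_encodes (m : {perm 'I_N}) : involutive m ->
    (forall i : 'I_N, W (m i) = ~~ W i) ->
    (forall x y x' y', oriented_arc N_gt0 W m x y -> oriented_arc N_gt0 W m x' y' ->
       x < x' -> x' < y -> y < y' -> False) ->
  encodes m W.
Proof.
move=> mK W_m nocross x y mxy.
have [y' axy'] := oriented_arc_open N_gt0 W_m (matched_opens mxy).
rewrite (matched_fun mxy (orientation_arc mK W_m nocross axy')).
by case: axy'.
Qed.

Hypothesis W_balanced : height W N = 0%R.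

Lemma matched_cover (i : 'I_N) : exists x y, matched W x y /\ (i = res x \/ i = res y).
Proof.
have [Wi|Wi] := boolP (W i).
  have [y miy] := matched_open N_gt0 W_period W_balanced Wi; exists i, y; split=> //.
  by left; rewrite residue_ord.
have [x mxi] : exists x, matched W x (i + N).
  by apply: (matched_close N_gt0 W_period W_balanced); rewrite ?leq_addl // W_period.
by exists x, (i + N); split=> //; right; rewrite residue_addN residue_ord.
Qed.

Lemma encodes_inj (m m' : {perm 'I_N}) : involutive m -> involutive m' ->
  encodes m W -> encodes m' W -> m = m'.
Proof.
move=> mK m'K em em'; apply/permP => i.
have [x [y [mxy [->|->]]]] := matched_cover i; first by rewrite (em _ _ mxy) (em' _ _ mxy).
by rewrite -{1}(em _ _ mxy) -(em' _ _ mxy) mK m'K.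
Qed.

Lemma encodes_flip (m : {perm 'I_N}) (i : 'I_N) : involutive m -> encodes m W ->
  W (m i) = ~~ W i.
Proof.
move=> mK em; have [x [y [mxy e]]] := matched_cover i.
have Wx := matched_opens mxy; have Wy := matched_closes mxy.
case: e => ->; first by rewrite (em _ _ mxy) !period_residue // Wx (negbTE Wy).
by rewrite -(em _ _ mxy) mK !(em _ _ mxy) !period_residue // Wx Wy.
Qed.

Lemma encodes_gap (m : {perm 'I_N}) x : encodes m W -> W x ->
  exists2 y, matched W x y & m (res x) = res y.
Proof.
move=> em Wx; have [y mxy] := matched_open N_gt0 W_period W_balanced Wx.
by exists y => //; apply: em.
Qed.

Lemma matched_short x : W x -> ~~ W x.+1 -> matched W x x.+1.
Proof.
move=> Wx Wx1; split=> //; first by rewrite !heightS Wx (negbTE Wx1); lia.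
move=> z z_in; have -> : z = x.+1 by lia.
by rewrite heightS Wx; lia.
Qed.

Lemma cyclic_shift_res x : cyclic_shift N (res x) = res x.+1.
Proof.
by apply: val_inj; rewrite [LHS]cyclic_shiftE /= -addn1 modnDml addn1.
Qed.

Lemma encodes_short (m : {perm 'I_N}) x : encodes m W -> W x ->
  (m (res x) == cyclic_shift N (res x)) = ~~ W x.+1.
Proof.
move=> em Wx; rewrite cyclic_shift_res; apply/eqP/idP => [mx|Wx1]; last first.
  exact: em (matched_short Wx Wx1).
have [y mxy mxy'] := encodes_gap em Wx; have := matched_closes mxy.
suff -> : x.+1 = y by [].
have [xy _ _] := mxy; have yx := matched_lt N_gt0 W_period W_balanced mxy.
by apply: (@residue_inj _ N_gt0); rewrite ?mx -?mx //; lia.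
Qed.

End Word.
End Encoding.

(** * Counting words *)

Section WordCounts.

Definition nb_words L (P : pred (seq bool)) : nat := #|[set s : L.-tuple bool | P s]|.

Lemma nb_words0 P : nb_words 0 P = P [::].
Proof.
rewrite /nb_words; case Pn: (P [::]).
  by rewrite -[RHS](card_tuple 0 bool) -cardsT; congr #|pred_of_set _|;
     apply/setP => s; rewrite !inE tuple0 Pn.
by apply/eqP; rewrite cards_eq0; apply/eqP/setP => s; rewrite !inE tuple0 Pn.
Qed.

Lemma nb_wordsS L P : nb_words L.+1 P =
  nb_words L (fun s => P (true :: s)) + nb_words L (fun s => P (false :: s)).
Proof.
pose f a (s : L.-tuple bool) : L.+1.-tuple bool := [tuple of a :: s].
have f_inj a : injective (f a) by move=> s t /(congr1 val) [] /val_inj.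
rewrite /nb_words -(cardsID [set s : L.+1.-tuple bool | thead s]).
rewrite -(card_imset _ (@f_inj true)) -(card_imset _ (@f_inj false)); congr (_ + _).
  apply: eq_card => s; apply/idP/imsetP => [|[t]]; rewrite !inE; last by move=> Pt ->; rewrite Pt theadE.
  case/tupleP: s => a s; rewrite theadE /=; case/andP=> + a_true; rewrite a_true => Ps.
  by exists s; rewrite ?inE.
apply: eq_card => s; apply/idP/imsetP => [|[t]]; rewrite !inE; last by move=> Pt ->; rewrite Pt theadE.
case/tupleP: s => a s; rewrite theadE /=; case/andP=> + + ; case: a => // _ Ps.
by exists s; rewrite ?inE.
Qed.

Lemma eq_nb_words L P Q : (forall s, size s = L -> P s = Q s) -> nb_words L P = nb_words L Q.
Proof. by move=> PQ; apply: eq_card => s; rewrite !inE PQ // size_tuple. Qed.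

Lemma nb_words_eq0 L P : (forall s, size s = L -> ~~ P s) -> nb_words L P = 0.
Proof.
move=> P0; apply/eqP; rewrite cards_eq0; apply/eqP/setP => s; rewrite !inE.
by apply/negbTE/P0; rewrite size_tuple.
Qed.

(* A peak is a factor [true; false]; the letter [e] comes after the end of [s]. *)
Fixpoint nb_peaks (e : bool) (s : seq bool) : nat :=
  if s is a :: t then (a && ~~ head e t) + nb_peaks e t else 0.

Definition nb_ups (s : seq bool) : nat := count id s.

Definition compositions (b j : nat) : nat :=
  match b, j with 0, 0 => 1 | 0, _.+1 => 0 | _.+1, 0 => 0 | b'.+1, j'.+1 => 'C(b', j') end.

Definition nb_words_peaks e L a j : nat :=
  nb_words L (fun s => (nb_ups s == a) && (nb_peaks e s == j)).
(** The peaks are counted as if a letter [true] preceded the word. Together the two counts are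
    closed under removal of the first letter. *)
Definition nb_words_up_peaks e L a j : nat :=
  nb_words L (fun s => (nb_ups s == a) && (~~ head e s + nb_peaks e s == j)).

Lemma nb_words_peaks0 e a j : nb_words_peaks e 0 a j = (a == 0) && (j == 0).
Proof. by rewrite /nb_words_peaks nb_words0 /= ![0 == _]eq_sym. Qed.

Lemma nb_words_up_peaks0 e a j : nb_words_up_peaks e 0 a j = (a == 0) && (j == ~~ e).
Proof. by rewrite /nb_words_up_peaks nb_words0 /= addn0 [0 == _]eq_sym [(~~ e : nat) == _]eq_sym. Qed.

Lemma nb_words_peaksS e L a j : nb_words_peaks e L.+1 a j =
  (if a is a'.+1 then nb_words_up_peaks e L a' j else 0) + nb_words_peaks e L a j.
Proof.
rewrite /nb_words_peaks nb_wordsS; congr (_ + _).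
case: a => [|a]; last by apply: eq_nb_words => s _; rewrite /nb_ups /= add1n eqSS.
by apply: nb_words_eq0.
Qed.

Lemma nb_words_up_peaksS e L a j : nb_words_up_peaks e L.+1 a j =
  (if a is a'.+1 then nb_words_up_peaks e L a' j else 0) +
  (if j is j'.+1 then nb_words_peaks e L a j' else 0).
Proof.
rewrite {1}/nb_words_up_peaks nb_wordsS; congr (_ + _).
  case: a => [|a]; last by apply: eq_nb_words => s _; rewrite /nb_ups /= add1n eqSS add0n.
  by apply: nb_words_eq0.
case: j => [|j]; last by apply: eq_nb_words => s _; rewrite /nb_ups /= add1n eqSS.
by apply: nb_words_eq0 => s _; rewrite andbF.
Qed.

Lemma compositionsS b j : compositions b.+1 j.+1 = 'C(b, j). Proof. by []. Qed.

Lemma compositions_pascal b j : compositions b.+1 j + 'C(b, j) = 'C(b.+1, j).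
Proof. by case: j => [|j]; rewrite ?bin0 // binS addnC. Qed.

Lemma nb_words_peaks_small e L a j : L < a -> nb_words_peaks e L a j = 0.
Proof.
move=> La; apply: nb_words_eq0 => s sL; apply/nandP; left; apply/eqP => sa.
by have := count_size id s; rewrite -/(nb_ups s) sa sL leqNgt La.
Qed.

(** A word is a lattice path, determined by the coordinates of its peaks: the numbers of letters
    [true] and of letters [false] before them form two increasing sequences. This explains the two
    factors; the letters assumed at the ends of the word only change the ranges. *)
Lemma words_upE L a b : a + b = L -> forall j,
  nb_words_peaks true L a j = 'C(a, j) * 'C(b, j) /\
  nb_words_up_peaks true L a j = 'C(a.+1, j) * compositions b j.
Proof.
elim: L a b => [|L IH] a b.
  by case: a b => [|//] [|//] _ j; rewrite nb_words_peaks0 nb_words_up_peaks0; case: j => [|[|j]].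
case: a => [|a] eL j; rewrite nb_words_peaksS nb_words_up_peaksS.
  have peaks0 i := proj1 (IH 0 L erefl i); rewrite add0n in eL; rewrite eL peaks0.
  by case: j => [|j]; rewrite ?peaks0 /=; [|case: j => [|j]]; rewrite ?bin0 ?mul1n ?mul0n.
have up i := proj2 (IH a b (succn_inj eL) i); rewrite up.
case: b eL up => [|b] eL up.
  have small i : nb_words_peaks true L a.+1 i = 0 by apply: nb_words_peaks_small; move: eL; lia.
  by case: j => [|j]; rewrite ?small ?muln0 ?bin0.
have peaks i : nb_words_peaks true L a.+1 i = 'C(a.+1, i) * 'C(b, i).
  by apply: (proj1 (IH a.+1 b _ i)); move: eL; lia.
rewrite !peaks -mulnDr compositions_pascal; split=> //.
by case: j => [|j]; rewrite ?muln0 // peaks compositionsS -mulnDl -binS.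
Qed.

Lemma words_downE L a b : a + b = L -> forall j,
  nb_words_peaks false L a j = compositions a j * 'C(b.+1, j) /\
  nb_words_up_peaks false L a j = compositions a.+1 j * compositions b.+1 j.
Proof.
elim: L a b => [|L IH] a b.
  by case: a b => [|//] [|//] _ j; rewrite nb_words_peaks0 nb_words_up_peaks0; case: j => [|[|j]].
case: a => [|a] eL j; rewrite nb_words_peaksS nb_words_up_peaksS.
  have peaks0 i := proj1 (IH 0 L erefl i); rewrite add0n in eL; rewrite eL peaks0.
  by case: j => [|[|j]]; rewrite ?peaks0.
have up i := proj2 (IH a b (succn_inj eL) i); rewrite up.
case: b eL up => [|b] eL up.
  have small i : nb_words_peaks false L a.+1 i = 0 by apply: nb_words_peaks_small; move: eL; lia.
  by case: j => [|[|j]]; rewrite ?small /= ?muln0 ?bin0 ?bin1.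
have peaks i : nb_words_peaks false L a.+1 i = compositions a.+1 i * 'C(b.+1, i).
  by apply: (proj1 (IH a.+1 b _ i)); move: eL; lia.
rewrite !peaks -mulnDr compositions_pascal; split=> //.
by case: j => [|j]; rewrite ?muln0 // peaks !compositionsS -mulnDl addnC compositions_pascal.
Qed.

(* Taking the first letter for the one after the end reads the word cyclically. *)
Definition nb_cyclic_words L j : nat :=
  nb_words L (fun s => (2 * nb_ups s == L) && (nb_peaks (head true s) s == j)).

Lemma nb_cyclic_wordsE r j : nb_cyclic_words (2 * r.+1) j = 2 * ('C(r.+1, j) * compositions r.+1 j).
Proof.
have [_ upE] := words_upE (erefl (r + r.+1)) j.
have [downE _] := words_downE (erefl (r.+1 + r)) j.
rewrite /nb_cyclic_words (_ : 2 * r.+1 = (r + r.+1).+1); last by lia.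
rewrite nb_wordsS mul2n -addnn -{1}upE mulnC -downE [r.+1 + r]addnC; congr (_ + _);
  by apply: eq_nb_words => s _ /=; rewrite /nb_ups /=; congr (_ && _); lia.
Qed.

(** * Dyck words counted by peaks *)

Fixpoint dyck (h : nat) (s : seq bool) : bool :=
  match s with
  | [::] => h == 0
  | true :: t => dyck h.+1 t
  | false :: t => (0 < h) && dyck h.-1 t
  end.

Definition nb_dyck L h j : nat := nb_words L (fun s => dyck h s && (nb_peaks false s == j)).
Definition nb_dyck_up L h j : nat :=
  nb_words L (fun s => dyck h s && (~~ head false s + nb_peaks false s == j)).

Lemma nb_dyck0 h j : nb_dyck 0 h j = (h == 0) && (j == 0).
Proof. by rewrite /nb_dyck nb_words0 /= [0 == _]eq_sym. Qed.

Lemma nb_dyckS L h j : nb_dyck L.+1 h j =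
  nb_dyck_up L h.+1 j + (if h is h'.+1 then nb_dyck L h' j else 0).
Proof.
rewrite /nb_dyck nb_wordsS; congr (_ + _).
by case: h => [|h]; [apply: nb_words_eq0 | apply: eq_nb_words => s _].
Qed.

Lemma nb_dyck_upS L h j : nb_dyck_up L.+1 h j =
  nb_dyck_up L h.+1 j +
  (if (h, j) is (h'.+1, j'.+1) then nb_dyck L h' j' else 0).
Proof.
rewrite {1}/nb_dyck_up nb_wordsS; congr (_ + _).
by case: h j => [|h] [|j]; try (by apply: nb_words_eq0 => s _; rewrite /= ?andbF);
  apply: eq_nb_words => s _.
Qed.

Lemma dyck_size h s : dyck h s -> h <= size s.
Proof.
elim: s h => [|[] s IH] h /=; first by move/eqP->.
  by move/IH; lia.
by case/andP=> _ /IH; lia.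
Qed.

Lemma nb_dyck_up_small L h j : L < h -> nb_dyck_up L h j = 0.
Proof.
move=> Lh; apply: nb_words_eq0 => s sL; apply/nandP; left.
by apply: contraTN Lh => /dyck_size; rewrite sL -leqNgt.
Qed.

(** A difference of two products as in the reflection principle, with the subtracted one moved to
    the other side to stay in [nat]. There are [a] letters [true]; an arbitrary initial height is
    what makes the induction on the length close. *)
Lemma dyck_countE L :
  (forall a h j, 2 * a + h = L ->
    nb_dyck L h j + (if a is a'.+1 then 'C(a', j) * 'C((a + h).+1, j) else 0)
      = 'C(a, j) * 'C(a + h, j)) /\
  (forall a h j, 2 * a + h.+1 = L ->
    nb_dyck_up L h.+1 j + (if j is j'.+1 then 'C(a, j) * 'C((a + h).+1, j') else 0)
      = (if j is j'.+1 then 'C(a.+1, j) * 'C(a + h, j') else 0)).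
Proof.
elim: L => [|L [IH IHup]].
  split=> a h j eL; last by lia.
  have [-> ->] : a = 0 /\ h = 0 by lia.
  by rewrite nb_dyck0; case: j.
split=> a h j eL.
  rewrite nb_dyckS; case: a eL => [|a] eL.
    rewrite nb_dyck_up_small; last by move: eL; lia.
    case: h eL => // h eL; have := IH 0 h j; rewrite !add0n !addn0 bin0n => ->; last by lia.
    by case: j => [|j]; rewrite ?bin0.
  have := IHup a h j; rewrite (_ : 2 * a + h.+1 = L); last by move: eL; lia.
  move/(_ erefl).
  case: h eL => [|h] eL.
    rewrite !addn0; case: j => [|j]; first by rewrite !bin0; lia.
    by rewrite !binS; nia.
  have := IH a.+1 h j; rewrite (_ : 2 * a.+1 + h = L); last by move: eL; lia.
  move/(_ erefl); case: j => [|j]; first by rewrite !bin0 => e1 e2; lia.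
  rewrite !addSn !addnS !binS => e1 e2; nia.
rewrite nb_dyck_upS; case: a eL => [|a] eL.
  rewrite nb_dyck_up_small; last by move: eL; lia.
  case: j => [|j] //; have := IH 0 h j; rewrite !add0n !addn0 => ->; last by move: eL; lia.
  by rewrite binS (@bin_small 0 j.+1) // mul0n addn0 add0n.
have := IHup a h.+1 j; rewrite (_ : 2 * a + h.+2 = L); last by move: eL; lia.
move/(_ erefl); case: j => [|j] // e2; first by lia.
have := IH a.+1 h j; rewrite (_ : 2 * a.+1 + h = L); last by move: eL; lia.
move/(_ erefl) => e1; move: e1 e2; rewrite !addSn !addnS (binS a.+1 j) (binS a j) => e1 e2; nia.
Qed.

(* The Narayana numbers, in ballot form. *)
Lemma nb_dyckE a j :
  nb_dyck (2 * a) 0 j + (if a is a'.+1 then 'C(a', j) * 'C(a.+1, j) else 0) = 'C(a, j) ^ 2.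
Proof. by have := (dyck_countE (2 * a)).1 a 0 j; rewrite !addn0 -mulnn; apply. Qed.

Lemma nb_peaks_dyck h e s : dyck h s -> nb_peaks e s = nb_peaks false s.
Proof.
elim: s h => // a s IH h /= ds; have {}IH : nb_peaks e s = nb_peaks false s.
  by case: a ds => [|/andP[_]] /IH.
by rewrite IH; congr (_ + _); case: a s ds {IH} => // -[].
Qed.
End WordCounts.

(** * Matchings fixed by a rotation *)

Section CardRel.
Variables (S T : finType) (A : {set S}) (B : {set T}) (R : S -> T -> Prop).

Lemma leq_card_rel : (forall a, a \in A -> exists2 b, b \in B & R a b) ->
  (forall a a' b, R a b -> R a' b -> a \in A -> a' \in A -> a = a') -> #|A| <= #|B|.
Proof.
move=> AB R_inj; have [->|[a0 a0A]] := set_0Vmem A; first by rewrite cards0.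
have [b0 _ _] := AB a0 a0A.
have [f fP] : exists f : S -> T, forall a, a \in A -> f a \in B /\ R a (f a).
  apply: (@fin_all_exists _ (fun=> T) (fun a b => a \in A -> b \in B /\ R a b)) => a.
  by have [/AB[b]|] := boolP (a \in A); [exists b | exists b0].
rewrite -(@card_in_imset _ _ f A) => [|a a' aA a'A e].
  by apply/subset_leq_card/subsetP => _ /imsetP[a /fP[fB _] ->].
by apply: (R_inj _ _ _ (fP a aA).2 _ aA a'A); rewrite e; apply: (fP a' a'A).2.
Qed.
End CardRel.

(** Bijections are given as relations because [encodes] is one between matchings and words, and
    neither direction has to be made into a function. *)
Lemma card_rel (S T : finType) (A : {set S}) (B : {set T}) (R : S -> T -> Prop) :
  (forall a, a \in A -> exists2 b, b \in B & R a b) ->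
  (forall b, b \in B -> exists2 a, a \in A & R a b) ->
  (forall a a' b, R a b -> R a' b -> a \in A -> a' \in A -> b \in B -> a = a') ->
  (forall a b b', R a b -> R a b' -> a \in A -> b \in B -> b' \in B -> b = b') ->
  #|A| = #|B|.
Proof.
move=> AB BA R_inj R_fun; apply/eqP; rewrite eqn_leq; apply/andP; split.
  apply: (@leq_card_rel _ _ _ _ (fun a b => R a b /\ b \in B)).
    by move=> a /AB[b bB Rab]; exists b.
  by move=> a a' b [Rab bB] [Ra'b _] aA a'A; apply: (R_inj _ _ _ Rab Ra'b aA a'A bB).
apply: (@leq_card_rel _ _ _ _ (fun b a => R a b /\ a \in A)).
  by move=> b /BA[a aA Rab]; exists a.
by move=> b b' a [Rab aA] [Rab' _] bB b'B; apply: (R_fun _ _ _ Rab Rab' aA bB b'B).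
Qed.

Section PeriodicWord.
Variable s : seq bool.

Definition word (x : nat) : bool := nth false s (x %% size s).

Lemma word_period x : word (x + size s) = word x.
Proof. by rewrite /word modnDr. Qed.

Lemma word_small x : x < size s -> word x = nth false s x.
Proof. by move=> xs; rewrite /word modn_small. Qed.
End PeriodicWord.

Lemma height_cons a s j :
  height (nth false (a :: s)) j.+1 = ((if a then 1 else -1) + height (nth false s) j)%R.
Proof. by rewrite /height big_ord_recl. Qed.

Lemma height_nth s : height (nth false s) (size s) = ((2 * nb_ups s)%:Z - (size s)%:Z)%R.
Proof.
elim: s => [|a s IH]; first by rewrite height0.
by rewrite /= height_cons IH /nb_ups /=; case: a; lia.
Qed.

Lemma height_word s j : j <= size s -> height (word s) j = height (nth false s) j.
Proof. by move=> js; apply: height_ext => y yj; apply: word_small; apply: leq_trans yj js. Qed.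

Lemma height_word_size s : height (word s) (size s) = ((2 * nb_ups s)%:Z - (size s)%:Z)%R.
Proof. by rewrite height_word // height_nth. Qed.

Lemma peaks_nth e s :
  \sum_(x < size s) (nth e s x && ~~ nth e s x.+1) = nb_peaks e s.
Proof.
elim: s => [|a s IH]; first by rewrite big_ord0.
by rewrite [size _]/= big_ord_recl /= -nth0 IH.
Qed.

Lemma peaks_word s :
  \sum_(x < size s) (word s x && ~~ word s x.+1) = nb_peaks (head true s) s.
Proof.
rewrite -peaks_nth; apply: eq_bigr => x _.
rewrite word_small // (set_nth_default (head true s)) //; congr (_ && ~~ _).
have [xs|] := ltnP x.+1 (size s); first by rewrite word_small // (set_nth_default (head true s)).
move=> le_x; have e : x.+1 = size s by apply/eqP; rewrite eqn_leq le_x (ltn_ord x).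
have -> : word s x.+1 = nth false s 0 by rewrite /word e modnn.
by rewrite (nth_default _ le_x) nth0; case: (s) x {e le_x} => // -[].
Qed.

Lemma matched_ext W W' x y : W =1 W' -> matched W x y -> matched W' x y.
Proof.
move=> WW' [xy e above]; have hW z : height W' z = height W z by apply: height_ext => w _; rewrite WW'.
by split=> // [|z z_in]; rewrite !hW ?above.
Qed.

Lemma height_mul W r k : (forall x, W (x + r) = W x) ->
  height W (k * r) = (k%:Z * height W r)%R.
Proof.
move=> W_period; have hD x : height W (x + r) = (height W x + height W r)%R.
  elim: x => [|x IH]; first by rewrite height0 add0r.
  by rewrite addSn !heightS IH W_period; lia.
elim: k => [|k IH]; first by rewrite height0 mul0r.
by rewrite mulSn addnC hD IH; lia.
Qed.

Lemma sum_periodic (F : nat -> nat) r d : (forall x, F (x + r) = F x) ->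
  \sum_(x < d * r) F x = d * \sum_(x < r) F x.
Proof.
move=> F_period; elim: d => [|d IH]; first by rewrite mul0n big_ord0.
rewrite mulSn big_split_ord mulSn -IH; congr (_ + _).
by apply: eq_bigr => i _; rewrite /= addnC F_period.
Qed.

Lemma double_gt1 n : 0 < n -> 1 < 2 * n. Proof. by lia. Qed.

Section Counting.
Variables (n : nat) (n_gt0 : 0 < n).
Local Notation N := (2 * n)%N.
Local Notation N_gt1 := (double_gt1 n_gt0).
Local Notation N_gt0 := (ltnW N_gt1).
Local Notation res := (residue N_gt0).
Local Notation c := (cyclic_shift N).
Implicit Type m : {perm 'I_N}.

(** Conjugation by [c ^- r] is the [r]-fold rotation of the root. For [r = N] it is trivial and all
    noncrossing matchings with [k] short chords remain. *)
Definition fixed_matchings r k : {set {perm 'I_N}} :=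
  [set m | [&& noncrossing m, nb_short m == k & (m ^ (c ^- r))%g == m]].

Lemma shift_res r x : (c ^+ r)%g (res x) = res (x + r).
Proof. by apply: val_inj; rewrite [LHS]cyclic_shiftX /= modnDml. Qed.

Lemma conj_shiftP r m : reflect (forall x y, m (res x) = res y -> m (res (x + r)) = res (y + r))
  ((m ^ (c ^- r))%g == m).
Proof.
apply: (iffP eqP) => [e x y mxy | shift].
  have {1}-> : m = (m ^ (c ^+ r))%g by rewrite -[in RHS]e -conjgM mulVg conjg1.
  by rewrite -shift_res permJ mxy shift_res.
apply/permP => i; apply: (@perm_inj _ (c ^+ r)%g).
have := shift i (m i); rewrite !residue_ord -!shift_res !residue_ord => /(_ erefl) <-.
by rewrite -permJ -conjgM mulVg conjg1.
Qed.

Lemma fixed_matchingsP r k m : reflect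
  [/\ noncrossing m, nb_short m = k & forall x y, m (res x) = res y -> m (res (x + r)) = res (y + r)]
  (m \in fixed_matchings r k).
Proof.
rewrite inE; apply: (iffP and3P) => -[nc /eqP s /conj_shiftP f]; by split.
Qed.

Lemma matching_gap m x : noncrossing m -> exists2 l, 0 < l < N & m (res x) = res (x + l).
Proof.
move=> nc; pose W y := res y == res x.
have [l lN e] : exists2 l, l < N & m (res x) = res (x + l).
  exists ((m (res x) + (N - x %% N)) %% N); first by rewrite (ltn_pmod _ N_gt0).
  apply: val_inj; rewrite /= modnDmr -modnDml.
  have xN : x %% N <= N by rewrite ltnW // (ltn_pmod _ N_gt0).
  by rewrite addnCA subnKC // modnDr modn_small.
exists l => //; rewrite lN andbT lt0n; apply: contraTneq (nc_neq nc (res x)) => l0.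
by rewrite e l0 addn0 eqxx.
Qed.

(** A short chord is a peak if its first end opens; the last term accounts for short chords that the
    word orients the long way around. *)
Lemma nb_short_word W m : (forall x, W (x + N) = W x) -> height W N = 0%R ->
    involutive m -> encodes N_gt1 m W ->
  nb_short m = \sum_(x < N) (W x && ~~ W x.+1) + #|[set i : 'I_N | ~~ W i & m i == c i]|.
Proof.
move=> W_period W0 mK em; rewrite /nb_short -!sum1_card [LHS]big_mkcond.
rewrite [X in _ + X]big_mkcond -big_split; apply: eq_bigr => i _; rewrite !inE.
have [Wi|Wi] := boolP (W i); last by case: eqP.
have := encodes_short W_period W0 em Wi; rewrite (residue_ord _ i) => ->.
by case: (W _).
Qed.
Section Rotational.
Variables (r d k : nat).
Hypotheses (rd : d * r = N) (d_gt1 : 1 < d).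

Let r_gt0 : 0 < r. Proof. by case: r rd => //; rewrite muln0; lia. Qed.
Let r_le : r <= n. Proof. by nia. Qed.

(* In a matching without diameters, a half-edge opens its chord when the chord
   is the shorter way around the circle. *)
Definition short_side m (x : nat) : bool := [exists l : 'I_n, m (res x) == res (x + l)].

Lemma short_sideP m x l : 0 < l < N -> m (res x) = res (x + l) -> short_side m x = (l < n).
Proof.
move=> lN mx; apply/existsP/idP => [[l' /eqP]|ln]; last by exists (Ordinal ln); rewrite mx.
rewrite mx => /(@residue_inj _ N_gt0) e; have l'n := ltn_ord l'.
suff : x + l = x + l' by lia.
by apply: e; lia.
Qed.

Lemma short_side_encodes m : m \in fixed_matchings r k ->
  (forall x, m (res x) <> res (x + n)) ->
  [/\ forall x, short_side m (x + r) = short_side m x,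
      forall i : 'I_N, short_side m (m i) = ~~ short_side m i
    & encodes N_gt1 m (short_side m)].
Proof.
move=> m_fix no_diam; have /fixed_matchingsP[nc _ shift] := m_fix.
have flip (i : 'I_N) : short_side m (m i) = ~~ short_side m i.
  have [l lN mi] := matching_gap i nc.
  have ln : l != n by apply/eqP => ln; apply: (no_diam i); rewrite mi ln.
  rewrite (short_sideP lN mi); rewrite residue_ord in mi.
  have mN : 0 < N - l < N by lia.
  rewrite (@short_sideP m (m i) (N - l)) // -?leqNgt; first by lia.
  rewrite residue_ord (ncK nc) mi -[i in LHS](residue_ord N_gt0).
  apply: val_inj; rewrite /= modnDml -addnA subnKC ?modnDr //; lia.
split=> // [x|].
  have [l lN mx] := matching_gap x nc; rewrite (short_sideP lN mx).
  by apply: short_sideP => //; rewrite (shift _ _ mx) addnAC.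
apply: (orientation_encodes _ (ncK nc) flip) => [x|x y x' y' [Wx /andP[xy yx] mx] [Wx' /andP[xy' yx'] mx']].
  rewrite /short_side residue_addN; apply: eq_existsb => l.
  by rewrite addnAC residue_addN.
have short z w : short_side m z -> z < w < z + N -> m (res z) = res w -> w < z + n.
  move=> Wz /andP[zw wz] mz; have wE : w = z + (w - z) by lia.
  move: Wz; rewrite (@short_sideP m z (w - z)); [lia|lia|by rewrite -wE].
(* Two overlapping arcs shorter than [n] span less than one period, so their lifts may not cross. *)
move=> xx' x'y yy'; apply: (nc_nat nc mx mx') => //.
have := short _ _ Wx _ mx; have := short _ _ Wx' _ mx'; lia.
Qed.

Hypothesis no_diameter : forall m x, m \in fixed_matchings r k -> m (res x) <> res (x + n).

Lemma rotational_count : #|fixed_matchings r k| =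
  nb_words r (fun s => (2 * nb_ups s == r) && (d * nb_peaks (head true s) s == k)).
Proof.
have word_pN (s : r.-tuple bool) x : word s (x + N) = word s x.
  by rewrite /word -rd size_tuple addnC modnMDl.
have word_pr (s : r.-tuple bool) x : word s (x + r) = word s x.
  by have := word_period s x; rewrite size_tuple.
have word_height (s : r.-tuple bool) : (2 * nb_ups s == r) = (height (word s) r == 0%R).
  by have := height_word_size s; rewrite size_tuple => ->; lia.
have word_heightN (s : r.-tuple bool) : 2 * nb_ups s == r -> height (word s) N = 0%R.
  by rewrite word_height -rd height_mul // => /eqP ->; rewrite mulr0.
have peaksN (s : r.-tuple bool) :
    \sum_(x < N) (word s x && ~~ word s x.+1) = d * nb_peaks (head true s) s.
  have e := @sum_periodic (fun x => word s x && ~~ word s x.+1) r d.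
  rewrite rd in e; rewrite e; first by rewrite -peaks_word size_tuple.
  by move=> x; rewrite -addSn !word_pr.
(* In a balanced [r]-periodic word every pair of parentheses spans less than [r <= n], so an opening
   letter takes the short way around. The word is therefore determined by the matching. *)
have short_word (s : r.-tuple bool) m x : 2 * nb_ups s == r -> noncrossing m ->
    encodes N_gt1 m (word s) -> word s x = short_side m x.
  move=> s_bal nc em; have sN := word_heightN s s_bal.
  have s_r : height (word s) r = 0%R by apply/eqP; rewrite -word_height.
  have [Wx|Wx] := boolP (word s x).
    have [y mxy mx] := encodes_gap (word_pN s) sN em Wx.
    have yx := matched_lt r_gt0 (word_pr s) s_r mxy; have [xy _ _] := mxy.
    have xE : y = x + (y - x) by lia.
    by rewrite (@short_sideP m x (y - x)); [lia|lia|rewrite -xE].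
  pose z := m (res x).
  have Wz : word s z.
    by rewrite (encodes_flip (word_pN s) sN _ (ncK nc) em) (period_residue _ (word_pN s)).
  have [y mzy mz] := encodes_gap (word_pN s) sN em Wz.
  have yz := matched_lt r_gt0 (word_pr s) s_r mzy; have [zy _ _] := mzy.
  have xy : res x = res y by rewrite -mz residue_ord /z (ncK nc).
  rewrite (@short_sideP m x (N - (y - z))); [lia|lia|].
  rewrite -/z -shift_res xy shift_res -[z in LHS](residue_ord N_gt0).
  by rewrite (_ : y + (N - (y - z)) = z + N) ?residue_addN //; lia.
(* A chord of length 1 fails to be short only if [n = 1], and then it is a diameter. *)
have no_tail m : (forall x, m (res x) <> res (x + n)) ->
    #|[set i : 'I_N | ~~ short_side m i & m i == c i]| = 0.
  move=> nodiam; apply/eqP; rewrite cards_eq0; apply/eqP/setP => i; rewrite !inE.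
  apply/negP => /andP[Wi /eqP mi].
  have mi1 : m (res i) = res (i + 1) by rewrite residue_ord mi -{1}[i](residue_ord N_gt0) cyclic_shift_res addn1.
  have n1 : n = 1.
    by move: Wi; rewrite (short_sideP _ mi1); lia.
  by apply: (nodiam i); rewrite mi1; congr (res (i + _)).
apply: (card_rel (R := fun m (s : r.-tuple bool) => encodes N_gt1 m (word s))).
- move=> m m_fix; have [W_r flip em] := short_side_encodes m_fix (fun x => no_diameter (x := x) m_fix).
  have /fixed_matchingsP[nc m_short shift] := m_fix.
  pose s : r.-tuple bool := [tuple short_side m i | i < r].
  have sE x : word s x = short_side m x.
    rewrite /word size_tuple (_ : x %% r = Ordinal (ltn_pmod x r_gt0)) // nth_mktuple /=.
    by rewrite [in RHS](divn_eq x r) addnC (periodD W_r).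
  have em_s : encodes N_gt1 m (word s).
    by move=> x y /(matched_ext sE); apply: em.
  have s_bal : 2 * nb_ups s == r.
    have hN : height (word s) N = 0%R.
      have W_m (i : 'I_N) : word s (m i) = ~~ word s i by rewrite !sE.
      exact: orientation_balanced W_m.
    have := height_mul d (word_pr s); rewrite rd hN word_height => /esym/eqP.
    by rewrite mulf_eq0 => /orP[/eqP|//]; lia.
  exists s => //; rewrite inE s_bal andTb -(peaksN s) -m_short.
  rewrite (nb_short_word (word_pN s) (word_heightN s s_bal) (ncK nc) em_s).
  rewrite (eq_card (B := [set i : 'I_N | ~~ short_side m i & m i == c i])); last first.
    by move=> i; rewrite !inE sE.
  by rewrite no_tail ?addn0 // => x; apply: no_diameter.
- move=> s; rewrite inE => /andP[s_bal /eqP s_peaks].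
  have [m nc em] := matching_of_word N_gt0 (word_pN s) (word_heightN s s_bal).
  exists m => //; apply/fixed_matchingsP; split=> //.
    rewrite (nb_short_word (word_pN s) (word_heightN s s_bal) (ncK nc) em) peaksN s_peaks.
    rewrite -[RHS]addn0; congr (_ + _); apply/eqP; rewrite cards_eq0; apply/eqP/setP => i.
    rewrite !inE (short_word s m i s_bal nc em); apply/negP => /andP[Wi /eqP mi].
    have mi1 : m (res i) = res (i + 1).
      by rewrite residue_ord mi -{1}[i](residue_ord N_gt0) cyclic_shift_res addn1.
    have n1 : n = 1 by move: Wi; rewrite (short_sideP _ mi1); lia.
    have r1 : r = 1 by have := r_gt0; have := r_le; lia.
    by move: s_bal r1; lia.
  have half x y : word s x -> m (res x) = res y -> m (res (x + r)) = res (y + r).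
    move=> Wx mx; have [z mxz mx'] := encodes_gap (word_pN s) (word_heightN s s_bal) em Wx.
    have := em _ _ (matched_shift (k := r) (fun z _ => word_pr s z) mxz).
    by move=> ->; rewrite -shift_res -mx' mx shift_res.
  move=> x y mx; have [Wx|Wx] := boolP (word s x); first exact: half.
  have my : m (res y) = res x by rewrite -mx (ncK nc).
  rewrite -(half y x _ my) ?(ncK nc) //.
  rewrite -(period_residue N_gt0 (word_pN s)) -mx.
  rewrite (encodes_flip (word_pN s) (word_heightN s s_bal) _ (ncK nc) em).
  by rewrite (period_residue _ (word_pN s)).
- move=> m m' s em em'.
  move=> /fixed_matchingsP[nc _ _] /fixed_matchingsP[nc' _ _]; rewrite inE => /andP[s_bal _].
  exact: (encodes_inj (word_pN s) (word_heightN s s_bal) (ncK nc) (ncK nc') em em').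
move=> m s s' em em' /fixed_matchingsP[nc _ _]; rewrite !inE => /andP[s_bal _] /andP[s'_bal _].
apply: val_inj; apply: (@eq_from_nth _ false); rewrite ?size_tuple // => i ir.
have := short_word s m i s_bal nc em; rewrite -(short_word s' m i s'_bal nc em').
by rewrite !word_small ?size_tuple.
Qed.
End Rotational.
End Counting.

Lemma nb_peaks_cat e s t : nb_peaks e (s ++ t) = nb_peaks (head e t) s + nb_peaks e t.
Proof.
elim: s => //= a s ->; rewrite addnA; congr (_ + _ + _).
by case: s.
Qed.

Lemma dyck_cat h g s t : dyck h s -> dyck (h + g) (s ++ t) = dyck g t.
Proof.
elim: s h => [|[] s IH] h /=; first by move/eqP ->.
  by move/IH => <-.
by case/andP=> h0 /IH <-; rewrite addn_gt0 h0 /=; congr dyck; lia.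
Qed.

Lemma dyckP h s : reflect
  ((forall j, j <= size s -> (0 <= h%:Z + height (nth false s) j)%R) /\
   (h%:Z + height (nth false s) (size s) = 0)%R) (dyck h s).
Proof.
elim: s h => [|a s IH] h.
  rewrite /= height0 addr0; apply: (iffP eqP) => [->|[_ /eqP]]; last by case: h.
  by split=> // j; rewrite leqn0 => /eqP ->; rewrite height0.
have step (g : nat) : (g%:Z = h%:Z + (if a then 1 else -1))%R -> (0 < h) || a ->
    reflect ((forall j, j <= (size s).+1 -> (0 <= h%:Z + height (nth false (a :: s)) j)%R) /\
      (h%:Z + height (nth false (a :: s)) (size s).+1 = 0)%R) (dyck g s).
  move=> gE ha; apply: (iffP (IH g)) => -[pos fin]; split.
  - case=> [|j] js; first by rewrite height0 addr0.
    by rewrite height_cons addrA -gE pos.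
  - by rewrite height_cons addrA -gE.
  - by move=> j js; have := pos j.+1 js; rewrite height_cons addrA -gE.
  - by have := fin; rewrite height_cons addrA -gE.
case: a step => step; first by apply: step; lia.
case: h step => [|h] step; last by apply: step; lia.
rewrite /=; apply: (iffP idP) => // -[/(_ 1 isT)].
by rewrite height_cons height0.
Qed.

(** * Matchings cut open at the root *)

Section LinearWords.
Variables (n : nat) (n_gt1 : 1 < n).
Let n_gt0 : 0 < n := ltnW n_gt1.
Local Notation N := (2 * n)%N.
Local Notation N_gt1 := (double_gt1 n_gt0).
Local Notation N_gt0 := (ltnW N_gt1).
Local Notation res := (residue N_gt0).
Local Notation c := (cyclic_shift N).
Implicit Type m : {perm 'I_N}.

Definition opens m (x : nat) : bool := res x < m (res x).

Lemma opens_period m x : opens m (x + N) = opens m x.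
Proof. by rewrite /opens residue_addN. Qed.

Lemma opens_ord m (i : 'I_N) : opens m i = (i < m i).
Proof. by rewrite /opens residue_ord. Qed.

Lemma opens_flip m : noncrossing m -> forall i : 'I_N, opens m (m i) = ~~ opens m i.
Proof.
move=> nc i; rewrite !opens_ord (ncK nc) -leqNgt ltn_neqAle.
by rewrite (nc_neq nc i : (m i : nat) != i).
Qed.

Lemma opens_nocross m : noncrossing m -> forall x y x' y',
  oriented_arc N_gt0 (opens m) m x y -> oriented_arc N_gt0 (opens m) m x' y' ->
  x < x' -> x' < y -> y < y' -> False.
Proof.
move=> nc x y x' y' [Wx /andP[xy yx] mx] [Wx' /andP[xy' yx'] mx'] xx' x'y yy'.
have block z w : opens m z -> z < w < z + N -> m (res z) = res w -> z %/ N = w %/ N.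
  rewrite /opens => + zw mz; rewrite mz /= => lt.
  have := divn_eq z N; have := divn_eq w N; have := ltn_pmod z N_gt0; have := ltn_pmod w N_gt0.
  move: lt; set zm := z %% N; set wm := w %% N; set zd := z %/ N; set wd := w %/ N; nia.
have e := block _ _ Wx (introT andP (conj xy yx)) mx.
have e' := block _ _ Wx' (introT andP (conj xy' yx')) mx'.
apply: (nc_nat nc mx mx') => //.
have e'' : y' %/ N = x %/ N.
  apply: anti_leq; rewrite -e' (leq_div2r N (ltnW xx')) andbT e.
  by have := leq_div2r N (ltnW x'y).
rewrite {1}(divn_eq y' N) e''; apply: leq_trans (_ : x %/ N * N + N <= _).
  by rewrite ltn_add2l (ltn_pmod _ N_gt0).
by rewrite leq_add2r leq_divM.
Qed.

Lemma opens_encodes m : noncrossing m -> encodes N_gt1 m (opens m).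
Proof.
by move=> nc; apply: (orientation_encodes (opens_period m) (ncK nc) (opens_flip nc) (opens_nocross nc)).
Qed.

Lemma opens_matched m x y : noncrossing m -> x < y < N -> m (res x) = res y -> matched (opens m) x y.
Proof.
move=> nc /andP[xy yN] mx.
apply: (orientation_arc (opens_period m) (ncK nc) (opens_flip nc) (opens_nocross nc)).
split=> //; last by rewrite xy; lia.
by rewrite /opens mx /= !modn_small //; lia.
Qed.

Section DyckWord.
Variable s : seq bool.
Hypotheses (size_s : size s = N) (dyck_s : dyck 0 s).

Lemma dword_period x : word s (x + N) = word s x.
Proof. by rewrite -size_s word_period. Qed.

Lemma dword_ge0 j : j <= N -> (0 <= height (word s) j)%R.
Proof.
rewrite -size_s => js; rewrite height_word //.
by have [/(_ j js)] := dyckP 0 s dyck_s; rewrite add0r.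
Qed.

Lemma dword_balanced : height (word s) N = 0%R.
Proof.
rewrite -{1}size_s height_word //.
by have [_] := dyckP 0 s dyck_s; rewrite add0r.
Qed.

Lemma dword_matched x y : matched (word s) x y -> x < N -> y < N.
Proof.
move=> [xy _ above] xN; rewrite ltnNge; apply/negP => Ny.
have := above N; rewrite xN Ny dword_balanced => /(_ erefl).
by have := dword_ge0 (ltnW xN); lia.
Qed.

Variable m : {perm 'I_N}.
Hypotheses (nc : noncrossing m) (em : encodes N_gt1 m (word s)).

Lemma dword_opens (i : 'I_N) : word s i = (i < m i).
Proof.
have up (j : 'I_N) : word s j -> j < m j.
  move=> Wj; have [y mjy] := encodes_gap dword_period dword_balanced em Wj.
  rewrite residue_ord => ->; have yN := dword_matched mjy (ltn_ord j).
  by rewrite /= modn_small //; case: mjy.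
have [/up-> //|Wi] := boolP (word s i); apply/esym/negbTE.
rewrite -leqNgt ltnW // -{2}(ncK nc i); apply: up.
by rewrite (encodes_flip dword_period dword_balanced _ (ncK nc) em).
Qed.

(** A chord of length 1 is a peak of the word unless it joins [N - 1] to 0 across the cut, where it
    escapes the linear count. *)
Lemma dword_short : nb_short m = nb_peaks true s + (m (res 0) == res N.-1).
Proof.
rewrite (nb_short_word dword_period dword_balanced (ncK nc) em); congr (_ + _).
  have -> : \sum_(x < N) (word s x && ~~ word s x.+1) =
      \sum_(x < size s) (word s x && ~~ word s x.+1) by rewrite size_s.
  by rewrite peaks_word; case: (s) dyck_s => // -[].
have last_i (i : 'I_N) : m i < i -> m i = c i -> i = res N.-1.
  move=> lt_i mi; apply: val_inj; rewrite /= modn_small; last by lia.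
  move: lt_i; rewrite mi cyclic_shiftE; have iN := ltn_ord i.
  by have [lt|ge] := ltnP i.+1 N; [rewrite modn_small //; lia | lia].
have c_last : c (res N.-1) = res 0.
  by rewrite cyclic_shift_res prednK ?N_gt0 //; apply: (residue_addN N_gt0 0).
have small : m (res 0) != res 0 by apply: nc_neq.
have [e|ne] := eqVneq (m (res 0)) (res N.-1).
  rewrite (_ : [set i | _ & _] = [set res N.-1]) ?cards1 //; apply/setP => i; rewrite !inE dword_opens.
  apply/andP/eqP => [[]|->]; last first.
    rewrite c_last -e (ncK nc) eqxx; split=> //.
    by rewrite -leqNgt /= mod0n.
  rewrite -leqNgt leq_eqVlt (negbTE (nc_neq nc i : (m i : nat) != i)) => lt_i /eqP; exact: last_i.
apply/eqP; rewrite cards_eq0; apply/eqP/setP => i; rewrite !inE dword_opens.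
apply/negP => /andP[]; rewrite -leqNgt leq_eqVlt (negbTE (nc_neq nc i : (m i : nat) != i)) => lt_i /eqP mi.
have iE := last_i i lt_i mi; move: mi; rewrite iE c_last => e.
by move: ne; rewrite -e (ncK nc) eqxx.
Qed.
End DyckWord.
End LinearWords.

Lemma dword_first v t : dyck 0 v -> matched (word (true :: v ++ false :: t)) 0 (size v).+1.
Proof.
move=> /dyckP[pos fin]; set s := true :: _.
have size_s : size s = (size v + size t).+2 by rewrite /= size_cat /= addnS.
have h j : j <= size v -> height (word s) j.+1 = (1 + height (nth false v) j)%R.
  move=> jv; rewrite height_word ?size_s ?height_cons; last by lia.
  by congr (_ + _)%R; apply: height_ext => y yj; rewrite nth_cat (leq_trans yj jv).
have Wn : word s (size v).+1 = false.
  by rewrite word_small ?size_s ?ltnS ?ltnS ?leq_addr //= nth_cat ltnn subnn.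
rewrite add0r in fin; split=> //.
  by rewrite heightS h // Wn fin height0.
move=> [|z] // /andP[_ zv]; rewrite h // height0; have := pos z zv; lia.
Qed.

Section FixedChords.
Variables (n : nat) (n_gt1 : 1 < n).
Local Notation n_gt0 := (ltnW n_gt1).
Local Notation N := (2 * n)%N.
Local Notation N_gt1 := (double_gt1 n_gt0).
Local Notation N_gt0 := (ltnW N_gt1).
Local Notation res := (residue N_gt0).
Local Notation c := (cyclic_shift N).
Implicit Type m : {perm 'I_N}.

Lemma first_chord_dyck m l : noncrossing m -> 0 < l < N -> m (res 0) = res l ->
  dyck 0 [seq opens n_gt1 m x | x <- iota 1 l.-1].
Proof.
move=> nc /andP[l0 lN] m0; have m0l : matched (opens n_gt1 m) 0 l.
  by apply: (opens_matched nc _ m0); rewrite l0.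
have [_ e above] := m0l; set v := map _ _.
have size_v : size v = l.-1 by rewrite size_map size_iota.
have h j : j <= l.-1 -> height (opens n_gt1 m) j.+1 = (1 + height (nth false v) j)%R.
  move=> jl; rewrite {1}/height big_ord_recl (matched_opens m0l); congr (_ + _)%R.
  apply: eq_bigr => i _; rewrite (nth_map 0) ?size_iota ?nth_iota //; exact: leq_trans (ltn_ord i) jl.
apply/dyckP; rewrite size_v; split=> [j jl|].
  have := above j.+1; rewrite h // height0; have -> : 0 < j.+1 <= l by lia.
  by move/(_ erefl); lia.
have := h _ (leqnn l.-1); rewrite prednK //.
have := matched_closes m0l; move: e; rewrite heightS height0; case: (opens _ _ l) => //; lia.
Qed.

(** The chord across the cut is itself short, which leaves [k] short chords as the peaks of the
    enclosed Dyck word. *)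
Definition rooted_at_leaf k : {set {perm 'I_N}} :=
  [set m | [&& noncrossing m, nb_short m == k.+1 & m (res 0) == res N.-1]].

Lemma rooted_at_leafE k : #|rooted_at_leaf k| = nb_dyck (2 * n.-1) 0 k.
Proof.
pose w (v : (2 * n.-1).-tuple bool) : seq bool := true :: v ++ [:: false].
have size_w v : size (w v) = N by rewrite /= size_cat size_tuple /=; lia.
have peaks_w (v : (2 * n.-1).-tuple bool) : dyck 0 v -> nb_peaks true (w v) = nb_peaks false v.
  move=> dv; rewrite /w /= nb_peaks_cat /= addn0.
  by case: v dv => -[|[] u] //= u_size _; move: u_size; lia.
have dyck_w (v : (2 * n.-1).-tuple bool) : dyck 0 v -> dyck 0 (w v).
  by move=> dv; apply: etrans (dyck_cat 1 _ dv) _.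
apply: (card_rel (R := fun m v => encodes N_gt1 m (word (w v)))).
- move=> m; rewrite inE => /and3P[nc /eqP m_short /eqP m0].
  have dv := @first_chord_dyck m N.-1 nc _ m0.
  pose v : (2 * n.-1).-tuple bool := [tuple opens n_gt1 m i.+1 | i < 2 * n.-1].
  have nth_v i : i < 2 * n.-1 -> nth false v i = opens n_gt1 m i.+1.
    by move=> iv; rewrite -[i in LHS]/(nat_of_ord (Ordinal iv)) -tnth_nth tnth_mktuple.
  have vE : [seq opens n_gt1 m x | x <- iota 1 N.-1.-1] = v.
    apply: (@eq_from_nth _ false); rewrite size_map size_iota ?size_tuple; first by lia.
    move=> i iN; have iN' : i < 2 * n.-1 by lia.
    by rewrite (nth_map 0) ?size_iota // nth_iota // nth_v.
  rewrite vE in dv; have {}dv : dyck 0 v by apply: dv; lia.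
  have wE x : word (w v) x = opens n_gt1 m x.
    rewrite /word size_w -[in RHS](period_residue N_gt0 (opens_period n_gt1 m)).
    rewrite -[nat_of_ord (res x)]/(x %% N).
    have := ltn_pmod x N_gt0; move: (x %% N) => [|i] iN.
      by rewrite /opens m0 /= modn_small // ?mod0n; lia.
    rewrite -[nth _ _ i.+1]/(nth false (v ++ [:: false]) i) nth_cat size_tuple; have [iv|vi] := ltnP i (2 * n.-1).
      by rewrite nth_v.
    have -> : i.+1 = N.-1 by lia.
    have -> : i - 2 * n.-1 = 0 by lia.
    by rewrite /opens -m0 (ncK nc) m0 /= mod0n.
  have em : encodes N_gt1 m (word (w v)).
    by move=> x y /(matched_ext wE); apply: opens_encodes.
  exists v => //; rewrite inE dv andTb; apply/eqP.
  move: m_short; rewrite (dword_short (size_w v) (dyck_w v dv) nc em) m0 eqxx peaks_w //; lia.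
- move=> v; rewrite inE => /andP[dv /eqP peaks_v].
  have dw := dyck_w v dv.
  have [m nc em] := matching_of_word N_gt0 (dword_period (size_w v)) (dword_balanced (size_w v) dw).
  have m0 : m (res 0) = res N.-1.
    have -> : N.-1 = (size v).+1 by rewrite size_tuple; lia.
    exact: em (dword_first [::] dv).
  exists m => //; rewrite inE nc m0 eqxx andbT /=.
  by rewrite (dword_short (n_gt1 := n_gt1) (size_w v) dw nc em) m0 eqxx peaks_w // peaks_v addn1.
- move=> m m' v em em'; rewrite !inE => /and3P[nc _ _] /and3P[nc' _ _] /andP[dv _].
  have dw := dyck_w v dv.
  exact: (encodes_inj (dword_period (size_w v)) (dword_balanced (size_w v) dw) (ncK nc) (ncK nc') em em').
move=> m v v' em em'; rewrite !inE => /and3P[nc _ _] /andP[dv _] /andP[dv' _].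
have ww' : w v = w v'.
  apply: (@eq_from_nth _ false); rewrite ?size_w // => i iN.
  have := dword_opens (n_gt1 := n_gt1) (size_w v) (dyck_w v dv) nc em (Ordinal iN).
  have := dword_opens (n_gt1 := n_gt1) (size_w v') (dyck_w v' dv') nc em' (Ordinal iN).
  by move=> <-; rewrite !word_small ?size_w.
by case: ww' => /eqP; rewrite !cats1 eqseq_rcons eqxx andbT => /eqP/val_inj.
Qed.
End FixedChords.

(** * Matchings with a diameter at the root *)

Section DiametralChords.
Variables (n : nat) (n_gt1 : 1 < n).
Local Notation n_gt0 := (ltnW n_gt1).
Local Notation N := (2 * n)%N.
Local Notation N_gt1 := (double_gt1 n_gt0).
Local Notation N_gt0 := (ltnW N_gt1).
Local Notation res := (residue N_gt0).
Local Notation c := (cyclic_shift N).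
Implicit Type m : {perm 'I_N}.

Definition centred_at_root k : {set {perm 'I_N}} :=
  [set m in fixed_matchings n n k | m (res 0) == res n].

Lemma half_turnK (i : 'I_N) : (c ^+ n)%g ((c ^+ n)%g i) = i.
Proof.
by rewrite -[i](residue_ord N_gt0) !shift_res -addnA addnn -mul2n residue_addN.
Qed.

(** The diameter separates the other half-edges into two Dyck words, which the half-turn identifies;
    hence the repeated [v] and the doubled number of peaks. As [1 < n], the diameter itself is not
    short. *)
Lemma centred_at_rootE k :
  #|centred_at_root k| = nb_words n.-1 (fun v => dyck 0 v && (2 * nb_peaks false v == k)).
Proof.
pose w (v : n.-1.-tuple bool) : seq bool := true :: v ++ false :: v.
have size_w v : size (w v) = N by rewrite /= size_cat /= size_tuple; lia.
have w0 v : nth false (w v) 0 = true by [].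
have w_n v : nth false (w v) n = false.
  by rewrite -(prednK n_gt0) /= nth_cat size_tuple ltnn subnn.
have w_low v i : i < n.-1 -> nth false (w v) i.+1 = nth false v i.
  by move=> iv; rewrite /= nth_cat size_tuple iv.
have w_high v i : i < n.-1 -> nth false (w v) (i.+1 + n) = nth false v i.
  move=> iv; rewrite addSn /= nth_cat size_tuple ifF; last by lia.
  by rewrite (_ : i + n - n.-1 = i.+1) //; lia.
have peaks_w (v : n.-1.-tuple bool) : dyck 0 v -> nb_peaks true (w v) = 2 * nb_peaks false v.
  move=> dv; rewrite /w /= nb_peaks_cat /= (nb_peaks_dyck true dv) mul2n -addnn.
  by case: v dv => -[|[] u] //= u_size _; move: u_size; lia.
have dyck_w (v : n.-1.-tuple bool) : dyck 0 v -> dyck 0 (w v).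
  by move=> dv; apply: etrans (dyck_cat 1 _ dv) _.
apply: (card_rel (R := fun m v => encodes N_gt1 m (word (w v)))).
- move=> m; rewrite inE => /andP[/(fixed_matchingsP n_gt0)[nc m_short shift] /eqP m0].
  have n_mid : 0 < n < N by lia.
  have dv := first_chord_dyck nc n_mid m0.
  pose v : n.-1.-tuple bool := [tuple opens n_gt1 m i.+1 | i < n.-1].
  have nth_v i : i < n.-1 -> nth false v i = opens n_gt1 m i.+1.
    by move=> iv; rewrite -[i in LHS]/(nat_of_ord (Ordinal iv)) -tnth_nth tnth_mktuple.
  have vE : [seq opens n_gt1 m x | x <- iota 1 n.-1] = v.
    apply: (@eq_from_nth _ false); rewrite size_map size_iota ?size_tuple //.
    by move=> i iN; rewrite (nth_map 0) ?size_iota // nth_iota // nth_v.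
  rewrite vE in dv.
  have low z : z < N -> nat_of_ord (res z) = z by move=> zN; rewrite /= modn_small.
  have opens_n : opens n_gt1 m n = false.
    by rewrite /opens -m0 (ncK nc) m0 !low //; lia.
  have wE x : word (w v) x = opens n_gt1 m x.
    rewrite /word size_w -[in RHS](period_residue N_gt0 (opens_period n_gt1 m)).
    rewrite -[nat_of_ord (res x)]/(x %% N).
    have := ltn_pmod x N_gt0; move: (x %% N) => i iN.
    have [i_n|n_i] := ltnP i n.
      case: i i_n {iN} => [|i] i_n; last by rewrite w_low ?nth_v //; lia.
      by rewrite w0 /opens m0 !low //; lia.
    move: n_i; rewrite leq_eqVlt => /orP[/eqP <-|n_i]; first by rewrite w_n.
    have [j jn iE] : exists2 j, j < n.-1 & i = j.+1 + n by exists (i - n).-1; lia.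
    rewrite iE w_high // nth_v //.
    have jl : nat_of_ord (res j.+1) = j.+1 by rewrite low //; lia.
    have ins : 0 < m (res j.+1) < n.
      have n_low : nat_of_ord (res n) = n by rewrite low //; lia.
      have := nc_inside nc (i := res 0) (j := res j.+1).
      have low0 : nat_of_ord (res 0) = 0 by rewrite low //; lia.
      by rewrite jl m0 n_low low0; apply; lia.
    have := shift j.+1 (m (res j.+1)); rewrite (residue_ord _ (m _)) => /(_ erefl) e.
    by rewrite /opens e jl !low; lia.
  have em : encodes N_gt1 m (word (w v)).
    by move=> x y /(matched_ext wE); apply: opens_encodes.
  exists v => //; rewrite inE dv andTb; apply/eqP.
  move: m_short; rewrite (dword_short (size_w v) (dyck_w v dv) nc em) m0 peaks_w //.
  rewrite -val_eqE /= !modn_small; lia.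
- move=> v; rewrite inE => /andP[dv /eqP peaks_v].
  have dw := dyck_w v dv; have per := dword_period (size_w v).
  have bal := dword_balanced (size_w v) dw.
  have [m nc em] := matching_of_word N_gt0 per bal.
  have m0n := dword_first v dv; rewrite size_tuple (prednK n_gt0) -/(w v) in m0n.
  have m0 : m (res 0) = res n by apply: em.
  have m_n : m (res n) = res 0 by rewrite -m0 (ncK nc).
  have low z : z < N -> nat_of_ord (res z) = z by move=> zN; rewrite /= modn_small.
  exists m => //; rewrite inE m0 eqxx andbT; apply/(fixed_matchingsP n_gt0); split=> //.
    rewrite (dword_short (n_gt1 := n_gt1) (size_w v) dw nc em) m0 peaks_w // peaks_v.
    rewrite -val_eqE /= !modn_small; lia.
  (* Commuting with the half-turn passes from [j] to its partner and to the opposite half-edge, so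
     opening half-edges below [n] suffice. *)
  pose P i := m ((c ^+ n)%g i) = (c ^+ n)%g (m i).
  suff Pall i : P i by move=> x y mx; rewrite -!shift_res (Pall (res x)) mx.
  have Pm j : P j -> P (m j) by rewrite /P => Pj; rewrite -Pj !(ncK nc).
  have Pc j : P j -> P ((c ^+ n)%g j) by rewrite /P => Pj; rewrite Pj !half_turnK.
  have P_up (j : 'I_N) : word (w v) j -> j < n -> P j.
    move=> Wj jn; rewrite /P; have [j0|j_gt0] := posnP j.
      have -> : j = res 0 by apply: val_inj; rewrite /= mod0n.
      rewrite m0 !shift_res add0n m_n; apply: val_inj => /=.
      by rewrite addnn -mul2n modnn mod0n.
    have [y mjy mj] := encodes_gap per bal em Wj; rewrite residue_ord in mj.
    have yn : y < n.
      rewrite ltnNge leq_eqVlt; apply/negP => /orP[/eqP ny|ny].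
        by move: mjy; rewrite -ny => /(matched_inj m0n) j0; rewrite -j0 in j_gt0.
      exact: matched_nocross m0n mjy j_gt0 jn ny.
    have Wshift z : j <= z <= y -> word (w v) (z + n) = word (w v) z.
      move=> /andP[jz zy]; have [z' z'E] : exists z', z = z'.+1 by exists z.-1; lia.
      by rewrite z'E !word_small ?size_w ?w_high ?w_low //; lia.
    have := em _ _ (matched_shift Wshift mjy).
    by rewrite -!shift_res residue_ord mj.
  have P_low (j : 'I_N) : j < n -> P j.
    move=> jn; have [Wj|Wj] := boolP (word (w v) j); first exact: P_up.
    rewrite -(ncK nc j); apply: Pm; apply: P_up.
      by rewrite (encodes_flip per bal _ (ncK nc) em).
    apply: leq_ltn_trans jn; rewrite leqNgt -(dword_opens (n_gt1 := n_gt1) (size_w v) dw nc em).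
    by [].
  have [i_n|n_i] := ltnP i n; first exact: P_low.
  rewrite -(half_turnK i); apply/Pc/P_low.
  rewrite cyclic_shiftX; have iN := ltn_ord i.
  have e : i + n = (i - n) + N by lia.
  by rewrite e modnDr modn_small; lia.
- move=> m m' v em em'; rewrite !inE => /andP[/and3P[nc _ _] _] /andP[/and3P[nc' _ _] _] /andP[dv _].
  have dw := dyck_w v dv.
  exact: (encodes_inj (dword_period (size_w v)) (dword_balanced (size_w v) dw) (ncK nc) (ncK nc') em em').
move=> m v v' em em'; rewrite !inE => /andP[/and3P[nc _ _] _] /andP[dv _] /andP[dv' _].
have ww' : w v = w v'.
  apply: (@eq_from_nth _ false); rewrite ?size_w // => i iN.
  have := dword_opens (n_gt1 := n_gt1) (size_w v) (dyck_w v dv) nc em (Ordinal iN).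
  have := dword_opens (n_gt1 := n_gt1) (size_w v') (dyck_w v' dv') nc em' (Ordinal iN).
  by move=> <-; rewrite !word_small ?size_w.
by case: ww' => /eqP; rewrite eqseq_cat ?size_tuple // => /andP[/eqP/val_inj].
Qed.
End DiametralChords.

Section RotationInvariance.
Variables (n : nat) (n_gt0 : 0 < n).
Local Notation N := (2 * n)%N.
Local Notation N_gt1 := (double_gt1 n_gt0).
Local Notation N_gt0 := (ltnW N_gt1).
Local Notation res := (residue N_gt0).
Local Notation c := (cyclic_shift N).
Implicit Type m : {perm 'I_N}.

Lemma shift_order : (c ^+ N)%g = 1%g.
Proof.
by apply/permP => i; rewrite -[i](residue_ord N_gt0) (shift_res n_gt0) residue_addN perm1.
Qed.

(* Rerooting a tree does not change the underlying tree. *)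
Lemma noncrossing_rotation m : noncrossing m -> noncrossing (m ^ c^-1)%g.
Proof.
move=> nc; have mK := ncK nc.
have [m' nc' e] := @tree_canonical n n_gt0 (next_corner (canonical_map n_gt0 m)) (canonical_tree n_gt0 nc).
suff -> : (m ^ c^-1)%g = m' by [].
apply: (canonical_map_inj _ _ (ncK nc')); last first.
  by move=> x; rewrite -[x](permK c) !permJ mK.
by rewrite -e -rotation_iso_class rotation_canonical.
Qed.

Lemma noncrossing_conj m j : noncrossing m -> noncrossing (m ^ (c ^+ j))%g.
Proof.
move=> nc; have -> : (c ^+ j = (c^-1) ^+ (N.-1 * j))%g.
  apply/eqP; rewrite expgVn eq_mulgV1 invgK -expgD; apply/eqP.
  by rewrite -mulSn prednK ?N_gt0 // expgM shift_order expg1n.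
elim: (N.-1 * j) => [|i IH]; first by rewrite expg0 conjg1.
by rewrite expgSr conjgM; apply: noncrossing_rotation.
Qed.

Lemma nb_short_conj m j : nb_short (m ^ (c ^+ j))%g = nb_short m.
Proof.
rewrite /nb_short -[RHS](card_imset _ (@perm_inj _ (c ^+ j)%g)); apply: eq_card => i.
have comm x : c ((c ^+ j)%g x) = (c ^+ j)%g (c x) by rewrite -!permM -expgSr -expgS.
apply/idP/imsetP => [|[x]]; rewrite !inE; last first.
  by move=> /eqP mx ->; rewrite permJ mx comm.
rewrite -[i](permKV (c ^+ j)%g) permJ comm (inj_eq perm_inj) => mi.
by eexists; [rewrite inE; apply: mi | ].
Qed.

Lemma fixed_matchings_conj r k m j :
  m \in fixed_matchings n r k -> (m ^ (c ^+ j))%g \in fixed_matchings n r k.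
Proof.
rewrite !inE => /and3P[nc s /eqP f]; rewrite noncrossing_conj // nb_short_conj s /=.
have comm : commute (c ^- r)%g (c ^+ j)%g by apply/commute_sym/commuteV/commuteX2.
by rewrite -conjgM -comm conjgM f.
Qed.

Lemma card_chord r k t j :
  #|[set m in fixed_matchings n r k | m (res j) == res (j + t)]|
    = #|[set m in fixed_matchings n r k | m (res 0) == res t]|.
Proof.
have le (a b u : nat) : #|[set m in fixed_matchings n r k | m (res a) == res (a + t)]|
    <= #|[set m in fixed_matchings n r k | m (res (a + u)) == res (a + u + t)]|.
  rewrite -(card_imset _ (conjg_inj (c ^+ u)%g)); apply/subset_leq_card/subsetP => _ /imsetP[m m_in ->].
  move: m_in; rewrite inE => /andP[m_fix /eqP ma].
  by rewrite inE fixed_matchings_conj //= -(shift_res n_gt0) permJ ma (shift_res n_gt0) addnAC.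
apply/eqP; rewrite eqn_leq; apply/andP; split; last by have := le 0 0 j; rewrite !add0n.
(* For the reverse inequality the rotation by [j] is continued until [j] full turns are complete. *)
have jN : j + N.-1 * j = j * N by rewrite -mulSn prednK ?N_gt0 // mulnC.
have e1 : res (j + N.-1 * j) = res 0 by rewrite jN -(residueD N_gt0 0 j).
have e2 : res (j + N.-1 * j + t) = res t by rewrite jN addnC residueD.
by have := le j 0 (N.-1 * j); rewrite e1 e2.
Qed.
End RotationInvariance.

Section FixedCounts.
Variables (n : nat) (n_gt1 : 1 < n).
Local Notation n_gt0 := (ltnW n_gt1).
Local Notation N := (2 * n)%N.
Local Notation N_gt1 := (double_gt1 n_gt0).
Local Notation N_gt0 := (ltnW N_gt1).
Local Notation res := (residue N_gt0).
Local Notation c := (cyclic_shift N).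
Implicit Type m : {perm 'I_N}.

(** Double counting of matchings with a marked short chord: each matching has [k.+1] of them, and by
    [card_chord] all [N] positions contribute equally, in particular the one from [N - 1] to 0. *)
Lemma fixed_count_full k : k.+1 * #|fixed_matchings n N k.+1| = N * nb_dyck (2 * n.-1) 0 k.
Proof.
rewrite -(rooted_at_leafE n_gt1).
have -> : k.+1 * #|fixed_matchings n N k.+1| =
    \sum_(m in fixed_matchings n N k.+1) \sum_(i < N) (m i == c i).
  rewrite mulnC -sum_nat_const; apply: eq_bigr => m /(fixed_matchingsP n_gt0)[_ <- _].
  by rewrite /nb_short -sum1_card big_mkcond; apply: eq_bigr => i _; rewrite inE; case: eqP.
transitivity (\sum_(i < N) #|rooted_at_leaf n_gt1 k|); last by rewrite sum_nat_const card_ord.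
rewrite exchange_big; apply: eq_bigr => i _.
have -> : \sum_(m in fixed_matchings n N k.+1) (m i == c i) =
    #|[set m in fixed_matchings n N k.+1 | m (res i) == res (i + 1)]|.
  rewrite -sum1_card big_mkcond [RHS]big_mkcond; apply: eq_bigr => m _.
  by rewrite inE addn1 -cyclic_shift_res residue_ord; case: (_ \in _); case: eqP.
rewrite card_chord -(card_chord n_gt0 _ _ _ N.-1); apply: eq_card => m; rewrite !inE.
have -> : (m ^ (c ^- N) == m)%g.
  by apply/eqP; rewrite (shift_order n_gt0); apply: etrans (conjg1 m); rewrite invg1.
have -> : res (N.-1 + 1) = res 0 by rewrite addn1 prednK ?N_gt0 //; apply: (residue_addN N_gt0 0).
rewrite andbT -andbA; case nc: (noncrossing m) => //=; congr (_ && _).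
by apply/eqP/eqP => <-; rewrite (ncK nc).
Qed.

Lemma diameter_odd m i : noncrossing m -> m (res i) = res (i + n) -> odd n.
Proof.
move=> nc; wlog i_n : i / i < n.
  move=> low mi; have iN := ltn_pmod i N_gt0; have ri : res i = res (i %% N).
    by rewrite {1}(residue_mod N_gt0 i) residueD.
  have rin : res (i + n) = res (i %% N + n).
    by apply: val_inj; rewrite /= modnDml.
  have [lt|ge] := ltnP (i %% N) n; first by apply: (low (i %% N)); rewrite -?ri -?rin.
  apply: (low (i %% N - n)); first by lia.
  rewrite subnK // -ri -[res i](ncK nc) mi rin.
  have -> : i %% N + n = i %% N - n + N by lia.
  by rewrite residue_addN.
move=> mi; have := opens_matched (n_gt1 := n_gt1) nc (_ : i < i + n < N) mi.
have -> : i < i + n < N by lia.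
by move/(_ isT) => /matched_odd; rewrite addKn.
Qed.

Lemma no_small_diameter r k m i : 0 < r < n -> m \in fixed_matchings n r k ->
  m (res i) <> res (i + n).
Proof.
move=> rn /(fixed_matchingsP n_gt0)[nc _ shift] mi.
have := shift _ _ mi; rewrite addnAC => mi'.
by apply: (nc_nat nc mi mi'); lia.
Qed.

Lemma fixed_count_rotational r d k : d * r = N -> 1 < d -> (r < n) || ~~ odd n ->
  #|fixed_matchings n r k| =
  nb_words r (fun s => (2 * nb_ups s == r) && (d * nb_peaks (head true s) s == k)).
Proof.
move=> rd d_gt1 hyp; apply: (rotational_count (n_gt0 := n_gt0) rd d_gt1) => m i m_fix mi.
have r_gt0 : 0 < r by case: r rd {hyp m_fix} => //; rewrite muln0; lia.
case/orP: hyp => [r_n|/negP]; first by apply: (no_small_diameter _ m_fix mi); rewrite r_gt0.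
by apply; case/(fixed_matchingsP n_gt0): m_fix => nc _ _; apply: diameter_odd mi.
Qed.

(** Each such matching has exactly one diameter: two would cross, and without one [short_side] would
    be a balanced word of odd period [n]. By [card_chord] its [n] possible positions contribute
    equally. *)
Lemma fixed_count_half k : odd n -> #|fixed_matchings n n k| =
  n * nb_words n.-1 (fun v => dyck 0 v && (2 * nb_peaks false v == k)).
Proof.
move=> n_odd; rewrite -(centred_at_rootE n_gt1).
transitivity (\sum_(m in fixed_matchings n n k) \sum_(i < n) (m (res i) == res (i + n))).
  rewrite -sum1_card; apply: eq_bigr => m m_fix.
  have [nc _ shift] := fixed_matchingsP n_gt0 _ _ _ m_fix.
  have unique (i j : nat) : i < n -> j < n -> m (res i) = res (i + n) ->
      m (res j) = res (j + n) -> i = j.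
    move=> i_n jn mi mj; case: (ltngtP i j) => // ij.
      by case: (nc_nat nc mi mj); lia.
    by case: (nc_nat nc mj mi); lia.
  have [/existsP[i /eqP mi]|/existsPn no_diam] := boolP [exists i : 'I_n, m (res i) == res (i + n)].
    rewrite (bigD1 i) //= mi eqxx big1 ?addn0 // => j ji; case: eqP => // mj.
    by case/eqP: ji; apply: val_inj; apply: unique mj mi.
  have {}no_diam x : m (res x) <> res (x + n).
    move=> mx; have rx : res x = res (x %% N) by rewrite {1}(residue_mod N_gt0 x) residueD.
    have xN := ltn_pmod x N_gt0; have rxn : res (x + n) = res (x %% N + n).
      by apply: val_inj; rewrite /= modnDml.
    have [lt|ge] := ltnP (x %% N) n.
      by have := no_diam (Ordinal lt); rewrite /= -rx -rxn mx eqxx.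
    have lt : x %% N - n < n by lia.
    have /negP[] := no_diam (Ordinal lt); rewrite /= subnK // -rx.
    rewrite -(ncK nc (res x)) mx rxn; have -> : x %% N + n = x %% N - n + N by lia.
    by rewrite residue_addN.
  have [W_n flip _] := short_side_encodes (d := 2) (erefl _) isT m_fix no_diam.
  have := height_mul 2 W_n; rewrite (orientation_balanced flip) => /esym/eqP.
  rewrite mulf_eq0 /= => /eqP hn.
  have parity z : exists l : int, height (short_side n_gt0 m) z = (z%:Z - 2 * l)%R.
    elim: z => [|z [l IH]]; first by exists 0%R; rewrite height0.
    by rewrite heightS IH; case: (short_side _ _ z); [exists l | exists (l + 1)%R]; lia.
  have [l hl] := parity n; move: n_odd; lia.
rewrite exchange_big; transitivity (\sum_(i < n) #|centred_at_root n_gt1 k|).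
  apply: eq_bigr => i _.
  rewrite /centred_at_root -(card_chord n_gt0 n k n i) -sum1_card big_mkcond [RHS]big_mkcond.
  by apply: eq_bigr => m _; rewrite inE; case: (_ \in _); case: eqP.
by rewrite sum_nat_const card_ord.
Qed.
End FixedCounts.

(** * Values of the sieving polynomial *)

Section Values.
Local Open Scope ring_scope.

Definition eval_at (q : algC) (P : {poly int}) : algC := (map_poly intr P).[q].

Lemma eval_atM q P P' : eval_at q (P * P') = eval_at q P * eval_at q P'.
Proof. by rewrite /eval_at rmorphM hornerM. Qed.

Lemma eval_atD q P P' : eval_at q (P + P') = eval_at q P + eval_at q P'.
Proof. by rewrite /eval_at rmorphD hornerD. Qed.

Lemma eval_atN q P : eval_at q (- P) = - eval_at q P.
Proof. by rewrite /eval_at rmorphN hornerN. Qed.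

Lemma eval_at1 q : eval_at q 1 = 1.
Proof. by rewrite /eval_at rmorph1 hornerC. Qed.

Lemma eval_atXn q j : eval_at q ('X^j) = q ^+ j.
Proof. by rewrite /eval_at map_polyXn hornerXn. Qed.

Lemma eval_at_qnum q j : eval_at q (qnum 'X j) = qnum q j.
Proof.
by rewrite /eval_at rmorph_qnum /= map_polyX -horner_evalE rmorph_qnum /= horner_evalE hornerX.
Qed.

Lemma eval_at_qbin q m j : eval_at q (qbin 'X m j) = qbin q m j.
Proof.
by rewrite /eval_at rmorph_qbin /= map_polyX -horner_evalE rmorph_qbin /= horner_evalE hornerX.
Qed.

Definition eval_simp := (eval_at_qbin, eval_at_qnum, eval_atM, eval_atD, eval_atN, eval_at1,
  eval_atXn).

Lemma eval_at_int z P : eval_at z%:~R P = P.[z]%:~R.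
Proof. by rewrite /eval_at horner_map. Qed.

(** Compares two determinants for Narayana numbers: the minor behind [narayanaq] at [q = 1] and the
    ballot form of [nb_dyckE]. *)
Lemma narayana_identity M a :
  ('C(M.+1, a.+1) ^ 2 + (if a is a'.+1 then 'C(M, a') else 0) * 'C(M, a.+1) =
   'C(M, a) ^ 2 + 'C(M, a.+1) * 'C(M.+2, a.+1))%N.
Proof.
rewrite -!mulnn; case: a => [|a]; first by rewrite !binS !bin0; nia.
by rewrite [in 'C(M.+2, _)]binS !binS; nia.
Qed.

Lemma narayana_value (R : pzRingType) M a d :
  (d + 'C(M, a.+1) * 'C(M.+2, a.+1) = 'C(M.+1, a.+1) ^ 2)%N ->
  'C(M, a)%:R * 'C(M, a)%:R - (if a is a'.+1 then 'C(M, a') else 0%N)%:R * 'C(M, a.+1)%:R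
    = d%:R :> R.
Proof.
move=> dE; have id := narayana_identity M a.
rewrite -!natrM; apply/eqP; rewrite subr_eq -natrD; apply/eqP; congr (_%:R).
by move: dE id; rewrite mulnn; lia.
Qed.

Section Point.
Variables (a b : nat) (P : {poly int}).
Let n := (a + b).+2.
Let k := a.+2.
Hypothesis PE : (1 + 'X) * P = (1 + 'X^n) * sieving_num a b.

Let n_gt1 : (1 < n)%N. Proof. by []. Qed.

Lemma value_full : eval_at 1 P = #|fixed_matchings n (2 * n) k|%:R.
Proof.
have k_neq0 : k%:R != 0 :> algC by rewrite pnatr_eq0.
apply: (mulfI k_neq0); rewrite -natrM (fixed_count_full n_gt1 a.+1).
rewrite -[1]/(1%:~R) eval_at_int.
have e1 := sieving_poly_one PE.
have -> : k%:R * (P.[1])%:~R = (P.[1] * a.+2%:R)%:~R :> algC.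
  by rewrite mulrC intrM natz -pmulrn.
rewrite e1 -/n; set d := nb_dyck _ _ _; suff -> : (narayanaq a b).[1] = d%:R.
  by rewrite -!natrM natz -pmulrn.
have ev1 m j : (qbin 'X m j : {poly int}).[1] = 'C(m, j)%:R.
  by rewrite -horner_evalE rmorph_qbin /= horner_evalE hornerX qbin_one.
rewrite -(@narayana_value _ (a + b) a d); last by rewrite -[RHS]nb_dyckE.
rewrite /narayanaq hornerD hornerN !hornerM hornerX mul1r !ev1.
by case: (a) => [|a']; rewrite ?horner0 ?mul0r // ev1.
Qed.

Lemma value_half : odd n -> 2.-primitive_root (-1 : algC) ->
  eval_at (-1) P = #|fixed_matchings n n k|%:R.
Proof.
move=> n_odd prim; rewrite fixed_count_half // natrM.
have -> : eval_at (-1) P = n%:R * eval_at (-1) (binq_minor a b).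
  have -> : -1 = (-1)%:~R :> algC by rewrite rmorphN1.
  by rewrite !eval_at_int (sieving_poly_minus1 PE n_odd) intrM natz -pmulrn.
congr (_ * _); rewrite /binq_minor expr2 !eval_simp.
have -> : eval_at (-1) 'X = -1 :> algC by rewrite -['X]expr1 eval_atXn expr1.
rewrite mulN1r opprK mul1r.
(* As [n] is odd, the row [a + b] has last digit 1 in base 2. No digit of a column exceeds it, and
   q-Lucas at -1 reduces every entry to an ordinary binomial of row [m]. *)
have [m abE] : exists m, (a + b = m * 2 + 1)%N.
  by exists (a + b)./2; move: n_odd; rewrite /n /=; lia.
have nE : n.-1 = (2 * m.+1)%N by rewrite /n abE; lia.
rewrite abE nE.
have even j : qbin (-1 : algC) (m * 2 + 1) (j * 2) = 'C(m, j)%:R.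
  by have := qbin_lucas prim m j (isT : (1 < 2)%N) (isT : (0 < 2)%N); rewrite addn0 qbinn0 mulr1.
have odd j : qbin (-1 : algC) (m * 2 + 1) (j * 2 + 1) = 'C(m, j)%:R.
  by have := qbin_lucas prim m j (isT : (1 < 2)%N) (isT : (1 < 2)%N); rewrite qbinnn mulr1.
(* For odd [a] the two products in the minor coincide, and the odd [k] is not twice a number of
   peaks. For even [a] the minor becomes the Narayana minor of row [m]. *)
have [a_odd|a_even] := boolP (ssrnat.odd a).
  rewrite nb_words_eq0; last by move=> s _; apply/nandP; right; rewrite /k; lia.
  have [j aE] : exists j, a = (j * 2 + 1)%N by exists a./2; lia.
  rewrite aE; have -> : (j * 2 + 1).+1 = (j.+1 * 2)%N by lia.
  have -> : (j.+1 * 2).+1 = (j.+1 * 2 + 1)%N by lia.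
  rewrite (_ : (if (j * 2 + 1)%N is a'.+1 then qbin 'X (m * 2 + 1) a' else 0 : {poly int})
    = qbin 'X (m * 2 + 1) (j * 2)); last by rewrite {1}addn1.
  by rewrite eval_at_qbin !even !odd; ring.
have [j aE] : exists j, a = (j * 2)%N by exists a./2; lia.
have -> : nb_words (2 * m.+1) (fun v => dyck 0 v && (2 * nb_peaks false v == k)%N) =
    nb_dyck (2 * m.+1) 0 j.+1.
  by apply: eq_nb_words => s _; rewrite /k aE; congr (_ && _); lia.
rewrite -(@narayana_value _ m j); last exact: nb_dyckE.
rewrite aE; have -> : (j * 2).+2 = (j.+1 * 2)%N by lia.
rewrite -[(j * 2).+1]addn1 !even !odd; congr (_ - _ * _).
case: (j) => [|j']; first by rewrite /eval_at rmorph0 horner0.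
rewrite (_ : (if (j'.+1 * 2)%N is a'.+1 then qbin 'X (m * 2 + 1) a' else 0 : {poly int})
    = qbin 'X (m * 2 + 1) (j' * 2 + 1)); first by rewrite eval_at_qbin odd.
by rewrite mulSn [(j' * 2 + 1)%N]addn1.
Qed.

Lemma value_rotational q r d : (d * r = 2 * n)%N -> (1 < d)%N -> d.-primitive_root q ->
  (r < n)%N || ~~ odd n -> eval_at q P = #|fixed_matchings n r k|%:R.
Proof.
move=> rd d_gt1 prim hyp; rewrite (fixed_count_rotational n_gt1 k rd d_gt1 hyp).
have d_gt0 : (0 < d)%N := ltnW d_gt1.
have product : eval_at q P * qnum q n.+1 =
    (1 + q ^+ n) * (qbin q n.+1 k * qbin q (a + b) a).
  have := congr1 (eval_at q) (sieving_poly_product PE).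
  by rewrite !eval_simp.
have [dn|dn] := boolP (d %| n)%N; last first.
  have q_n : q ^+ n = -1.
    have : (q ^+ n) ^+ 2 == 1.
      by rewrite -exprM -(prim_order_dvd prim) mulnC -rd dvdn_mulr.
    by rewrite sqrf_eq1 -(prim_order_dvd prim) (negbTE dn) => /eqP.
  have r_odd : odd r.
    apply: contraR dn => r_even; apply/dvdnP; exists r./2.
    have rE : (r = 2 * r./2)%N by lia.
    by move: rd; rewrite {1}rE; lia.
  (* Here [q = -1] would mean [d = 2] and [n] odd, so that [r = n], the case excluded by [hyp]. Thus
     [[n+1]_q] is nonzero and [P] vanishes with [1 + q^n]; on the other side a word of odd length
     [r] is never balanced. *)
  have q1 : 1 + q != 0.
    rewrite addrC addr_eq0; apply/eqP => q_1.
    have : (d %| 2)%N by rewrite (prim_order_dvd prim) q_1 sqrrN expr1n.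
    move/dvdn_leq => /(_ isT) d_le; have d2 : d = 2 by apply/eqP; rewrite eqn_leq d_le.
    by move: hyp dn rd; rewrite d2 dvdn2; lia.
  have n1 : qnum q n.+1 != 0.
    apply: contraNneq q1 => n1; have := qnum_geom q n.+1; rewrite n1 mulr0 exprS q_n => /eqP.
    by rewrite mulrN1 opprK eq_sym.
  rewrite nb_words_eq0 => [|s _]; last by apply/nandP; left; lia.
  by apply: (mulIf n1); rewrite product q_n subrr !mul0r.
have /dvdnP[n' nE] := dn.
have n'_gt0 : (0 < n')%N by case: n' nE => //; rewrite mul0n.
have rE : r = (2 * n'.-1.+1)%N by rewrite prednK //; nia.
have q_n : q ^+ n = 1 by apply/eqP; rewrite -(prim_order_dvd prim).
move: product; rewrite qnumSl.
have -> : qnum q n = 0.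
  have /eqP := qnum_geom q n; rewrite q_n subrr mulf_eq0 subr_eq0 eq_sym => /orP[|/eqP //].
  by rewrite -[q]expr1 -(prim_order_dvd prim) dvdn1 => /eqP d1; rewrite d1 in d_gt1.
rewrite mulr0 addr0 mulr1 q_n => ->.
(* The last base-[d] digits of the rows [n + 1] and [a + b] are 1 and [d - 2]. For [s >= 2] the
   first q-binomial vanishes; for [s = 1] the column [a] ends in [d - 1] and the second one does.
   Only multiples of [d] remain, as for the number of peaks. *)
pose j := (k %/ d)%N; pose s := (k %% d)%N; have kE : k = (j * d + s)%N := divn_eq k d.
have sd : (s < d)%N by rewrite ltn_pmod.
have n1E : n.+1 = (n' * d + 1)%N by rewrite nE addn1.
have mE : (a + b = n'.-1 * d + (d - 2))%N by move: nE; rewrite /n -(prednK n'_gt0) mulSn; lia.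
have not_multiple u x : (0 < u < d)%N -> (d * x)%N != (j * d + u)%N.
  case/andP=> u0 ud; apply/eqP => e; have : (d %| j * d + u)%N by rewrite -e dvdn_mulr.
  by rewrite dvdn_addr ?dvdn_mull // => /dvdn_leq; rewrite u0 leqNgt ud => /(_ isT).
rewrite kE n1E qbin_lucas //.
case s01 : s kE sd => [|[|s']] kE sd; last first.
- rewrite (@qbin_small _ _ 1 s'.+2) // mulr0 mul0r mulr0 nb_words_eq0 // => t _.
  by apply/nandP; right; apply: not_multiple.
- have j_gt0 : (0 < j)%N by case: (j) kE => //; rewrite /k; lia.
  have aE : a = (j.-1 * d + d.-1)%N by move: kE; rewrite /k -{1}(prednK j_gt0) mulSn; lia.
  rewrite mE [in qbin q _ a]aE (qbin_lucas prim); [|lia|lia].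
  rewrite (@qbin_small _ _ (d - 2) d.-1) ?mulr0; last by lia.
  rewrite nb_words_eq0 // => t _.
  by apply/nandP; right; apply: not_multiple.
have j_gt0 : (0 < j)%N by case: (j) kE.
have aE : a = (j.-1 * d + (d - 2))%N by move: kE; rewrite /k -{1}(prednK j_gt0) mulSn; lia.
rewrite mE [in qbin q _ a]aE (qbin_lucas prim); [|lia|lia].
rewrite qbinnn qbinn0 !mulr1.
have -> : nb_words r (fun t => (2 * nb_ups t == r) && (d * nb_peaks (head true t) t == j * d + 0))%N
    = nb_cyclic_words r j.
  apply: eq_nb_words => t _; congr (_ && _).
  by rewrite addn0 mulnC eqn_pmul2r.
rewrite rE nb_cyclic_wordsE -[in compositions _ j](prednK j_gt0) compositionsS (prednK n'_gt0) !natrM; ring.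
Qed.
End Point.
End Values.

Section FractionField.
Local Open Scope ring_scope.
Local Notation frac := (@tofrac {poly int}).

Lemma qvarE : qvar = frac 'X. Proof. by []. Qed.

Lemma frac_qnum m : frac (qnum 'X m) = qnum qvar m.
Proof. exact: rmorph_qnum. Qed.

Lemma frac_qbin m j : frac (qbin 'X m j) = qbin qvar m j.
Proof. exact: rmorph_qbin. Qed.

Lemma qnum_qvar_neq0 i : qnum qvar i.+1 != 0.
Proof. by rewrite -frac_qnum tofrac_eq0 qnumX_neq0. Qed.

Lemma qfac_qvar_neq0 i : qfac qvar i != 0.
Proof. by rewrite prodf_seq_neq0; apply/allP => j _; apply: qnum_qvar_neq0. Qed.

Lemma qintE m : qint qvar m = qnum qvar m.
Proof.
have q_neq1 : 1 - qvar != 0.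
  rewrite qvarE -tofrac1 -tofracB tofrac_eq0.
  apply/eqP => /(congr1 (fun p : {poly int} => p.[0])).
  by rewrite hornerD hornerN hornerC hornerX horner0.
by rewrite /qint -qnum_geom mulrC mulKf.
Qed.

Lemma qfactE m : qfact qvar m = qfac qvar m.
Proof. by rewrite /qfact /qfac big_add1 big_mkord; apply: eq_bigr => i _; rewrite qintE. Qed.

Lemma qbinomE m j : qbinom qvar m (Posz j) = qbin qvar m j.
Proof.
rewrite /qbinom lez_nat /= !qfactE; case: leqP => [jm|mj]; last by rewrite qbin_small.
rewrite -{1}(subnKC jm) -qbin_fac subnKC // mulfK //.
by rewrite mulf_neq0 // qfac_qvar_neq0.
Qed.

Lemma qbinom_neg m j : qbinom qvar m (Negz j) = 0.
Proof. by []. Qed.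

Lemma divf_mul_cancel (F : fieldType) (x y z u : F) : u != 0 -> x / u * y * z * u = x * (y * z).
Proof. by move=> u0; field. Qed.

Lemma frac_sieving_poly a b (P : {poly int}) (n := (a + b).+2) :
  (1 + 'X) * P = (1 + 'X^n) * sieving_num a b -> frac P = sieving_fraction n a.+2.
Proof.
move=> PE; rewrite /sieving_fraction /= qintE.
have -> : a.+2%:Z - 2 = a%:Z by lia.
rewrite !qbinomE; apply: (mulIf (qnum_qvar_neq0 (a + b))).
rewrite divf_mul_cancel ?qnum_qvar_neq0 //; have := congr1 frac (sieving_poly_fraction PE).
by rewrite !tofracM tofracD tofrac1 tofracXn frac_qnum !frac_qbin.
Qed.

Lemma sieving_fraction_eq0 n k : (1 < n)%N -> (0 < k)%N -> (k == 1)%N || (n < k)%N ->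
  sieving_fraction n k = 0.
Proof.
rewrite /sieving_fraction; case: n => [|[|n]] //= _ k_gt0.
case/orP=> [/eqP ->|nk]; first by rewrite (_ : 1 - 2 = Negz 0) // qbinom_neg mulr0 mul0r.
by rewrite qbinomE [X in _ * X]qbin_small ?mulr0.
Qed.
End FractionField.

Section SievingPolynomialSpec.

Lemma fixed_matchings_eq0 n r k : 1 < n -> 0 < k -> (k == 1) || (n < k) ->
  #|fixed_matchings n r k| = 0.
Proof.
move=> n_gt1; case: k => // k _ hyp; apply/eqP; rewrite -leqn0.
apply: (@leq_trans #|fixed_matchings n (2 * n) k.+1|).
  apply/subset_leq_card/subsetP => m; rewrite !inE => /and3P[-> -> _].
  by rewrite (shift_order (ltnW n_gt1)) invg1 conjg1 eqxx.
have := fixed_count_full n_gt1 k; suff -> : nb_dyck (2 * n.-1) 0 k = 0 by nia.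
have := nb_dyckE n.-1 k; case: n n_gt1 hyp => [|[|n]] //= _.
case: k => [|k] /=; first by rewrite !bin0; lia.
by rewrite ltnS => nk; rewrite (@bin_small n.+1) // exp0n //; lia.
Qed.

Lemma fixed_matchings_one_edge r k : 0 < k -> #|fixed_matchings 1 r k| = (k == 2).
Proof.
move=> k_gt0; pose c := cyclic_shift (2 * 1).
have two (i : 'I_(2 * 1)) : i < 2 by [].
have c_neq i : c i != i by rewrite -val_eqE /= cyclic_shiftE; have := two i; case: (nat_of_ord i) => [|[]].
have nc_c : noncrossing c.
  apply/andP; split; apply/forallP => i.
    rewrite c_neq /=; apply/eqP/val_inj; rewrite /= !cyclic_shiftE.
    by have := two i; case: (nat_of_ord i) => [|[]].
  by apply/forallP => j; apply/negP => /and3P[]; have := two i; have := two j; have := two (c j); lia.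
have short_c : nb_short c = 2.
  rewrite /nb_short -[RHS]/(2 * 1) -[RHS]card_ord; apply: eq_card => i.
  by rewrite !inE eqxx.
have -> : fixed_matchings 1 r k = if k == 2 then [set c] else set0.
  apply/setP => m; rewrite inE; apply/and3P/idP => [[nc /eqP s _]|].
    have mc : m = c.
      apply/permP => i; apply: val_inj => /=.
      have := nc_neq nc i; have := c_neq i; rewrite -!val_eqE /=.
      by have := two i; have := two (m i); have := two (c i); lia.
    by rewrite -s mc short_c eqxx inE.
  case: eqP => [-> |_]; last by rewrite inE.
  rewrite inE => /eqP ->; split=> //; first by rewrite short_c.
  by apply/eqP/conjg_fixP/commgP/commuteV/commuteX.
by case: (k == 2); rewrite ?cards1 ?cards0.
Qed.

Local Open Scope ring_scope.

Lemma sieving_poly_spec n k : (0 < n)%N -> (0 < k)%N ->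
  exists P : {poly int}, [/\ forall i, 0 <= P`_i, tofrac P = sieving_fraction n k
    & forall q r d, (d * r = 2 * n)%N -> d.-primitive_root q ->
        eval_at q P = #|fixed_matchings n r k|%:R].
Proof.
move=> n_gt0 k_gt0; have [n_gt1|n_le1] := ltnP 1 n; last first.
  have n1 : n = 1%N by apply/eqP; rewrite eqn_leq n_le1.
  exists (k == 2)%:R; rewrite n1; split=> [i||q r d _ _].
  - by rewrite -polyC1 -polyCMn coefC; case: (i == 0)%N; case: (k == 2).
  - by rewrite /sieving_fraction /=; case: (k == 2); rewrite ?tofrac1 ?tofrac0.
  - by rewrite fixed_matchings_one_edge //; case: (k == 2); rewrite /eval_at ?rmorph1 ?rmorph0 ?hornerC.
have [hyp|] := boolP ((k == 1)%N || (n < k)%N).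
  exists 0; split=> [i||q r d _ _]; first by rewrite coef0.
    by rewrite sieving_fraction_eq0 // tofrac0.
  by rewrite fixed_matchings_eq0 // /eval_at rmorph0 horner0.
rewrite negb_or -leqNgt => /andP[k_neq1 kn].
have [a [b [kE nE]]] : exists a b, k = a.+2 /\ n = (a + b).+2.
  by exists (k - 2)%N, (n - k)%N; lia.
have [P PE] := sieving_poly_exists a b.
exists P; rewrite kE nE; split=> [i||q r d rd prim]; first exact: sieving_poly_ge0 PE i.
  exact: frac_sieving_poly.
have d_gt0 := prim_order_gt0 prim.
have [d1|d_gt1] := leqP d 1.
  have d1' : d = 1%N by lia.
  have q1 : q = 1 by have := prim_expr_order prim; rewrite d1' expr1.
  by rewrite q1 (value_full PE); move: rd; rewrite d1' mul1n => ->.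
have [hyp|] := boolP ((r < (a + b).+2)%N || ~~ odd (a + b).+2).
  exact: (value_rotational PE rd d_gt1 prim hyp).
(* The exceptional case [d = 2], [r = n] odd. *)
rewrite negb_or negbK -leqNgt => /andP[r_ge n_odd].
have [d2 rE] : d = 2 /\ r = (a + b).+2 by nia.
rewrite d2 in prim; have q_1 : q = -1.
  have := prim_expr_order prim => /eqP; rewrite sqrf_eq1 => /orP[/eqP q1|/eqP //].
  have := prim_order_dvd prim 1; rewrite q1 expr1 eqxx.
  by [].
by rewrite q_1 rE; apply: (value_half PE n_odd); rewrite -q_1.
Qed.
End SievingPolynomialSpec.

(** * The rotation action *)

Section RotationAction.
Variables (n k : nat) (n_gt0 : 0 < n).
Local Notation N := (2 * n)%N.
Local Notation c := (cyclic_shift N).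
Local Notation canon := (canonical_map n_gt0).

Lemma plane_treesP X : reflect
  (exists2 m, m \in fixed_matchings n N k & X = iso_class (canon m)) (X \in plane_trees n k).
Proof.
have fixedN m : (m \in fixed_matchings n N k) = noncrossing m && (nb_short m == k).
  by rewrite inE (shift_order n_gt0) invg1 conjg1 eqxx andbT.
apply: (iffP imsetP) => [[t]|[m]]; rewrite ?fixedN.
  rewrite inE => /andP[t_tree /eqP t_leaves] ->.
  have [m nc e] := tree_canonical n_gt0 t_tree; exists m => //.
  rewrite fixedN nc /= -(nb_leaves_canonical n_gt0 nc) -t_leaves.
  by have [p ->] := iso_class_eq e; rewrite nb_leaves_relabel.
case/andP=> nc /eqP short_m ->; exists (canon m) => //.
by rewrite inE canonical_tree // nb_leaves_canonical //= short_m.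
Qed.

Lemma rotation_iter m i : noncrossing m ->
  iter i (@rotation n) (iso_class (canon m)) = iso_class (canon (m ^ (c ^- i))%g).
Proof.
move=> nc; elim: i => [|i IH]; first by rewrite expg0 invg1 conjg1.
rewrite iterS IH rotation_canonical; last first.
  by move=> x; rewrite -[x](permK (c ^+ i)%g) !permJ (ncK nc).
by rewrite -conjgM -invMg -expgS.
Qed.

Lemma noncrossing_conjV m i : noncrossing m -> noncrossing (m ^ (c ^- i))%g.
Proof.
move=> nc; elim: i => [|i IH]; first by rewrite expg0 invg1 conjg1.
by rewrite expgS invMg conjgM; apply: noncrossing_rotation.
Qed.

Lemma rotation_plane_trees X : X \in plane_trees n k -> rotation X \in plane_trees n k.
Proof.
case/plane_treesP=> m m_fix ->; apply/plane_treesP; exists (m ^ (c ^- 1))%g.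
  rewrite (_ : (c ^- 1 = c ^+ N.-1)%g) ?fixed_matchings_conj //.
  apply/eqP; rewrite expg1 eq_invg_mul -expgS prednK ?(shift_order n_gt0) //.
  by rewrite muln_gt0.
by have [nc _ _] := fixed_matchingsP n_gt0 _ _ _ m_fix; rewrite -rotation_iter.
Qed.

Definition rotate_tree (t : rooted_plane_tree n k) : rooted_plane_tree n k :=
  exist _ (rotation (val t)) (rotation_plane_trees (valP t)).

Lemma rotate_tree_inj : injective rotate_tree.
Proof.
move=> t t' /(congr1 val) /= e; apply: val_inj => /=.
have /plane_treesP[m /(fixed_matchingsP n_gt0)[nc _ _] tE] := valP t.
have /plane_treesP[m' /(fixed_matchingsP n_gt0)[nc' _ _] t'E] := valP t'.
move: e; rewrite tE t'E !rotation_canonical; try exact: ncK.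
move/canonical_map_inj => e; congr (iso_class (canon _)).
by apply: (conjg_inj (c^-1)%g); apply: e; apply: ncK; apply: noncrossing_rotation.
Qed.

Definition rotation_perm : {perm rooted_plane_tree n k} := perm rotate_tree_inj.

Lemma rotation_permX i t : val ((rotation_perm ^+ i)%g t) = iter i (@rotation n) (val t).
Proof.
elim: i => [|i IH]; first by rewrite expg0 perm1.
by rewrite expgSr permM permE /= IH.
Qed.

Lemma card_rotation_fix i :
  #|[set t | (rotation_perm ^+ i)%g t == t]| = #|fixed_matchings n i k|.
Proof.
have fixE t m : val t = iso_class (canon m) -> noncrossing m ->
    ((rotation_perm ^+ i)%g t == t) = ((m ^ (c ^- i))%g == m).
  move=> tE nc; rewrite -val_eqE rotation_permX tE rotation_iter //.
  apply/eqP/eqP => [/canonical_map_inj|->] //; apply; apply: ncK => //; exact: noncrossing_conjV.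
apply: (card_rel (R := fun t m => val t = iso_class (canon m) /\ noncrossing m)).
- move=> t; rewrite inE => t_fix.
  have /plane_treesP[m /(fixed_matchingsP n_gt0)[nc short_m _] tE] := valP t.
  by exists m => //; rewrite inE nc short_m eqxx -(fixE t m).
- move=> m; rewrite inE => /and3P[nc short_m m_fix].
  have mem_m : iso_class (canon m) \in plane_trees n k.
    apply/plane_treesP; exists m => //.
    by rewrite inE nc short_m (shift_order n_gt0) invg1 conjg1 eqxx.
  by exists (exist (fun X => X \in plane_trees n k) _ mem_m) => //; rewrite inE (fixE _ m).
- by move=> t t' m [tE _] [t'E _] _ _ _; apply: val_inj; rewrite tE t'E.
move=> t m m' [tE nc] [tE' nc'] _ _ _.
by apply: (@canonical_map_inj _ n_gt0); [rewrite -tE tE' | apply: ncK | apply: ncK].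
Qed.

Lemma rotation_perm_order : (rotation_perm ^+ N)%g = 1%g.
Proof.
apply/permP => t; rewrite perm1; apply: val_inj; rewrite rotation_permX.
have /plane_treesP[m /(fixed_matchingsP n_gt0)[nc _ _] ->] := valP t.
by rewrite rotation_iter // (shift_order n_gt0) invg1 conjg1.
Qed.

(** Rotations by [i] and by the gcd generate the same group, by Bezout. This reduces to periods that
    divide [N], for which the values of the polynomial are known. *)
Lemma card_fixed_gcd i : #|fixed_matchings n i k| = #|fixed_matchings n (gcdn i N) k|.
Proof.
have sub j j' m : j %| j' -> (m ^ (c ^- j))%g = m -> (m ^ (c ^- j'))%g = m.
  case/dvdnP=> x -> mj; elim: x => [|x IH]; first by rewrite expg0 invg1 conjg1.
  by rewrite (mulSn x) addnC expgD invMg conjgM mj IH.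
have N_gt0 : 0 < N by rewrite muln_gt0.
apply: eq_card => m; rewrite !inE; congr [&& _, _ & _]; apply/eqP/eqP; last first.
  exact/sub/dvdn_gcdl.
move=> mi; have [x xN dv] := Bezoutr i N_gt0.
have [y e] := dvdnP dv.
have cg : (c ^- (gcdn i N) = c ^+ (x * i))%g.
  by apply/eqP; rewrite eq_invg_mul -expgD e (mulnC y) expgM (shift_order n_gt0) expg1n.
have xi := sub i (x * i) m (dvdn_mull _ (dvdnn i)) mi.
by rewrite cg -[in LHS]xi -conjgM mulVg conjg1.
Qed.
End RotationAction.

Theorem theorem7 (n k : nat) (n_gt0 : 0 < n) (k_gt0 : 0 < k)
    (gT : finGroupType) (G : {group gT}) (g : gT)
    (genG : generator G g) (cardG : #|G| = 2 * n) :
  exists (to : action G (rooted_plane_tree n k)) (P : {poly nat}),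
    [/\ forall t : rooted_plane_tree n k, val (to t g) = rotation (val t),
        qfrac_of_poly P = sieving_fraction n k
      & cyclic_sieving g to P].
Proof.
have GE : G :=: <[g]>%g by apply/eqP.
have order_g : #[g]%g = (2 * n)%N by rewrite -cardG GE.
(* The action need not be faithful; divisibility of the orders is what it takes to send [g] to the
   rotation. *)
have dvd_order : #[rotation_perm k n_gt0]%g %| #[g]%g.
  by rewrite order_g order_dvdn rotation_perm_order.
have sub : G \subset <[g]>%g by rewrite GE.
pose to := (<<eltm_morphism dvd_order>> \ sub)%act.
have toE t i : to t (g ^+ i)%g = ((rotation_perm k n_gt0) ^+ i)%g t.
  by rewrite /to ractE mactE /= eltmE.
have [P [P_ge0 P_frac P_values]] := sieving_poly_spec n_gt0 k_gt0.
pose Pn : {poly nat} := (\poly_(i < size P) absz P`_i)%R.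
have PnE i : (Pn`_i)%R = absz (P`_i)%R.
  rewrite coef_poly; case: ltnP => // size_i; by rewrite nth_default.
exists to, Pn; split.
- by move=> t; rewrite -[g]expg1 toE rotation_permX.
- rewrite -P_frac /qfrac_of_poly; congr (tofrac _); apply/polyP => i.
  by rewrite coef_map_id0 // PnE natz gez0_abs.
split=> // w e w_prim; rewrite cardG in w_prim.
have [a [ga wa]] : exists a : nat, expgz g e = (g ^+ a)%g /\ (w ^ e = w ^+ a)%R.
  case: e => [a|a]; first by exists a.
  (* Both [g] and [w] have order [2 * n], so inverting either is raising it to the power
     [(2 * n).-1]. *)
  exists ((2 * n).-1 * a.+1)%N.
  have N_gt0 : 0 < 2 * n by rewrite muln_gt0.
  split; rewrite /=.
    by apply/eqP; rewrite eq_invg_mul -expgD -mulSn prednK // expgM -order_g expg_order expg1n.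
  have w_unit : (w ^+ a.+1 \is a GRing.unit)%R.
    by rewrite unitrX // -(unitrX_pos _ N_gt0) (prim_expr_order w_prim) unitr1.
  apply: (mulrI w_unit).
  by rewrite mulrV // -exprD addnC -mulSnr prednK // exprM (prim_expr_order w_prim) expr1n.
rewrite ga wa.
have -> : ('Fix_to[g ^+ a])%g = [set t | ((rotation_perm k n_gt0) ^+ a)%g t == t].
  by apply/setP => t; apply/afix1P/idP; rewrite toE inE => /eqP.
rewrite card_rotation_fix (card_fixed_gcd k n_gt0).
(* The order of [w ^+ a] is [2 * n] divided by the gcd, complementary to the period found by
   [card_fixed_gcd]. *)
have := P_values (w ^+ a)%R (gcdn a (2 * n)) ((2 * n) %/ gcdn a (2 * n)).
rewrite divnK ?dvdn_gcdr // => /(_ (erefl _) (exp_prim_root w_prim a)) <-.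
rewrite /eval_at; congr (_.[_])%R; apply/polyP => i.
by rewrite coef_map coef_map_id0 // PnE -[in LHS](gez0_abs (P_ge0 i)) /= -pmulrn.
Qed.
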